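(* The following decision problem is NP-complete: given a connected graph $G$, decide whether $pc(G)=2$. In particular, computing $pc(G)$ for a connected graph $G$ is NP-hard.
   Context: All graphs are finite, simple and undirected. Let $G$ be a nontrivial connected graph with an edge-coloring. A path in $G$ is a proper path if no two adjacent (consecutive) edges of the path receive the same color. An edge-coloring of $G$ is a proper-path coloring if every pair of distinct vertices of $G$ is connected by a proper path. The proper connection number $pc(G)$ is the minimum number of colors in a proper-path coloring of $G$. *)

(* Defs.v *)
From HB Require Import structures.
From mathcomp Require Import all_boot ssralg poly.
From mathcomp Require Import boolp.

Set Implicit Arguments.
Unset Strict Implicit.
Unset Printing Implicit Defensive.

Inductive dir := MoveLeft | Stay | MoveRight.

(* Deterministic machine with [ntapes.+2] two-way infinite tapes.  A cell holds
   [None] (blank), [Some (inl b)] (a bit) or [Some (inr g)] (a work symbol). *)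
Record TM := MkTM {
  ntapes : nat;
  work : finType;
  state : finType;
  start : state;
  halting : pred state;
  accepting : pred state;
  delta : state -> {ffun 'I_ntapes.+2 -> option (bool + work)} ->
          state * {ffun 'I_ntapes.+2 -> option (bool + work) * dir}
}.

Definition symbol (M : TM) : Type := option (bool + work M).

(* The cells left of the head are listed nearest first; all the cells that are
   not listed are blank. *)
Record tape (M : TM) := Tape {
  lefts : seq (symbol M);
  scanned : symbol M;
  rights : seq (symbol M)
}.

Definition write_move (M : TM) (t : tape M) (a : symbol M * dir) : tape M :=
  let: (s, d) := a in
  match d with
  | MoveLeft =>
      Tape (behead (lefts t)) (head None (lefts t)) (s :: rights t)
  | Stay => Tape (lefts t) s (rights t)
  | MoveRight =>
      Tape (s :: lefts t) (head None (rights t)) (behead (rights t))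
  end.

Definition tape_of (M : TM) (x : seq bool) : tape M :=
  let s : seq (symbol M) := [seq Some (inl b) | b <- x] in
  Tape [::] (head None s) (behead s).

Fixpoint bits (A : Type) (s : seq (option (bool + A))) : seq bool :=
  if s is Some (inl b) :: s' then b :: bits s' else [::].

(* The longest string of bits starting at the head. *)
Definition tape_bits (M : TM) (t : tape M) : seq bool :=
  bits (scanned t :: rights t).

Record config (M : TM) := Config {
  cstate : state M;
  ctapes : {ffun 'I_(ntapes M).+2 -> tape M}
}.

(* The i-th input is written on tape i; the other tapes are blank. *)
Definition init (M : TM) (xs : seq (seq bool)) : config M :=
  Config (start M) [ffun i : 'I_(ntapes M).+2 => tape_of M (nth [::] xs i)].

(* Halting configurations are fixed, so that being in a halting state after
   [t] steps means having halted within [t] steps. *)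
Definition step (M : TM) (c : config M) : config M :=
  if halting (cstate c) then c else
  let: (q, a) := delta (cstate c) [ffun i => scanned (ctapes c i)] in
  Config q [ffun i => write_move (ctapes c i) (a i)].

Definition run (M : TM) (xs : seq (seq bool)) (t : nat) : config M :=
  iter t (@step M) (init M xs).

Definition halted (M : TM) (c : config M) : bool := halting (cstate c).
Definition accepted (M : TM) (c : config M) : bool := accepting (cstate c).
Definition output (M : TM) (c : config M) : seq bool :=
  tape_bits (ctapes c ord0).

Definition polytime_fun (f : seq bool -> seq bool) : Prop :=
  exists (M : TM) (p : {poly nat}), forall x,
    let c := run M [:: x] p.[size x]%R in
    halted c /\ output c = f x.

Definition polytime_rel (V : seq bool -> seq bool -> Prop) : Prop :=
  exists (M : TM) (p : {poly nat}), forall x w,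
    let c := run M [:: x; w] p.[(size x + size w)%N]%R in
    halted c /\ (accepted c <-> V x w).

(* [query q = Some q'] makes [q] a query state: in one step the string written
   on tape 1 is replaced by the answer of the oracle, and [q'] is entered. *)
Record oracleTM := MkOracleTM {
  base :> TM;
  query : state base -> option (state base)
}.

Definition ostep (O : seq bool -> seq bool) (M : oracleTM) (c : config M) :
    config M :=
  if halting (cstate c) then c else
  if query (cstate c) is Some q then
    Config q [ffun i : 'I_(ntapes M).+2 =>
      if i == 1 :> nat then tape_of M (O (tape_bits (ctapes c i)))
      else ctapes c i]
  else step c.

Definition orun (O : seq bool -> seq bool) (M : oracleTM)
    (xs : seq (seq bool)) (t : nat) : config M :=
  iter t (@ostep O M) (init M xs).

Definition inNP (L : seq bool -> Prop) : Prop :=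
  exists (V : seq bool -> seq bool -> Prop) (q : {poly nat}),
    polytime_rel V /\
    forall x, L x <-> exists w, size w <= q.[size x]%R /\ V x w.

(* A decision problem is given by its instances and its yes-instances. *)
Record decision_problem := DecisionProblem {
  instance : seq bool -> Prop;
  yes : seq bool -> Prop;
  yes_instance : forall s, yes s -> instance s
}.

(* The reductions are required to produce instances only, here encodings of
   connected graphs. *)
Definition NPhard (P : decision_problem) : Prop :=
  forall L, inNP L ->
  exists f, polytime_fun f /\
    forall x, instance P (f x) /\ (L x <-> yes P (f x)).

Definition NPcomplete (P : decision_problem) : Prop :=
  inNP (yes P) /\ NPhard P.

(* A function problem is the graph of a partial function; an oracle solves it
   if it is right wherever that function is defined, and is otherwise
   unconstrained. *)
Definition solves (O : seq bool -> seq bool)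
    (F : seq bool -> seq bool -> Prop) : Prop :=
  forall s t, F s t -> O s = t.

(* Hardness under polynomial-time Turing reductions; machine and time bound do
   not depend on the oracle. *)
Definition NPhard_fun (F : seq bool -> seq bool -> Prop) : Prop :=
  forall L, inNP L ->
  exists (M : oracleTM) (p : {poly nat}), forall O, solves O F ->
    forall x, let c := orun O M [:: x] p.[size x]%R in
      halted c /\ (accepted c <-> L x).

Record sgraph := SGraph {
  vertex :> finType;
  adj : rel vertex;
  adj_sym : symmetric adj;
  adj_irr : irreflexive adj
}.

Record cgraph := CGraph {
  cgraph_graph :> sgraph;
  cgraph_nontrivial : 1 < #|cgraph_graph|;
  cgraph_connected : forall u v : cgraph_graph, connect (@adj cgraph_graph) u v
}.

(* The edge uv is the set [set u; v]; the values of an edge-coloring on the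
   other sets are irrelevant. *)
Definition edge_coloring (G : sgraph) (k : nat) := {ffun {set G} -> 'I_k}.

(* The vertices of the path are u :: p. *)
Definition proper_path (G : sgraph) (k : nat) (c : edge_coloring G k)
    (u : G) (p : seq G) : bool :=
  [&& path (@adj G) u p, uniq (u :: p)
    & sorted (fun a b => a != b) (pairmap (fun x y => c [set x; y]) u p)].

Definition proper_path_coloring (G : sgraph) (k : nat)
    (c : edge_coloring G k) : Prop :=
  forall u v : G, u != v -> exists p, proper_path c u p /\ last u p = v.

Definition has_proper_path_coloring (G : sgraph) (k : nat) : Prop :=
  exists c : edge_coloring G k, proper_path_coloring c.

(* Pairwise distinct colors make every path proper. *)
Lemma ex_proper_path_coloring (G : cgraph) :
  exists k, `[< has_proper_path_coloring G k >].
Proof.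
exists #|{set G}|; apply/asboolP; exists [ffun e => enum_rank e] => u v _.
have /connectP[p0 /shortenP[p pP pU _] ->] := cgraph_connected u v.
exists p; split=> //; rewrite /proper_path pP pU /=.
elim: p u pU {pP} => [|x [|y p] IH] u //= pU.
case/andP: pU => uN /IH /= ->; rewrite andbT !ffunE (inj_eq enum_rank_inj).
apply/eqP=> /setP/(_ u); rewrite !inE eqxx /=.
by move: uN; rewrite !inE !negb_or => /and3P[/negPf-> /negPf-> _].
Qed.

Definition pc (G : cgraph) : nat := ex_minn (ex_proper_path_coloring G).

(* 1^n 0 followed by the n x n adjacency matrix, row by row. *)
Definition encode (G : sgraph) : seq bool :=
  nseq #|G| true ++ false :: [seq adj u v | u <- enum G, v <- enum G].

Definition pc_eq2_instance (s : seq bool) : Prop :=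
  exists G : cgraph, s = encode G.

Definition pc_eq2_yes (s : seq bool) : Prop :=
  exists G : cgraph, s = encode G /\ pc G = 2.

Lemma pc_eq2_yes_instance s : pc_eq2_yes s -> pc_eq2_instance s.
Proof. by case=> G [-> _]; exists G. Qed.

Definition pc_eq2 : decision_problem := DecisionProblem pc_eq2_yes_instance.

(* Unary output costs only a polynomial factor: pc is at most the number of
   edges. *)
Definition pc_fun (s t : seq bool) : Prop :=
  exists G : cgraph, s = encode G /\ t = nseq (pc G) true.

(* Main.v *)
(* Membership in NP: a certificate lists a 2-coloring and one alternating path
   for every ordered pair of vertices; moreover pc = 2 excludes pc = 1, that is,
   complete graphs.

   Hardness: Cook-Levin turns the verifier of an NP problem into clauses, and
   the clauses into a graph.  The graph has four hubs joined to each other and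
   to all "hosts", and "guests" having three neighbors (hosts or guests) and
   two pendant leaves.  In a proper-path 2-coloring the two leaves of a guest
   have different colors and its three other edges do not all have the same
   color.  So one of them, the stem, differs in color from the two others, and
   one leaf can leave only through it.  Stems must lead to hosts, adjacent
   guests have stems of the same color, and two stems arriving at the same host
   have different colors.  Conversely, these constraints suffice, as the hubs
   connect any two hosts by paths with any prescribed first and last colors.
   The choice of stems under these constraints expresses satisfiability.

   Polynomial time: a small language of arithmetic expressions with bounded
   sums over the bits of the input is compiled to Turing machines; as nesting is
   fixed, evaluation in unary takes polynomial time.  The reduction and the
   verifier are both written as such expressions.  An oracle for pc answers 2,
   in unary, on the reduced graph if and only if the input is accepted. *)
Require Import Defs.
From mathcomp Require Import all_boot ssralg poly boolp zify.
Set Implicit Arguments.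
Unset Strict Implicit.
Unset Printing Implicit Defensive.

(** * Two-colorings as alternating paths *)

(** The reduced graph has two descriptions. Colorings are analysed on vertices built from sums and
    products of finite types; a machine must produce the bit of the encoding at a given position, so
    the tableau, its clauses and the adjacency are also closed formulas on mixed-radix indices.
    Numberings tie the two together, and follow the order of [enum] because [encode] does.

    Adjacent guests can only express equality, and shared hosts only inequality. A guest tied to
    another guest has two hosts left to choose from: hence clauses are broken into short
    implications linked by auxiliary signals. These constraints are invariant under exchanging the
    two colors, so truth itself is a signal, to which the others are compared.

    The width of the clauses depends on the verifying machine only, so it is a constant of the
    expressions that compute the reduction. *)

Lemma map_pairmap (S T U : Type) (h : T -> U) (f : S -> S -> T) u p :
  [seq h a | a <- pairmap f u p] = pairmap (fun x y => h (f x y)) u p.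
Proof. by elim: p u => //= x p IH u; rewrite IH. Qed.

Section TwoColorings.
Variable G : sgraph.
Implicit Types (f : G -> G -> bool) (u v : G) (p : seq G).

Definition alt_path f u p : bool :=
  [&& path (@adj G) u p, uniq (u :: p)
    & sorted (fun a b => a != b) (pairmap f u p)].

Definition alt_connected f : Prop :=
  forall u v, u != v -> exists p, alt_path f u p /\ last u p = v.

(** Paths as functions on indices: forced first and last steps, reversal and coincidence of
    positions become arithmetic. *)
Lemma alt_pathP f u v :
  (exists p, alt_path f u p /\ last u p = v) <->
  exists n (s : nat -> G), [/\ s 0 = u, s n = v,
    forall i, i < n -> adj (s i) (s i.+1),
    forall i, i.+1 < n -> f (s i) (s i.+1) != f (s i.+1) (s i.+2)
    & forall i j, i < j <= n -> s i != s j].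
Proof.
split=> [[p [/and3P[pP pU pS] <-]]|[n [s [<- <- sA sC sI]]]].
  exists (size p), (fun i => nth u (u :: p) i); split=> //.
  - by rewrite -nth_last /=; case: (p).
  - by move=> i ip; apply: (pathP u pP).
  - move=> i ip; move/(sortedP true)/(_ i): pS.
    rewrite size_pairmap => /(_ ip).
    by rewrite (nth_pairmap u) ?(ltnW ip) // (nth_pairmap u).
  - by move=> i j /andP[ij jp]; rewrite nth_uniq //=; lia.
exists [seq s i.+1 | i <- iota 0 n].
have En i m : nth (s 0) (s 0 :: [seq s i.+1 | i <- iota 0 m]) i
            = if i <= m then s i else s 0.
  case: i => [|i] /=; first by [].
  case: ltnP => im; last by rewrite nth_default // size_map size_iota.
  by rewrite (nth_map 0) ?size_iota // nth_iota.
have Em i m : i < m -> nth (s 0) [seq s i.+1 | i <- iota 0 m] i = s i.+1.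
  by move=> im; rewrite (nth_map 0) ?size_iota // nth_iota.
split; last first.
  by rewrite -nth_last size_map size_iota; case: (n) => [|m] //; rewrite Em.
apply/and3P; split.
- apply/(pathP (s 0)) => i; rewrite size_map size_iota => lin.
  by rewrite En (ltnW lin) Em //; apply: sA.
- apply/(uniqP (s 0)) => i j; rewrite !inE /= size_map size_iota => li lj.
  rewrite !En -ltnS li -ltnS lj => /eqP E; apply/eqP; apply: contraLR E => E.
  case: (ltngtP i j) E => // ij _; first by apply: sI; lia.
  by rewrite eq_sym; apply: sI; lia.
- apply/(sortedP true) => i; rewrite size_pairmap size_map size_iota => lin.
  have lin' := ltnW lin.
  rewrite !(nth_pairmap (s 0)) ?size_map ?size_iota // !En !Em //.
  by rewrite lin' (ltnW lin'); apply: sC.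
Qed.

Lemma ord2_eqE (a b : 'I_2) : (a == b) = ((a == ord0) == (b == ord0)).
Proof.
by case: a b => [[|[|a]] ha] [[|[|b]] hb] //; rewrite -!(inj_eq val_inj).
Qed.

Lemma sorted_neq_map (c : seq 'I_2) :
  sorted (fun a b => a != b) [seq a == ord0 | a <- c]
  = sorted (fun a b => a != b) c.
Proof.
rewrite sorted_map; apply: eq_sorted => a b /=.
by rewrite [in RHS]ord2_eqE.
Qed.

Lemma two_coloringP : has_proper_path_coloring G 2 <->
  exists f : G -> G -> bool, (forall x y, f x y = f y x) /\ alt_connected f.
Proof.
split=> [[c cP]|[f [fC fP]]].
  exists (fun x y => c [set x; y] == ord0); split=> [x y|u v uv].
    by rewrite setUC.
  have [p [/and3P[pP pU pS] pl]] := cP u v uv.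
  exists p; split=> //; rewrite /alt_path pP pU /=.
  by move: pS; rewrite -sorted_neq_map map_pairmap.
pose col (x y : G) : 'I_2 := if f x y then ord0 else ord_max.
(* A coloring sees only the set of ends, so some pair forming it is picked; symmetry of [f] makes
   the order of the pair harmless. *)
pose c : edge_coloring G 2 := [ffun S : {set G} =>
  if [pick q : G * G | (q.1 != q.2) && (S == [set q.1; q.2])] is Some q
  then col q.1 q.2 else ord0].
have cE x y : x != y -> c [set x; y] = col x y.
  move=> xy; rewrite ffunE; case: pickP => [[a b] /= /andP[ab /eqP E]|]; last first.
    by move/(_ (x, y)); rewrite /= xy eqxx.
  have : a \in [set x; y] by rewrite E !inE eqxx.
  have : b \in [set x; y] by rewrite E !inE eqxx orbT.
  rewrite !inE => /orP[]/eqP Eb /orP[]/eqP Ea; move: ab;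
    rewrite Ea Eb ?eqxx // => _.
  by rewrite /col fC.
exists c => u v uv; have [p [/and3P[pP pU pS] pl]] := fP u v uv.
exists p; split=> //; rewrite /proper_path pP pU /=.
rewrite -sorted_neq_map map_pairmap.
suff -> : pairmap (fun x y => c [set x; y] == ord0) u p = pairmap f u p by [].
elim: p u pU {uv pl pS pP} => //= x p IH u /andP[uN /IH ->].
congr cons; rewrite cE; last by apply: contraNneq uN => ->; rewrite inE eqxx.
by rewrite /col; case: (f u x).
Qed.

(** Recording both end colors makes paths composable: a junction then only asks for opposite colors
    and disjointness. *)
Definition alink f u p a b : bool :=
  [&& alt_path f u p, p != [::], head a (pairmap f u p) == a
    & last b (pairmap f u p) == b].

Lemma alink_cat f u p q a b c :
  alink f u p a b -> alink f (last u p) q (~~ b) c ->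
  ~~ has [in u :: p] q -> alink f u (p ++ q) a c.
Proof.
case/and4P=> /and3P[pP pU pS] p0 ph pl.
case/and4P=> /and3P[qP qU qS] q0 qh ql dis.
apply/and4P; split.
- apply/and3P; split; first by rewrite cat_path pP.
    rewrite -cat_cons cat_uniq pU dis /=.
    by case/andP: qU.
  rewrite pairmap_cat.
  case: (q) qS qh q0 => // y q' /= qS qh _.
  case: (p) pS pl p0 qS qh => // x p' /= pS /eqP pl _ qS /eqP qh.
  by rewrite cat_path pS /= qS andbT pl qh; case: (b).
- by case: (p) p0.
- by rewrite pairmap_cat; case: (p) p0 ph.
- by rewrite pairmap_cat last_cat; case: (q) q0 ql.
Qed.

Lemma pairmap_rev f u p : (forall x y, f x y = f y x) ->
  pairmap f (last u p) (rev (belast u p)) = rev (pairmap f u p).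
Proof.
move=> fC; elim: p u => //= x p IH u.
rewrite !rev_cons -!cats1 pairmap_cat IH /= !cats1.
congr (rcons _ _); rewrite fC; congr (f _ _).
by case: p {IH} => [|y p] //=; rewrite rev_cons last_rcons.
Qed.

Lemma alink_rev f u p a b : (forall x y, f x y = f y x) ->
  alink f u p a b -> alink f (last u p) (rev (belast u p)) b a.
Proof.
move=> fC /and4P[/and3P[pP pU pS] p0 ph pl]; apply/and4P; split.
- apply/and3P; split.
  + by rewrite rev_path; under eq_path => x y do rewrite adj_sym.
  + by rewrite -rev_rcons -lastI rev_uniq.
  + rewrite pairmap_rev // rev_sorted.
    by under eq_sorted => x y do rewrite eq_sym.
- by case: (p) p0 => // x q _; rewrite -size_eq0 size_rev.
- rewrite pairmap_rev //; case/lastP: (pairmap f u p) pl => [|s x] //.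
  by rewrite last_rcons rev_rcons.
- rewrite pairmap_rev //; case: (pairmap f u p) ph => [|x s] //.
  by rewrite rev_cons last_rcons.
Qed.

End TwoColorings.

(** * The graph of hubs, hosts, guests and leaves *)

Section Gadget.
Variables (G H : finType) (nb : G -> 'I_3 -> G + H).

Definition gadget_vertex : finType := (('I_4 + H) + (G + G * 'I_2))%type.
Notation V := gadget_vertex.
Notation Hub c := (inl (inl c) : V).
Notation Host h := (inl (inr h) : V).
Notation Guest g := (inr (inl g) : V).
Notation Leaf g b := (inr (inr (g, b)) : V).

Definition nbv g i : V :=
  match nb g i with inl k => Guest k | inr h => Host h end.

(** Edges may be listed from one end only, since [gadget_adj] symmetrizes; this one-sided form is
    what is computed later on vertex numbers. *)
Definition gadget_adj0 (x y : V) : bool :=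
  match x, y with
  | inl (inl c), inl (inl d) => c != d
  | inl (inl _), inl (inr _) => true
  | inr (inl g), inr (inr (k, _)) => g == k
  | inr (inl g), _ => [exists i, nbv g i == y]
  | _, _ => false
  end.

Definition gadget_adj (x y : V) : bool := gadget_adj0 x y || gadget_adj0 y x.

Lemma gadget_adj_sym : symmetric gadget_adj.
Proof. by move=> x y; rewrite /gadget_adj orbC. Qed.

Hypothesis nb_inj : forall g, injective (nb g).
Hypothesis nb_sym :
  forall g i k, nb g i = inl k -> exists j, nb k j = inl g.
Hypothesis nb_irr : forall g i, nb g i != inl g.

Lemma gadget_adj_irr : irreflexive gadget_adj.
Proof.
move=> x; rewrite /gadget_adj orbb.
case: x => [[c|h]|[g|[g b]]] //=; first by rewrite eqxx.
apply/existsP=> -[i /eqP]; rewrite /nbv.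
by have := nb_irr g i; case: (nb g i) => // k /eqP kN [E]; rewrite E in kN.
Qed.

Definition gadget_graph : sgraph := SGraph gadget_adj_sym gadget_adj_irr.

Lemma adj_nbv g i : gadget_adj (Guest g) (nbv g i).
Proof.
apply/orP; left; rewrite /= -/(nbv g i).
case E: (nbv g i) => [[c|h]|[k|[k b]]] /=; try by apply/existsP; exists i; rewrite E.
by move: E; rewrite /nbv; case: (nb g i).
Qed.

Lemma adj_leaf g b x : gadget_adj (Leaf g b) x = (x == Guest g).
Proof.
rewrite /gadget_adj /=; case: x => [[c|h]|[k|[k b']]] //=.
Qed.

Lemma adj_guestP g x : gadget_adj (Guest g) x ->
  (exists i, x = nbv g i) \/ (exists b, x = Leaf g b).
Proof.
case/orP; case: x => [[c|h]|[k|[k b']]] //=.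
- by case/existsP=> i /eqP <-; left; exists i.
- by case/existsP=> i /eqP <-; left; exists i.
- by case/existsP=> i /eqP <-; left; exists i.
- by move/eqP <-; right; exists b'.
- case/existsP=> i /eqP; rewrite /nbv; case E: (nb k i) => [g'|] // [Eg].
  rewrite {}Eg in E; have [j Ej] := nb_sym E.
  by left; exists j; rewrite /nbv Ej.
Qed.

(* [s g] is the host at the end of the stem of [g], [i g] its index among the
   neighbors of [g], and [y g] the color of the stem. *)
Definition stable_choice : Prop :=
  exists (y : G -> bool) (s : G -> H) (i : G -> 'I_3),
    [/\ forall g, nb g (i g) = inr (s g),
        forall g j k, nb g j = inl k -> y g = y k
      & forall g k, g != k -> s g = s k -> y g != y k].

(** * Necessity: stems forced by an arbitrary 2-coloring *)

Section Necessity.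
Variable f : V -> V -> bool.
Hypothesis fC : forall x y, f x y = f y x.
Hypothesis fP : @alt_connected gadget_graph f.

Lemma alt_seq u v : u != v -> exists n (s : nat -> V),
  [/\ s 0 = u, s n = v,
    forall i, i < n -> gadget_adj (s i) (s i.+1),
    forall i, i.+1 < n -> f (s i) (s i.+1) != f (s i.+1) (s i.+2)
    & forall i j, i < j <= n -> s i != s j].
Proof.
move=> uv; have [p pP] := fP uv.
have [/(_ (ex_intro _ p pP)) [n [s sP]] _] := @alt_pathP gadget_graph f u v.
by exists n, s.
Qed.

Let l g b := f (Leaf g b) (Guest g).
Let e g i := f (Guest g) (nbv g i).

Lemma nbv_leaf g i k b : nbv g i != Leaf k b.
Proof. by rewrite /nbv; case: (nb g i). Qed.

Lemma nbv_guest g i : nbv g i != Guest g.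
Proof. by rewrite /nbv; have := nb_irr g i; case: (nb g i). Qed.

(** A leaf has a single neighbor, so the path between the two leaves is the one of length 2 through
    their guest. *)
Lemma leaf_colors g : l g ord0 != l g ord_max.
Proof.
have [|n [s [s0 sn sA sC sI]]] := @alt_seq (Leaf g ord0) (Leaf g ord_max).
  by apply/eqP => -[].
have n0 : 0 < n by case: (n) sn => //; rewrite s0.
have s1 : s 1 = Guest g by have := sA 0 n0; rewrite s0 adj_leaf => /eqP.
have nE : s n.-1 = Guest g.
  have := sA n.-1; rewrite prednK // leqnn sn => /(_ isT).
  by rewrite gadget_adj_sym adj_leaf => /eqP.
have n2 : n = 2.
  case: (ltngtP 1 n.-1) => [lt|lt|]; last by lia.
    by have := sI 1 n.-1; rewrite s1 nE eqxx lt leq_pred => /(_ isT).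
  have n1 : n = 1 by lia.
  by rewrite n1 s1 in sn.
have := sC 0; rewrite n2 => /(_ isT).
by rewrite n2 in sn; rewrite s0 s1 sn /l (fC (Leaf g ord_max)).
Qed.

Lemma leaf_color g c : exists b, l g b = c.
Proof.
have := leaf_colors g; case E: (l g ord0) => H0; case: c.
- by exists ord0.
- by exists ord_max; move: H0; case: (l _ _).
- by exists ord_max; move: H0; case: (l _ _).
- by exists ord0.
Qed.

(** The other leaf is a dead end, so a path that gets away from the guest and its leaves must use
    one of the three core edges. *)
Lemma leaf_step g b n (s : nat -> V) :
  s 0 = Leaf g b ->
  (forall i, i < n -> gadget_adj (s i) (s i.+1)) ->
  (forall i, i.+1 < n -> f (s i) (s i.+1) != f (s i.+1) (s i.+2)) ->
  (forall i j, i < j <= n -> s i != s j) ->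
  s n != Leaf g b -> s n != Guest g -> (forall b', s n != Leaf g b') ->
  [/\ 1 < n, s 1 = Guest g & exists2 i, s 2 = nbv g i & e g i != l g b].
Proof.
move=> s0 sA sC sI n0 nG nL.
have n_gt0 : 0 < n by case: (n) n0 => //; rewrite s0 eqxx.
have s1 : s 1 = Guest g by have := sA 0 n_gt0; rewrite s0 adj_leaf => /eqP.
have n_gt1 : 1 < n.
  by case: (n) n_gt0 nG => [|[|m]] //; rewrite s1 eqxx.
split=> //.
have := sA 1 n_gt1; rewrite s1 => /adj_guestP[[i s2]|[b' s2]].
  by exists i => //; have := sC 0 n_gt1; rewrite s0 s1 s2 /l /e eq_sym.
case: (ltngtP 2 n) => [n3||n2]; [|by lia|by have := nL b'; rewrite -n2 s2 eqxx].
have := sA 2 n3; rewrite s2 adj_leaf => /eqP s3.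
by have := sI 1 3; rewrite s1 s3 eqxx n3 => /(_ isT).
Qed.

(** The leaf of color [c] reaches the rest of the graph only over a core edge of the other color. *)
Lemma core_colors g c : exists i, e g i != c.
Proof.
have [b bc] := leaf_color g c.
have [|n [s [s0 sn sA sC sI]]] := @alt_seq (Leaf g b) (nbv g ord0).
  by rewrite eq_sym nbv_leaf.
have [||b'|_ _ [i _ iP]] := leaf_step s0 sA sC sI; rewrite ?sn ?nbv_leaf ?nbv_guest //.
by exists i; rewrite -bc.
Qed.

(** Both colors occur on three edges, so one of them occurs exactly once. *)
Lemma stem_exists g : exists i, forall j, j != i -> e g j = ~~ e g i.
Proof.
have [i ic] := core_colors g true; have [j jc] := core_colors g false.
have ij : i != j by apply: contraTneq ic => ->; move: jc; case: (e g j).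
(* [k] is the third index; its color decides whether [i] or [j] is alone. *)
have [k [ki kj all3]] : exists k, [/\ k != i, k != j & forall x, [|| x == i, x == j | x == k]].
  by case: i j ij {ic jc} => [[|[|[|i]]] hi] [[|[|[|j]]] hj] //= _;
   (try by exists (@Ordinal 3 0 isT); split=> // -[[|[|[|x]]] hx]);
   (try by exists (@Ordinal 3 1 isT); split=> // -[[|[|[|x]]] hx]);
   (try by exists (@Ordinal 3 2 isT); split=> // -[[|[|[|x]]] hx]).
have iF : e g i = false by move: ic; case: (e g i).
have jT : e g j = true by move: jc; case: (e g j).
case kE: (e g k).
- exists i => x xi; have := all3 x; rewrite (negPf xi) iF /=.
  by case/orP=> /eqP ->.
- exists j => x xj; have := all3 x; rewrite (negPf xj) jT /=.
  by case/orP=> /eqP ->.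
Qed.

Definition stem_spec g i := forall j, j != i -> e g j = ~~ e g i.

(* The leaf of [g] whose color differs from that of the stem can only leave
   through the stem. *)
Lemma stem_path g i n (s : nat -> V) :
  stem_spec g i -> forall b, l g b = ~~ e g i ->
  s 0 = Leaf g b ->
  (forall i, i < n -> gadget_adj (s i) (s i.+1)) ->
  (forall i, i.+1 < n -> f (s i) (s i.+1) != f (s i.+1) (s i.+2)) ->
  (forall i j, i < j <= n -> s i != s j) ->
  s n != Guest g -> (forall b', s n != Leaf g b') ->
  [/\ 1 < n, s 1 = Guest g & s 2 = nbv g i].
Proof.
move=> st b lb s0 sA sC sI nG nL.
have [n1 s1 [j s2 ej]] := leaf_step s0 sA sC sI (nL b) nG nL.
split=> //; rewrite s2; congr (nbv g _); apply/eqP.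
by apply: contraNT ej => /st ->; rewrite lb.
Qed.

(** The chosen leaves can leave only through the stems, which meet at one vertex; so the path
    between them has length 4 and the two stems are consecutive on it. *)
Lemma stems_conflict g i k j : stem_spec g i -> stem_spec k j ->
  g != k -> nbv g i = nbv k j -> e g i != e k j.
Proof.
move=> gi kj gk E; apply/eqP => ee.
have [b lb] := leaf_color g (~~ e g i); have [b' lb'] := leaf_color k (~~ e k j).
have Lgk a a' : Leaf g a != Leaf k a'.
  by apply: contraNneq gk => -[->].
have [|n [s [s0 sn sA sC sI]]] := @alt_seq (Leaf g b) (Leaf k b').
  exact: Lgk.
have [||n1 s1 s2] := stem_path gi lb s0 sA sC sI; rewrite ?sn //.
  by move=> a; rewrite eq_sym Lgk.
(* The same path read from the other end, for the stem of [k]. *)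
pose r i := s (n - i).
have [] := @stem_path k j n r kj b' lb'; rewrite /r ?subn0 ?subnn ?s0 ?Lgk //.
- move=> m mn; rewrite gadget_adj_sym.
  have -> : n - m = (n - m.+1).+1 by lia.
  by apply: sA; lia.
- move=> m mn; rewrite eq_sym fC (fC (s (n - m))).
  have -> : n - m = (n - m.+2).+2 by lia.
  have -> : n - m.+1 = (n - m.+2).+1 by lia.
  by apply: sC; lia.
- by move=> a c ac; rewrite eq_sym; apply: sI; lia.
move=> _ r1 r2.
have n4 : n - 2 = 2.
  case: (ltngtP (n - 2) 2) => // lt.
    by have := sI (n - 2) 2; rewrite r2 s2 E eqxx lt n1 => /(_ isT).
  by have := sI 2 (n - 2); rewrite r2 s2 E eqxx lt leq_subr => /(_ isT).
have n3 : n - 1 = 3 by lia.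
rewrite n3 in r1; have := sC 1; rewrite s1 s2 r1 => /(_ ltac:(lia)).
by rewrite E (fC (nbv k j)) -/(e k j) -ee /e E eqxx.
Qed.

(** If the stem led to a guest [k], the path to the leaf of [k] that has the color of the stem would
    have length 3 and end with two edges of that color. *)
Lemma stem_host g i : stem_spec g i -> exists h, nb g i = inr h.
Proof.
move=> gi; case E: (nb g i) => [k|h]; last by exists h.
have Ev : nbv g i = Guest k by rewrite /nbv E.
have gk : g != k by apply/eqP => gk; have := nb_irr g i; rewrite E gk eqxx.
have [b lb] := leaf_color g (~~ e g i); have [b' lb'] := leaf_color k (e g i).
have Lgk a a' : Leaf k a != Leaf g a'.
  by apply: contraNneq gk => -[->].
have [|n [s [s0 sn sA sC sI]]] := @alt_seq (Leaf g b) (Leaf k b').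
  by rewrite eq_sym.
have [||n1 s1 s2] := stem_path gi lb s0 sA sC sI; rewrite ?sn //.
have n0 : 0 < n by lia.
have sn1 : s n.-1 = Guest k.
  have := sA n.-1; rewrite prednK // leqnn sn => /(_ isT).
  by rewrite gadget_adj_sym adj_leaf => /eqP.
have n3 : n = 3.
  case: (ltngtP n.-1 2) => // lt; last by lia.
    have n2 : n = 2 by lia.
    by move: s2; rewrite -n2 sn Ev.
  by have := sI 2 n.-1; rewrite s2 Ev sn1 eqxx lt leq_pred => /(_ isT).
have := sC 1; rewrite n3 => /(_ isT).
by rewrite n3 in sn; rewrite s1 s2 sn -/(e g i) Ev (fC (Guest k)) -/(l k b') lb' eqxx.
Qed.

(** As stems end at hosts, an edge between guests is the stem of neither, so its color is opposite
    to both stems. *)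
Lemma necessity : stable_choice.
Proof.
have [i iP] := choice stem_exists.
have [s sP] := choice (fun g => stem_host (iP g)).
exists (fun g => e g (i g)), s, i; split=> // [g j k E|g k gk E].
- have [j' E'] := nb_sym E.
  have ji : j != i g by apply: contra_eqN E => /eqP ->; rewrite sP.
  have ji' : j' != i k by apply: contra_eqN E' => /eqP ->; rewrite sP.
  have := iP g j ji; have := iP k j' ji'.
  have -> : e k j' = e g j by rewrite /e /nbv E E' fC.
  by move=> ->; case: (e _ _); case: (e _ _).
- by apply: stems_conflict (iP g) (iP k) gk _; rewrite /nbv !sP E.
Qed.

End Necessity.

(** * Sufficiency: the 2-coloring given by a stable choice *)

Section Sufficiency.
Variables (y : G -> bool) (s : G -> H) (i : G -> 'I_3).
Hypothesis nb_stem : forall g, nb g (i g) = inr (s g).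
Hypothesis nb_eq : forall g j k, nb g j = inl k -> y g = y k.
Hypothesis s_neq : forall g k, g != k -> s g = s k -> y g != y k.

(* A host sends both colors to the hubs, and any two hosts are linked with all
   four pairs of end colors. *)
Definition hub_color (c d : 'I_4) : bool :=
  if (c < 2) && (d < 2) then false
  else if (2 <= c) && (2 <= d) then true else (c == 2 :> nat) || (d == 2 :> nat).

Definition leaf_col (b : 'I_2) := b == ord0.

(** Among the edges from [g] to hosts, the stem has color [y g] and the others the opposite one. On
    an edge between guests [y g = y k], so the negated conjunction is a symmetric form of the
    opposite of both. *)
Definition vcolor (x z : V) : bool :=
  match x, z with
  | inl (inl c), inl (inl d) => hub_color c d
  | inl (inl c), inl (inr _) => c < 2
  | inl (inr _), inl (inl c) => c < 2
  | inl (inr h), inr (inl g) => (h == s g) == y g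
  | inr (inl g), inl (inr h) => (h == s g) == y g
  | inr (inl g), inr (inl k) => ~~ (y g && y k)
  | inr (inl _), inr (inr (_, b)) => leaf_col b
  | inr (inr (_, b)), inr (inl _) => leaf_col b
  | _, _ => true
  end.

Lemma vcolorC x z : vcolor x z = vcolor z x.
Proof.
case: x z => [[c|h]|[g|[g b]]] [[d|h']|[k|[k b']]] //=; last by rewrite andbC.
rewrite /hub_color andbC (andbC (1 < c)); do 2 case: ifP => // _.
by rewrite orbC.
Qed.

Lemma vertex_eqE :
  (forall c d, (Hub c == Hub d) = (c == d)) *
  (forall h h', (Host h == Host h') = (h == h')) *
  (forall g k, (Guest g == Guest k) = (g == k)) *
  (forall g k b b', (Leaf g b == Leaf k b') = (g == k) && (b == b')) *
  (forall c h, (Hub c == Host h) = false) * (forall c h, (Host h == Hub c) = false) *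
  (forall c x, (Hub c == inr x) = false) * (forall c x, (inr x == Hub c) = false) *
  (forall h x, (Host h == inr x) = false) * (forall h x, (inr x == Host h) = false) *
  (forall g k b, (Guest g == Leaf k b) = false) *
  (forall g k b, (Leaf k b == Guest g) = false).
Proof. by []. Qed.

(** The route from a leaf of [g] to its first host. After a guest [k] it takes the stem of [k], the
    only core edge of [k] whose color differs from the edge just used. *)
Definition exit_path g j : seq V :=
  match nb g j with
  | inr h => [:: Guest g; Host h]
  | inl k => [:: Guest g; Guest k; Host (s k)]
  end.
Definition exit_host g j := match nb g j with inr h => h | inl k => s k end.
Definition exit_col g j :=
  match nb g j with inr h => (h == s g) == y g | inl k => y k end.

Notation link := (@alink gadget_graph vcolor).
Notation altp := (@alt_path gadget_graph vcolor).

Lemma stemE g j : (nb g j == inr (s g)) = (j == i g).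
Proof. by rewrite -nb_stem (inj_eq (@nb_inj g)). Qed.

(** The hypothesis expresses that the edge of the leaf and the core edge [j] have different
    colors. *)
Lemma exit_link g b j : leaf_col b = (j == i g) (+) y g ->
  link (Leaf g b) (exit_path g j) (leaf_col b) (exit_col g j).
Proof.
have := adj_nbv g j; rewrite /nbv /exit_path /exit_col -stemE.
case E: (nb g j) => [k|h] A bE.
- have Ak := adj_nbv k (i k); rewrite /nbv nb_stem in Ak.
  have gk : g != k by apply/eqP => gk; have := nb_irr g j; rewrite E gk eqxx.
  rewrite /alink /alt_path /= A Ak adj_leaf eqxx !inE !vertex_eqE (negPf gk) /= !eqxx /=.
  by rewrite -(nb_eq E) bE /=; case: (y g).
- rewrite /alink /alt_path /= A adj_leaf !eqxx /= andbT bE.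
  have -> : (inr h == inr (s g) :> G + H) = (h == s g) by [].
  by case: (h == s g); case: (y g).
Qed.

Lemma exit_last u g j : last u (exit_path g j) = Host (exit_host g j).
Proof. by rewrite /exit_path /exit_host; case: (nb g j). Qed.

(** Hubs 0 and 1 see the hosts in color [true], hubs 2 and 3 in color [false], so the first and last
    hub determine the end colors. *)
Definition hub_seq (a b : bool) : seq 'I_4 :=
  let h0 := @Ordinal 4 0 isT in let h1 := @Ordinal 4 1 isT in
  let h2 := @Ordinal 4 2 isT in let h3 := @Ordinal 4 3 isT in
  match a, b with
  | true, true => [:: h0; h1] | false, false => [:: h2; h3]
  | true, false => [:: h0; h1; h2] | false, true => [:: h2; h1; h0]
  end.

Definition hub_path a b h' : seq V :=
  [seq Hub c | c <- hub_seq a b] ++ [:: Host h'].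

Lemma hub_link h h' a b : h != h' -> link (Host h) (hub_path a b h') a b.
Proof.
by move=> hh; case: a b => [] [];
  rewrite /alink /alt_path /= !inE !vertex_eqE (negPf hh).
Qed.

Lemma to_hub h a c : exists p b, link (Host h) p a b /\
  last (Host h) p = Hub c /\ forall x, x \in p -> exists d, x = Hub d.
Proof.
have [p [pc [b pl]]] : exists p : seq 'I_4, last ord0 p = c /\
    exists b, link (Host h) [seq Hub d | d <- p] a b.
  pose h0 := @Ordinal 4 0 isT; pose h1 := @Ordinal 4 1 isT.
  pose h2 := @Ordinal 4 2 isT; pose h3 := @Ordinal 4 3 isT.
  case: c => [[|[|[|[|c]]]] hc] //; case: a;
  [exists [:: h0] | exists [:: h2; h0] | exists [:: h1] | exists [:: h2; h1]
  |exists [:: h0; h1; h2] | exists [:: h2] | exists [:: h0; h3]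
  |exists [:: h3]]; (split; first exact: val_inj);
  try (by exists true); by exists false.
exists [seq Hub d | d <- p], b; split=> //; split.
  have p0 : p != [::] by case/and4P: pl => _; case: (p).
  by case: (p) pc p0 => //= d q <- _; rewrite (last_map (fun d => Hub d)).
by move=> _ /mapP[d _ ->]; exists d.
Qed.

Lemma exit_inner g j x : x \in exit_path g j ->
  [\/ x = Host (exit_host g j), x = Guest g | exists2 k, nb g j = inl k & x = Guest k].
Proof.
rewrite /exit_path /exit_host; case E: (nb g j) => [k|h]; rewrite !inE.
  case/or3P=> /eqP ->; [by constructor 2|constructor 3|by constructor 1].
  by exists k.
by case/orP=> /eqP ->; [constructor 2|constructor 1].
Qed.

(** What is needed to join the exit of [g] to the reversed exit of [k]: no common guest, and
    different colors in case of a common host. *)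
Definition compatible g p k q : Prop :=
  [/\ nb g p != inl k, nb k q != inl g,
      forall m, nb g p = inl m -> nb k q != inl m
    & exit_host g p = exit_host k q -> exit_col g p != exit_col k q].

Lemma exits_joined g b p k b' q : g != k ->
  leaf_col b = (p == i g) (+) y g -> leaf_col b' = (q == i k) (+) y k ->
  compatible g p k q ->
  exists r, altp (Leaf g b) r /\ last (Leaf g b) r = Leaf k b'.
Proof.
move=> gk pb qb [pk qg pq hc].
have L1 := exit_link pb; have L2 := exit_link qb.
have := @alink_rev gadget_graph vcolor _ _ _ _ vcolorC L2; rewrite exit_last.
set R := rev _ => L3.
have RE x : x \in R -> x = Leaf k b' \/ x = Guest k \/
    exists2 m, nb k q = inl m & x = Guest m.
  rewrite /R mem_rev /exit_path; case: (nb k q) => [m|h] /=; rewrite !inE.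
    by case/or3P=> /eqP ->; [left|right; left|right; right; exists m].
  by case/orP=> /eqP ->; [left|right; left].
have lastR u : last u R = Leaf k b'.
  by rewrite /R /exit_path; case: (nb k q) => [m|h]; rewrite /= /rev /=.
have dis x : x \in R -> x \notin Leaf g b :: exit_path g p.
  move=> xR; rewrite inE negb_or; apply/andP; split.
    case: (RE x xR) => [->|[->|[m _ ->]]] //; rewrite vertex_eqE eq_sym.
    by rewrite (negPf gk).
  apply/negP => /exit_inner[Ex|Ex|[m Em Ex]]; move: (RE x xR); rewrite {x xR}Ex.
  - by case=> [|[]] // [].
  - case=> [//|[[E]|[m Em [E]]]]; first by rewrite E eqxx in gk.
    by rewrite Em E eqxx in qg.
  - case=> [//|[[E]|[m' Em' [E]]]].
      by rewrite Em E eqxx in pk.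
    by have := pq m Em; rewrite Em' E eqxx.
have [hh|hh] := eqVneq (exit_host g p) (exit_host k q).
  exists (exit_path g p ++ R); split; last by rewrite last_cat lastR.
  have /and4P[//] : link (Leaf g b) (exit_path g p ++ R) (leaf_col b) (leaf_col b').
  apply: alink_cat L1 _ _.
    rewrite exit_last hh; have -> // : ~~ exit_col g p = exit_col k q.
    by move: (hc hh); case: (exit_col g p); case: (exit_col k q).
  by apply/hasPn => x /dis.
(* Distinct hosts are linked through the hubs by a path whose end colors are opposite to those of
   arrival. *)
have W := hub_link (~~ exit_col g p) (~~ exit_col k q) hh.
have L4 : link (Leaf g b) (exit_path g p ++ hub_path (~~ exit_col g p)
    (~~ exit_col k q) (exit_host k q)) (leaf_col b) (~~ exit_col k q).
  apply: alink_cat L1 _ _; first by rewrite exit_last.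
  apply/hasPn => x; rewrite mem_cat => /orP[/mapP[c _ ->]|].
    rewrite inE vertex_eqE /=; apply/negP => /exit_inner[] //; last by case.
  rewrite inE => /eqP ->; rewrite inE vertex_eqE /=.
  apply/negP => /exit_inner[[E]||[]] //.
  by rewrite E eqxx in hh.
have /and4P[L5 _ _ _] : link (Leaf g b) ((exit_path g p ++ hub_path
    (~~ exit_col g p) (~~ exit_col k q) (exit_host k q)) ++ R)
    (leaf_col b) (leaf_col b').
  apply: alink_cat L4 _ _; first by rewrite /hub_path catA last_cat /= negbK.
  apply/hasPn => x xR; have := dis x xR; rewrite !inE mem_cat !negb_or.
  case/andP=> -> ->; rewrite mem_cat negb_or inE /=; apply/andP; split.
    by apply/negP => /mapP[c _ E]; move: (RE x xR); rewrite E => -[|[|[]]].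
  by apply/negP => /eqP E; move: (RE x xR); rewrite E => -[|[|[]]].
by eexists; split; first exact: L5; rewrite last_cat lastR.
Qed.

Lemma others (a : 'I_3) : exists p q, [/\ p != a, q != a & p != q].
Proof.
case: a => [[|[|[|a]]] ha] //;
  [exists (@Ordinal 3 1 isT), (@Ordinal 3 2 isT)
  |exists (@Ordinal 3 0 isT), (@Ordinal 3 2 isT)
  |exists (@Ordinal 3 0 isT), (@Ordinal 3 1 isT)]; by [].
Qed.

Lemma exit_host_other g p h : nb g p = inr h -> p != i g -> (h == s g) = false.
Proof. by move=> E; rewrite -stemE E => /negPf. Qed.

(** One of the two non-stem edges of [k] works. An edge fails if it leads to [g], which implies
    [y g = y k], or to the stem host of [g] when [y g] and [y k] differ. These cases exclude each
    other, and each concerns one edge at most. *)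
Lemma stem_other g k : g != k ->
  exists2 q, q != i k & compatible g (i g) k q.
Proof.
move=> gk; have [q1 [q2 [q1k q2k q12]]] := others (i k).
have bad q : q != i k -> ~ compatible g (i g) k q ->
    nb k q = inl g \/ nb k q = inr (s g) /\ y g = ~~ y k.
  move=> qk; case E: (nb k q) => [m|h] C.
    have [->|mg] := eqVneq m g; [by left|case: C; split=> //].
    + by rewrite nb_stem.
    + by rewrite E; apply: contraNneq mg => -[->].
    + by move=> m'; rewrite nb_stem.
    + rewrite /exit_host /exit_col nb_stem E eqxx => sm.
      by rewrite /= eq_sym; have := s_neq mg (esym sm); case: (y g); case: (y m).
  right; have [hs|hs] := eqVneq h (s g).
    rewrite -hs; split=> //; apply/eqP; apply: contra_notT C => yy.
    split; rewrite ?nb_stem ?E // => _.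
    rewrite /exit_col nb_stem E eqxx (exit_host_other E qk).
    by move: yy; case: (y g); case: (y k).
  case: C; split; rewrite ?nb_stem ?E //.
  by rewrite /exit_host nb_stem E => hs'; rewrite hs' eqxx in hs.
have [C1|C1] := pselect (compatible g (i g) k q1); first by exists q1.
have [C2|C2] := pselect (compatible g (i g) k q2); first by exists q2.
have Nq := @nb_inj k q1 q2.
case: (bad _ q1k C1) => [E1|[E1 y1]]; case: (bad _ q2k C2) => [E2|[E2 y2]].
- by rewrite E1 E2 in Nq; rewrite Nq ?eqxx in q12.
- by move: y2; rewrite (nb_eq E1); case: (y g).
- by move: y1; rewrite (nb_eq E2); case: (y g).
- by rewrite E1 E2 in Nq; rewrite Nq ?eqxx in q12.
Qed.

Lemma compatible_sym g p k q : compatible g p k q -> compatible k q g p.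
Proof.
case=> A B C D; split=> //; last by move/esym/D; rewrite eq_sym.
by move=> m E; apply/eqP => /C; rewrite E eqxx.
Qed.

(** For an arbitrary non-stem edge [p] of [g], one of the two non-stem edges of [k] fits. A failure
    means a common neighbor, or that one exit runs through a guest whose stem ends at the neighbor
    used by the other. Two failures would be inconsistent, repeat a neighbor of [k], or give two
    guests with equal [y] and the same stem host. *)
Lemma other_other g k : g != k -> (forall p, nb g p != inl k) ->
  exists p q, [/\ p != i g, q != i k & compatible g p k q].
Proof.
move=> gk nadj; have [p [_ [pg _ _]]] := others (i g).
have [q1 [q2 [q1k q2k q12]]] := others (i k).
have nadj' q : nb k q != inl g.
  by apply/eqP => /nb_sym[j]; apply/eqP.
have bad q : q != i k -> ~ compatible g p k q ->
    [\/ y g = y k /\ nb k q = nb g p,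
        y g = ~~ y k /\ (exists2 m, nb g p = inl m & nb k q = inr (s m))
      | y g = ~~ y k /\ (exists m, nb k q = inl m /\ nb g p = inr (s m))].
  move=> qk C; have {C} [C|C] : (exists2 m, nb g p = inl m & nb k q = inl m) \/
      (exit_host g p = exit_host k q /\ exit_col g p = exit_col k q).
    apply: contra_notP C => /not_orP[C1 C2]; split=> //.
    + by move=> m Em; apply/eqP => Em'; apply: C1; exists m.
    + by move=> E; apply/eqP => E'; apply: C2.
  - case: C => m Em Em'; constructor 1; rewrite Em Em'.
    by rewrite (nb_eq Em) (nb_eq Em').
  move: C; rewrite /exit_host /exit_col.
  case Ep: (nb g p) => [m|h]; case Eq: (nb k q) => [m'|h'] [].
  - move=> sm ym; constructor 1; rewrite (nb_eq Ep) (nb_eq Eq) ym; split=> //.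
    have [->//|mm] := eqVneq m m'.
    by have := s_neq mm sm; rewrite ym eqxx.
  - move=> sm; rewrite (exit_host_other Eq qk) -(nb_eq Ep) => yy.
    by constructor 2; split; [move: yy; case: (y g); case: (y k)|exists m; rewrite ?sm].
  - move=> sm; rewrite (exit_host_other Ep pg) -(nb_eq Eq) sm => yy.
    by constructor 3; split; [move: yy; case: (y g); case: (y k)|exists m'; rewrite ?sm].
  - move=> hh; rewrite (exit_host_other Ep pg) (exit_host_other Eq qk) hh => yy.
    by constructor 1; split=> //; move: yy; case: (y g); case: (y k).
have [C1|C1] := pselect (compatible g p k q1); first by exists p, q1.
have [C2|C2] := pselect (compatible g p k q2); first by exists p, q2.
have Nq := @nb_inj k q1 q2.
have yF : y g = y k -> y g = ~~ y k -> False by case: (y g); case: (y k).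
exfalso; case: (bad _ q1k C1) => -[y1 E1]; case: (bad _ q2k C2) => -[y2 E2];
  try by [case: (yF y1 y2) | case: (yF y2 y1)].
- by rewrite E1 E2 in Nq; rewrite Nq ?eqxx in q12.
- case: E1 => m Em E1; case: E2 => m' Em' E2.
  move: Em'; rewrite Em => -[E]; rewrite -E in E2.
  by rewrite E1 E2 in Nq; rewrite Nq ?eqxx in q12.
- by case: E1 => m Em _; case: E2 => m' [_]; rewrite Em.
- by case: E1 => m [_ Em]; case: E2 => m' Em'; rewrite Em' in Em.
- case: E1 => m [E1 Em]; case: E2 => m' [E2 Em'].
  have mm : m != m'.
    by apply: contraNneq q12 => mm; apply/eqP/Nq; rewrite E1 E2 mm.
  move: Em'; rewrite Em => -[sm]; have := s_neq mm sm.
  by rewrite -(nb_eq E1) -(nb_eq E2) eqxx.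
Qed.

Definition joined (u v : V) : Prop :=
  u = v \/ exists p, altp u p /\ last u p = v.

Lemma joined_adj u v : gadget_adj u v -> joined u v.
Proof.
move=> uv; right; exists [:: v]; rewrite /alt_path /= uv inE /= !andbT; split=> //.
by apply/eqP=> E; move: uv; rewrite E gadget_adj_irr.
Qed.

Lemma joined_sym u v : joined u v -> joined v u.
Proof.
case=> [->|[p [pP pl]]]; first by left.
have [p0|p0] := eqVneq p [::]; first by left; rewrite -pl p0.
right; have L : link u p (head true (pairmap vcolor u p)) (last true (pairmap vcolor u p)).
  by rewrite /alink pP p0 /=; case: (p) p0 => //= x r _; rewrite !eqxx.
have /and4P[H1 _ _ _] := @alink_rev gadget_graph vcolor _ _ _ _ vcolorC L.
rewrite pl in H1; exists (rev (belast u p)); split=> //.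
by case: (p) p0 => //= x r _; rewrite rev_cons last_rcons.
Qed.

Lemma leaf_exits g b : exists p, leaf_col b = (p == i g) (+) y g.
Proof.
have [E|E] := eqVneq (leaf_col b) (y g); last first.
  by exists (i g); rewrite eqxx; move: E; case: (leaf_col b); case: (y g).
have [p [_ [pg _ _]]] := others (i g).
by exists p; rewrite (negPf pg) E.
Qed.

Lemma leaf_exit_nonstem g b p : p != i g -> leaf_col b = y g ->
  leaf_col b = (p == i g) (+) y g.
Proof. by move=> /negPf->. Qed.

Lemma leaf_exit_stem g b : leaf_col b != y g ->
  leaf_col b = (i g == i g) (+) y g.
Proof. by rewrite eqxx; case: (leaf_col b); case: (y g). Qed.

(** A leaf with the color of its guest's stem exits by another core edge, a leaf of the other color
    by the stem. *)
Lemma joined_leaves g b k b' : joined (Leaf g b) (Leaf k b').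
Proof.
have [<-|gk] := eqVneq g k.
  have [<-|bb] := eqVneq b b'; first by left.
  right; exists [:: Guest g; Leaf g b']; split=> //.
  rewrite /alt_path /= !adj_leaf eqxx gadget_adj_sym adj_leaf eqxx /=.
  rewrite !inE !vertex_eqE eqxx (negPf bb) /= andbT /leaf_col.
  by case: b b' bb => [[|[|b]] hb] [[|[|b']] hb'].
have [gb|gb] := eqVneq (leaf_col b) (y g); last first.
  have [kb|kb] := eqVneq (leaf_col b') (y k); last first.
    right; apply: (exits_joined gk (leaf_exit_stem gb) (leaf_exit_stem kb) _).
    split; rewrite ?nb_stem // /exit_host /exit_col !nb_stem => E.
    by rewrite !eqxx; have := s_neq gk E; case: (y g); case: (y k).
  have [q qk C] := stem_other gk.
  by right; apply: (exits_joined gk (leaf_exit_stem gb) (leaf_exit_nonstem qk kb) C).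
have [kb|kb] := eqVneq (leaf_col b') (y k); last first.
  have kg : k != g by rewrite eq_sym.
  have [q qk C] := stem_other kg.
  right; apply: (exits_joined gk (leaf_exit_nonstem qk gb) (leaf_exit_stem kb) _).
  exact: compatible_sym.
(* Between adjacent guests the edge has the color opposite to both leaves, so it can be used
   directly. *)
have [[p E]|nadj] := pselect (exists p, nb g p = inl k).
  right; exists [:: Guest g; Guest k; Leaf k b']; split=> //.
  have A := adj_nbv g p; rewrite /nbv E in A.
  rewrite /alt_path /= A !adj_leaf eqxx gadget_adj_sym adj_leaf eqxx /=.
  rewrite !inE !vertex_eqE (negPf gk) /= gb kb -(nb_eq E).
  by case: (y g).
have [p [q [pg qk C]]] := other_other gk (fun p => introN eqP (fun E => nadj (ex_intro _ p E))).
by right; apply: (exits_joined gk (leaf_exit_nonstem pg gb) (leaf_exit_nonstem qk kb) C).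
Qed.

Lemma joined_leaf_host g b h : joined (Leaf g b) (Host h).
Proof.
have [p pP] := leaf_exits g b; have L := exit_link pP.
have [E|hh] := eqVneq (exit_host g p) h.
  right; exists (exit_path g p); rewrite exit_last E; split=> //.
  by case/and4P: L.
right; have W := hub_link (~~ exit_col g p) true hh.
exists (exit_path g p ++ hub_path (~~ exit_col g p) true h).
have /and4P[-> _ _ _] : link (Leaf g b) (exit_path g p ++
    hub_path (~~ exit_col g p) true h) (leaf_col b) true.
  apply: alink_cat L _ _; first by rewrite exit_last.
  apply/hasPn => x; rewrite mem_cat => /orP[/mapP[c _ ->]|].
    by rewrite inE vertex_eqE /=; apply/negP => /exit_inner[] //; case.
  rewrite inE => /eqP ->; rewrite inE vertex_eqE /=.
  apply/negP => /exit_inner[[E]||[]] //.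
  by rewrite E eqxx in hh.
by split=> //; rewrite /hub_path catA last_cat.
Qed.

Lemma joined_leaf_hub g b c : joined (Leaf g b) (Hub c).
Proof.
have [p pP] := leaf_exits g b; have L := exit_link pP.
have [w [a [W [wl wH]]]] := to_hub (exit_host g p) (~~ exit_col g p) c.
right; exists (exit_path g p ++ w); rewrite last_cat exit_last wl; split=> //.
have /and4P[-> //] : link (Leaf g b) (exit_path g p ++ w) (leaf_col b) a.
apply: alink_cat L _ _; first by rewrite exit_last.
apply/hasPn => x /wH[d ->].
by rewrite inE vertex_eqE /=; apply/negP => /exit_inner[] //; case.
Qed.

Lemma joined_host_host h h' : joined (Host h) (Host h').
Proof.
have [->|hh] := eqVneq h h'; first by left.
right; exists (hub_path true true h'); split=> //.
by have /and4P[] := hub_link true true hh.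
Qed.

(** A path from a leaf goes first to its guest, so dropping the leaf leaves a path from the
    guest. *)
Lemma joined_guest g v : (forall b, joined (Leaf g b) v) -> joined (Guest g) v.
Proof.
move=> J; have [->|vg] := eqVneq v (Guest g); first by left.
case: (J ord0) => [<-|[p [/and3P[pP pU pS] pl]]].
  by apply: joined_adj; rewrite gadget_adj_sym adj_leaf.
case: p pP pU pS pl => [_ _ _ <-|x p].
  by apply: joined_adj; rewrite gadget_adj_sym adj_leaf.
rewrite [path _ _ _]/= adj_leaf => /andP[/eqP -> pP] /andP[_ pU] pS pl.
by right; exists p; split=> //; apply/and3P; split=> //; apply: path_sorted pS.
Qed.

Lemma sufficiency : @alt_connected gadget_graph vcolor.
Proof.
have JL g b v : joined (Leaf g b) v.
  case: v => [[c|h]|[k|[k b']]].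
  - exact: joined_leaf_hub.
  - exact: joined_leaf_host.
  - by apply/joined_sym/joined_guest => b'; apply: joined_leaves.
  - exact: joined_leaves.
have JG g v : joined (Guest g) v by apply: joined_guest.
move=> u v uv; suff [E|//] : joined u v by rewrite E eqxx in uv.
case: u v uv => [[c|h]|[g|[g b]]] [[d|h']|[k|[k b']]] uv //;
  try by apply/joined_sym.
- by apply: joined_adj; rewrite /gadget_adj /=; rewrite vertex_eqE in uv; rewrite uv.
- exact: joined_adj.
- exact: joined_adj.
- exact: joined_host_host.
Qed.

End Sufficiency.

Theorem gadget_two_coloring :
  has_proper_path_coloring gadget_graph 2 <-> stable_choice.
Proof.
split=> [/two_coloringP[f [fC fP]]|[y [s [i [h1 h2 h3]]]]].
  exact: necessity fC fP.
apply/two_coloringP; exists (vcolor y s); split; first exact: vcolorC.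
exact: sufficiency h1 h2 h3.
Qed.

End Gadget.

(** * From satisfiability to stable choices *)

Definition lit_val (a : nat -> bool) (c : nat) : bool := odd c (+) a c./2.

Section Clauses.
(* [lit j k] codes the k-th literal of the j-th clause: [c.*2] is the variable
   [c] and [c.*2.+1] its negation; the variable 0 stands for truth. *)
Variables (n m K : nat) (lit : nat -> nat -> nat).

Definition satisfiable : Prop := exists a : nat -> bool,
  a 0 /\ forall j, j < m -> exists2 k, k < K & lit_val a (lit j k).

Definition nconstraints := m * K.
Definition nsignals := (n.*2 + nconstraints).+2.
(** Slot 0, four slots per constraint, and two more: a cycle needs three guests for successor and
    predecessor to differ. *)
Definition nslots := (4 * nconstraints).+3.

(* The signal [chain j k] is true only if the first [k] literals of clause [j]
   do not suffice to make it true. *)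
Definition chain j k : nat :=
  if k == 0 then 0 else if k == K then 1 else n.*2.+2 + (j * K + k).

(** Guest 0 chooses between the two conclusions, guest 1 between the premise and truth. A true
    premise makes guest 1 impose a true conclusion; with a false one, guest 1 can adapt to either
    value. *)
Definition entry e b i : nat :=
  let j := e %/ K in let k := e %% K in
  if b == 0 then (if i == 0 then lit j k else chain j k.+1)
  else (if i == 0 then chain j k else 0).

Definition slot e b i : nat := (4 * e + 2 * b + i).+1.

(* A signal is a cycle of guests, hence has a single value [y], and its guest at
   slot [t] keeps the host [(s, t)] from guests of the same value.  The guests
   at slot 0 of a literal and of its negation share a host.  Constraint
   [e = (j, k)] is [chain j k -> lit j k \/ chain j k.+1]: its two guests have
   the same [y] and each may take the host of one of its two entries provided
   that this entry has the opposite value. *)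
Definition sat_host : finType := ('I_nsignals * 'I_nslots)%type.
Definition sat_guest : finType :=
  (('I_nsignals * 'I_nslots) + ('I_nconstraints * 'I_2))%type.

Definition signal_host (s : 'I_nsignals) (t : 'I_nslots) : sat_host :=
  if (t == ord0) && (s < n.*2.+2) then (inord s./2.*2, t) else (s, t).

Definition sat_nb (g : sat_guest) (i : 'I_3) : sat_guest + sat_host :=
  match g with
  | inl (s, t) => match val i with
                  | 0 => inl (inl (s, ordS t))
                  | 1 => inl (inl (s, ord_pred t))
                  | _ => inr (signal_host s t)
                  end
  | inr (e, b) => match val i with
                  | 0 => inl (inr (e, rev_ord b))
                  | i'.+1 => inr (inord (entry e b i'), inord (slot e b i'))
                  end
  end.

Hypothesis K_gt0 : 0 < K.
Hypothesis lit_lt : forall j k, j < m -> k < K -> lit j k < n.*2.+2.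

Let i0 := @Ordinal 3 0 isT.
Let i1 := @Ordinal 3 1 isT.
Let i2 := @Ordinal 3 2 isT.

Lemma I3P (P : 'I_3 -> Prop) : P i0 -> P i1 -> P i2 -> forall i, P i.
Proof.
move=> P0 P1 P2 [[|[|[|i]]] hi] //.
- by rewrite (_ : Ordinal hi = i0) //; apply: val_inj.
- by rewrite (_ : Ordinal hi = i1) //; apply: val_inj.
- by rewrite (_ : Ordinal hi = i2) //; apply: val_inj.
Qed.

Lemma slot_lt e b i : e < nconstraints -> b < 2 -> i < 2 -> slot e b i < nslots.
Proof. by rewrite /slot /nslots; lia. Qed.

Lemma ordS_val (t : 'I_nslots) :
  ordS t = (if t.+1 == nslots then 0 else t.+1) :> nat.
Proof.
rewrite /=; case: eqP => [->|tN]; first by rewrite modnn.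
by rewrite modn_small //; have := ltn_ord t; lia.
Qed.

Lemma ordS_pred (t : 'I_nslots) : ordS t != ord_pred t.
Proof.
apply/eqP => E; have : ordS (ordS t) = t by rewrite E ord_predK.
move/(congr1 (@nat_of_ord _)); rewrite !ordS_val; have := ltn_ord t; rewrite /nslots.
by repeat case: eqP; lia.
Qed.

Lemma sat_nb_inj g : injective (sat_nb g).
Proof.
have A (t : 'I_nslots) := negPf (ordS_pred t).
have B (t : 'I_nslots) : (ord_pred t == ordS t) = false by rewrite eq_sym.
have C (e : 'I_nconstraints) (b : 'I_2) :
    (inord (slot e b 0) : 'I_nslots) <> inord (slot e b 1).
  move/(congr1 (@nat_of_ord _)); rewrite !inordK ?slot_lt //.
  by rewrite /slot; lia.
case: g => [[s t]|[e b]] i j; move: i j; apply: I3P; apply: I3P => //=.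
- move/(congr1 (fun x => if x is inl (inl (_, u)) then u == ord_pred t else false)).
  by rewrite /= eqxx A.
- move/(congr1 (fun x => if x is inl (inl (_, u)) then u == ordS t else false)).
  by rewrite /= eqxx B.
- by case=> _ /C.
- by case=> _ /esym/C.
Qed.

Lemma sat_nb_sym g i k : sat_nb g i = inl k -> exists j, sat_nb k j = inl g.
Proof.
case: g => [[s t]|[e b]]; move: i; apply: I3P => //= -[<-].
- by exists i1; rewrite /= ordSK.
- by exists i0; rewrite /= ord_predK.
- by exists i0; rewrite /= rev_ordK.
Qed.

Lemma sat_nb_irr g i : sat_nb g i != inl g.
Proof.
case: g => [[s t]|[e b]]; move: i; apply: I3P => //=; apply/eqP => -[].
- move/(congr1 (@nat_of_ord _)); rewrite ordS_val; have := ltn_ord t; rewrite /nslots.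
  by case: eqP; lia.
- move=> E; have := ord_predK t; rewrite E.
  move/(congr1 (@nat_of_ord _)); rewrite ordS_val; have := ltn_ord t; rewrite /nslots.
  by case: eqP; lia.
- by case: b => [[|[|b]] hb] //= [].
Qed.

Lemma chain_lt j k : j < m -> k <= K -> chain j k < nsignals.
Proof.
move=> jm kK; rewrite /chain /nsignals /nconstraints.
case: eqP => [//|k0]; case: eqP => [//|kN].
have : j.+1 * K <= m * K by rewrite leq_mul2r jm orbT.
by rewrite mulSn; lia.
Qed.

Lemma constraint_index e : e < nconstraints -> e %/ K < m /\ e %% K < K.
Proof. by move=> eE; rewrite ltn_mod K_gt0 ltn_divLR. Qed.

Lemma entry_lt e b i : e < nconstraints -> entry e b i < nsignals.
Proof.
move=> eE; have [jm kK] := constraint_index eE; rewrite /entry.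
case: ifP => _; case: ifP => _ //.
- by apply: leq_trans (lit_lt jm kK) _; rewrite /nsignals; lia.
- exact: chain_lt.
- by apply: chain_lt => //; apply: ltnW.
Qed.

Lemma signal_host_slot s t : t != ord0 -> signal_host s t = (s, t).
Proof. by rewrite /signal_host => /negPf ->. Qed.

Lemma slot_neq0 e b i : e < nconstraints -> b < 2 -> i < 2 ->
  (inord (slot e b i) : 'I_nslots) != ord0.
Proof.
by move=> He Hb Hi; rewrite -(inj_eq val_inj) /= inordK // slot_lt.
Qed.

(** Complementing [y] preserves stable choices, so the value of a signal has a meaning only relative
    to that of signal 0. *)
Lemma stable_choice_sat : stable_choice sat_nb -> satisfiable.
Proof.
case=> y [h [i [ih yE hN]]].
pose v s := y (inl (inord s, ord0)).
have yv (s : 'I_nsignals) t : y (inl (s, t)) = v s.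
  rewrite /v inord_val; case: t => t ht.
  elim: t ht => [|t IH] ht; first by congr (y (inl (_, _))); apply: val_inj.
  have ht' := ltnW ht; rewrite -(IH ht'); symmetry; apply: (yE _ i0).
  rewrite /=; congr (inl (inl (_, _))); apply: ord_inj.
  by rewrite ordS_val /=; case: eqP ht => // ->; rewrite ltnn.
have stem s t : h (inl (s, t)) = signal_host s t.
  have := ih (inl (s, t)); move: (i _); apply: I3P => //=.
  by case.
have neq x : x <= n -> v x.*2.+1 = ~~ v x.*2.
  move=> xn; rewrite /v.
  have H1 : x.*2.+1 < nsignals by rewrite /nsignals; lia.
  have H0 := ltnW H1.
  have gk : inl (inord x.*2, ord0) != inl (inord x.*2.+1, ord0) :> sat_guest.
    apply/eqP => -[] /(congr1 (@nat_of_ord _)); rewrite /= !inordK //; lia.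
  have := hN _ _ gk; rewrite !stem /signal_host !eqxx /= !inordK //.
  have -> : x.*2 < n.*2.+2 by lia.
  have -> : x.*2.+1 < n.*2.+2 by lia.
  have -> : x.*2.+1./2 = x by lia.
  rewrite doubleK => /(_ erefl).
  by case: (y _); case: (y _).
(* Both guests of a constraint have the value [z]; the host taken by each is also that of a signal
   guest, which must have the value [~~ z]. *)
have con e : e < nconstraints -> exists z, forall b, b < 2 ->
    exists2 i', i' < 2 & v (entry e b i') = ~~ z.
  move=> eE; pose g (b : 'I_2) : sat_guest := inr (Ordinal eE, b).
  have yg b : y (g b) = y (g ord0).
    case: b => [[|[|b]] hb] //; first by congr (y (inr (_, _))); apply: val_inj.
    by apply: (yE _ i0); congr (inl (inr (_, _))); apply: val_inj.
  exists (y (g ord0)) => b hb.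
  have [i' i'2 hE] : exists2 i', i' < 2 &
      h (g (Ordinal hb)) = (inord (entry e b i'), inord (slot e b i')).
    have := ih (g (Ordinal hb)); move: (i _); apply: I3P => //= -[<-].
      by exists 0.
    by exists 1.
  exists i' => //.
  pose k : sat_guest := inl (inord (entry e b i'), inord (slot e b i')).
  have kg : k != g (Ordinal hb) by [].
  have := hN k _ kg; rewrite stem hE signal_host_slot ?slot_neq0 // => /(_ erefl).
  rewrite yg /k yv inordK ?entry_lt //.
  by case: (v _); case: (y _).
exists (fun x => v x.*2 == v 0); split; first by rewrite eqxx.
have lv c : c < n.*2.+2 -> lit_val (fun x => v x.*2 == v 0) c = (v c == v 0).
  move=> cn; rewrite /lit_val; have := odd_double_half c.
  case E: (odd c) => /= Ec; last by rewrite -{2}Ec.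
  rewrite -{2}Ec add1n neq; last by lia.
  by case: (v _); case: (v 0).
(* If all literals were false, truth would pass along the chain from signal 0 to signal 1, its
   negation. *)
move=> j jm; apply: contrapT => allF.
have litF k : k < K -> v (lit j k) = ~~ v 0.
  move=> kK; suff: ~~ lit_val (fun x => v x.*2 == v 0) (lit j k).
    by rewrite lv ?lit_lt //; case: (v _); case: (v 0).
  by apply/negP => L; apply: allF; exists k.
have chainT k : k <= K -> v (chain j k) = v 0.
  elim: k => [|k IH] kK; first by rewrite /chain.
  have eE : j * K + k < nconstraints.
    have : j.+1 * K <= m * K by rewrite leq_mul2r jm orbT.
    by rewrite mulSn /nconstraints; lia.
  have [z zP] := con _ eE.
  have [b1 _ b1P] := zP 0 isT; have [b2 _ b2P] := zP 1 isT.
  move: b2P b1P; rewrite /entry /= divnMDl // divn_small // addn0 modnMDl modn_small //.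
  have IH' := IH (ltnW kK).
  have -> : forall b, v (if b == 0 then chain j k else 0) = v 0.
    by move=> b; case: ifP.
  move=> v0; case: ifP => _ H; last by rewrite H v0.
  by move: H; rewrite litF // v0; case: (z).
have := chainT K (leqnn K); rewrite /chain gtn_eqF // eqxx.
by rewrite (neq 0 (leq0n n)); case: (v 0).
Qed.

(** * From a satisfying assignment to a stable choice *)

Section Assignment.
Variable a : nat -> bool.
Hypothesis a0 : a 0.
Hypothesis sat : forall j, j < m -> exists2 k, k < K & lit_val a (lit j k).

(** The intended value of [chain j k]; at [k = K] it is false because the clause is satisfied. *)
Let later j k := ~~ has (fun k' => lit_val a (lit j k')) (iota 0 k).

Let sv s : bool :=
  if s < n.*2.+2 then lit_val a s
  else later ((s - n.*2.+2) %/ K) ((s - n.*2.+2) %% K).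

Lemma sv_chain j k : j < m -> k <= K -> sv (chain j k) = later j k.
Proof.
move=> jm kK; rewrite /chain /sv.
case: eqP => [->|k0]; first by rewrite /lit_val /= a0.
case: eqP => [->|kN].
  rewrite /lit_val /= a0 /later; apply/esym/negbTE; rewrite negbK.
  have [k' k'K k'L] := sat jm; apply/hasP; exists k' => //.
  by rewrite mem_iota.
have kK' : k < K by lia.
rewrite ifF; last by lia.
by rewrite addKn divnMDl // divn_small // addn0 modnMDl modn_small.
Qed.

(** Tells whether a conclusion is true; both guests look for an entry of this value. Guest 1 finds
    it in truth or, if both conclusions are false, in the premise, which is then false too. *)
Let choice_true e := sv (entry e 0 0) || sv (entry e 0 1).
Let choice e (b : nat) : nat :=
  if b == 0 then (if choice_true e && ~~ sv (entry e 0 0) then 1 else 0)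
  else (if choice_true e then 1 else 0).

Lemma choice_lt e b : choice e b < 2.
Proof. by rewrite /choice; do 2 case: ifP. Qed.

Lemma choice_val e b : e < nconstraints -> b < 2 ->
  sv (entry e b (choice e b)) = choice_true e.
Proof.
move=> eE; have [jm kK] := constraint_index eE.
case: b => [|[|b]] // _; rewrite /choice /=.
  rewrite /choice_true; case E: (sv (entry e 0 0)) => /=; first by rewrite E.
  by case F: (sv (entry e 0 1)); rewrite /= ?F ?E.
case C: (choice_true e); first by rewrite /entry /= /sv /lit_val /= a0.
move: C; rewrite /choice_true /entry /= !sv_chain ?(ltnW kK) //.
rewrite /later -addn1 iotaD has_cat /= orbF negb_or /sv lit_lt //.
by case: (has _ _) => //=; case: (lit_val _ _).
Qed.

Let gy (g : sat_guest) : bool :=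
  match g with inl (s, _) => sv s | inr (e, _) => ~~ choice_true e end.

Let gh (g : sat_guest) : sat_host :=
  match g with
  | inl (s, t) => signal_host s t
  | inr (e, b) => (inord (entry e b (choice e b)), inord (slot e b (choice e b)))
  end.

Let gi (g : sat_guest) : 'I_3 :=
  match g with inl _ => i2 | inr (e, b) => inord (choice e b).+1 end.

Lemma sv_neg x : x <= n -> sv x.*2.+1 = ~~ sv x.*2.
Proof.
move=> xn; rewrite /sv /lit_val.
have -> : x.*2 < n.*2.+2 by lia.
have -> : x.*2.+1 < n.*2.+2 by lia.
have -> : x.*2.+1./2 = x by lia.
by rewrite doubleK /= odd_double.
Qed.

Lemma half_le x : x./2.*2 <= x.
Proof. by lia. Qed.

Lemma sat_stable_choice : stable_choice sat_nb.
Proof.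
exists gy, gh, gi; split.
- case=> [[s t]|[e b]] //=.
  by rewrite inordK //; have := choice_lt e b; lia.
- case=> [[s t]|[e b]] j [[s' t']|[e' b']]; move: j; apply: I3P => //= -[].
  + by move=> ->.
  + by move=> ->.
  + by move=> ->.
(* Constraints use hosts at nonzero slots only, where each signal has a host of its own. *)
have mixed s t e b : gh (inl (s, t)) = gh (inr (e, b)) ->
    gy (inl (s, t)) != gy (inr (e, b)).
  have eE := ltn_ord e; have sl := slot_lt eE (ltn_ord b) (choice_lt e b).
  have sl0 := slot_neq0 eE (ltn_ord b) (choice_lt e b).
  move=> /= E; have t0 : t != ord0.
    move: E; rewrite /signal_host; case: ifP => [_ [_ ->]//|_ [_ -> //]].
  move: E; rewrite signal_host_slot // => -[-> _].
  rewrite inordK ?entry_lt // choice_val //.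
  by case: (choice_true e).
case=> [[s t]|[e b]] [[s' t']|[e' b']].
- move=> gk /=; rewrite /signal_host; case: ifP => C; case: ifP => C' [].
  (* Distinct signals sharing a host at slot 0 have equal halves, so they are a variable and its
     negation. *)
  + case/andP: C => _ C; case/andP: C' => _ C'.
    have hs := leq_ltn_trans (half_le s) (ltn_ord s).
    have hs' := leq_ltn_trans (half_le s') (ltn_ord s').
    move/(congr1 (@nat_of_ord _)); rewrite !inordK //.
    move=> E tt; have ss : s != s' by apply: contraNneq gk => ->; rewrite tt.
    have ss' : s <> s' :> nat by move/ord_inj => E'; rewrite E' eqxx in ss.
    have half_n : s./2 <= n by lia.
    have : (s = s./2.*2 :> nat /\ s' = s./2.*2.+1 :> nat) \/
        (s = s./2.*2.+1 :> nat /\ s' = s./2.*2 :> nat) by lia.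
    move: (s./2) half_n => x xn [[-> ->]|[-> ->]].
      by rewrite sv_neg //; case: (sv _).
    by rewrite sv_neg //; case: (sv _).
  + move=> E tt; case/andP: C => /eqP t0 C; move: C'; rewrite -tt t0 eqxx -E.
    rewrite inordK; last exact: leq_ltn_trans (half_le _) (ltn_ord _).
    by move=> C'; exfalso; move: C';
      have -> : s./2.*2 < n.*2.+2 by apply: leq_ltn_trans (half_le s) C.
  + move=> E tt; case/andP: C' => /eqP t0 C'; move: C; rewrite tt t0 eqxx E.
    rewrite inordK; last exact: leq_ltn_trans (half_le _) (ltn_ord _).
    by move=> C; exfalso; move: C;
      have -> : s'./2.*2 < n.*2.+2 by apply: leq_ltn_trans (half_le s') C'.
  + by move=> E tt; rewrite E tt eqxx in gk.
- by move=> _; apply: mixed.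
- by move=> _ E; rewrite eq_sym; apply: mixed.
(* The slot determines constraint, guest and entry, so two constraint guests never share a host. *)
- move=> gk [_ /(congr1 (@nat_of_ord _))].
  rewrite !inordK; try exact: slot_lt (ltn_ord _) (ltn_ord _) (choice_lt _ _).
  have := choice_lt e b; have := choice_lt e' b'; have := ltn_ord b; have := ltn_ord b'.
  rewrite /slot => b2 b'2 c2 c'2 E.
  have ee : e = e' by apply: ord_inj; lia.
  have bb : b = b' by apply: ord_inj; lia.
  by rewrite ee bb eqxx in gk.
Qed.

End Assignment.

Lemma stable_choiceP : stable_choice sat_nb <-> satisfiable.
Proof.
split; first exact: stable_choice_sat.
by case=> a [a0 sat]; apply: sat_stable_choice a0 sat.
Qed.

End Clauses.

(** * Structured programs on tapes *)

Definition sym := option (bool + unit).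
Definition mark : sym := Some (inr tt).

(* Tapes indexed by [nat]; moving left of cell 0 renumbers the cells. *)
Record atape := ATape { acell : nat -> sym; apos : nat }.

Definition ascan (t : atape) : sym := acell t (apos t).

Definition awrite (t : atape) (s : sym) (d : dir) : atape :=
  let c i := if i == apos t then s else acell t i in
  match d with
  | MoveLeft => if apos t is p.+1 then ATape c p
                else ATape (fun i => if i is j.+1 then c j else None) 0
  | Stay => ATape c (apos t)
  | MoveRight => ATape c (apos t).+1
  end.

Definition store := nat -> atape.
Implicit Types A B C : store.

Definition upd A i t : store := fun j => if j == i then t else A j.

Inductive prog :=
  | Op of nat & option sym & dir
  | Seq of prog & prog
  | While of nat & (sym -> bool) & prog
  | If of nat & (sym -> bool) & prog.

Definition instr := option (nat * option sym * dir).

Definition do_instr A (a : instr) : store :=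
  if a is Some (i, w, d) then upd A i (awrite (A i) (odflt (ascan (A i)) w) d)
  else A.

Definition scans A : nat -> sym := fun i => ascan (A i).

(* [ev p A n B]: started on [A], [p] stops on [B] after [n] machine steps. *)
Inductive ev : prog -> store -> nat -> store -> Prop :=
  | ev_op i w d A : ev (Op i w d) A 1 (do_instr A (Some (i, w, d)))
  | ev_seq p q A n B m C : ev p A n B -> ev q B m C -> ev (Seq p q) A (n + m) C
  | ev_while0 i (P : sym -> bool) p A : ~~ P (ascan (A i)) -> ev (While i P p) A 1 A
  | ev_while1 i (P : sym -> bool) p A n B m C : P (ascan (A i)) -> ev p A n B ->
      ev (While i P p) B m C -> ev (While i P p) A (n + m).+1 C
  | ev_if0 i (P : sym -> bool) p A : ~~ P (ascan (A i)) -> ev (If i P p) A 1 A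
  | ev_if1 i (P : sym -> bool) p A n B : P (ascan (A i)) -> ev p A n B -> ev (If i P p) A n.+1 B.

(** The state [None] of a loop or a conditional is the one that performs the test. *)
Fixpoint pst (p : prog) : finType :=
  match p with
  | Op _ _ _ => unit
  | Seq p q => (pst p + pst q)%type
  | While _ _ p => option (pst p)
  | If _ _ p => option (pst p)
  end.

Fixpoint pstart (p : prog) : pst p :=
  match p with
  | Op _ _ _ => tt
  | Seq p q => inl (pstart p)
  | While _ _ _ => None
  | If _ _ _ => None
  end.

(** A first component [None] means exit. It comes together with the last instruction, so sequencing
    costs no extra step. *)
Fixpoint pnext (p : prog) : pst p -> (nat -> sym) -> option (pst p) * instr :=
  match p with
  | Op i w d => fun _ _ => (None, Some (i, w, d))
  | Seq p q => fun s r =>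
      match s with
      | inl s => let: (o, a) := pnext s r in
                 (Some (if o is Some s' then inl s' else inr (pstart q)), a)
      | inr s => let: (o, a) := pnext s r in (omap inr o, a)
      end
  | While i P p => fun s r =>
      match s with
      | None => (if P (r i) then Some (Some (pstart p)) else None, None)
      | Some s => let: (o, a) := pnext s r in (Some o, a)
      end
  | If i P p => fun s r =>
      match s with
      | None => (if P (r i) then Some (Some (pstart p)) else None, None)
      | Some s => let: (o, a) := pnext s r in (omap Some o, a)
      end
  end.

Inductive steps (p : prog) : pst p -> store -> nat -> store -> Prop :=
  | steps_exit s A a : pnext s (scans A) = (None, a) -> steps s A 1 (do_instr A a)
  | steps_more s A s' a n B : pnext s (scans A) = (Some s', a) ->
      steps s' (do_instr A a) n B -> steps s A n.+1 B.

Lemma steps_seq2 p q s A n B : @steps q s A n B ->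
  @steps (Seq p q) (inr s) A n B.
Proof.
elim=> {s A n B} [s A a E|s A s' a n B E _ IH].
  by apply: (@steps_exit (Seq p q)); rewrite /= E.
by apply: (@steps_more (Seq p q) _ _ (inr s') a) IH; rewrite /= E.
Qed.

Lemma steps_seq1 p q s A n B m C : @steps p s A n B ->
  @steps q (pstart q) B m C -> @steps (Seq p q) (inl s) A (n + m) C.
Proof.
elim=> {s A n B} [s A a E|s A s' a n B E _ IH] H.
  apply: (@steps_more (Seq p q) _ _ (inr (pstart q)) a).
    by rewrite /= E.
  exact: steps_seq2.
by apply: (@steps_more (Seq p q) _ _ (inl s') a) (IH H); rewrite /= E.
Qed.

Lemma steps_while i P p s A n B m C : @steps p s A n B ->
  @steps (While i P p) None B m C -> @steps (While i P p) (Some s) A (n + m) C.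
Proof.
elim=> {s A n B} [s A a E|s A s' a n B E _ IH] H.
  by apply: (@steps_more (While i P p) _ _ None a) H; rewrite /= E.
by apply: (@steps_more (While i P p) _ _ (Some s') a) (IH H); rewrite /= E.
Qed.

Lemma steps_if i P p s A n B : @steps p s A n B ->
  @steps (If i P p) (Some s) A n B.
Proof.
elim=> {s A n B} [s A a E|s A s' a n B E _ IH].
  by apply: (@steps_exit (If i P p)); rewrite /= E.
by apply: (@steps_more (If i P p) _ _ (Some s') a) IH; rewrite /= E.
Qed.

Lemma ev_steps p A n B : ev p A n B -> steps (pstart p) A n B.
Proof.
elim=> {p A n B}.
- by move=> i w d A; apply: (@steps_exit (Op i w d) tt A (Some (i, w, d))).
- by move=> p q A n B m C _ Hp _ Hq; apply: steps_seq1 Hp Hq.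
- move=> i P p A PA; apply: (@steps_exit (While i P p) None A None).
  by rewrite /= /scans (negPf PA).
- move=> i P p A n B m C PA _ Hp _ Hw; rewrite -addSn.
  apply: (@steps_more (While i P p) None A (Some (pstart p)) None).
    by rewrite /= /scans PA.
  exact: steps_while Hp Hw.
- move=> i P p A PA; apply: (@steps_exit (If i P p) None A None).
  by rewrite /= /scans (negPf PA).
- move=> i P p A n B PA _ Hp.
  apply: (@steps_more (If i P p) None A (Some (pstart p)) None).
    by rewrite /= /scans PA.
  exact: steps_if.
Qed.

Fixpoint pbounded b (p : prog) : bool :=
  match p with
  | Op i _ _ => i < b
  | Seq p q => pbounded b p && pbounded b q
  | While i _ p => (i < b) && pbounded b p
  | If i _ p => (i < b) && pbounded b p
  end.

Lemma pnext_ext b p (s : pst p) r r' : pbounded b p ->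
  (forall i, i < b -> r i = r' i) -> pnext s r = pnext s r'.
Proof.
move=> pb E; elim: p s pb => [i w d|p IHp q IHq|i P p IH|i P p IH] //=.
- by case=> s /andP[bp bq]; [rewrite IHp|rewrite IHq].
- by case=> [s|] /andP[ib bp]; [rewrite IH|rewrite E].
- by case=> [s|] /andP[ib bp]; [rewrite IH|rewrite E].
Qed.

Lemma pnext_bounded b p (s : pst p) r o i w d : pbounded b p ->
  pnext s r = (o, Some (i, w, d)) -> i < b.
Proof.
elim: p s o => [j v e|p IHp q IHq|j P p IH|j P p IH] /=.
- by move=> s o jb [_ <-].
- move=> [s|s] o /andP[bp bq].
  + by case E: (pnext s r) => [o' a] [_ Ea]; apply: (IHp s o') => //; rewrite E Ea.
  + by case E: (pnext s r) => [o' a] [_ Ea]; apply: (IHq s o') => //; rewrite E Ea.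
- move=> [s|] o /andP[jb bp] //.
  by case E: (pnext s r) => [o' a] [_ Ea]; apply: (IH s o') => //; rewrite E Ea.
- move=> [s|] o /andP[jb bp] //.
  by case E: (pnext s r) => [o' a] [_ Ea]; apply: (IH s o') => //; rewrite E Ea.
Qed.

(** * Simulation of programs by machines *)

Section Simulation.
Variables (nt : nat) (S : finType) (st : S) (hl ac : pred S).
Variable dl : S -> {ffun 'I_nt.+2 -> sym} -> S * {ffun 'I_nt.+2 -> sym * dir}.
Let M : TM := @MkTM nt unit S st hl ac dl.

Definition represents (a : atape) (t : tape M) : Prop :=
  [/\ scanned t = ascan a,
      forall i, nth None (rights t) i = acell a (apos a + i).+1
    & forall i, nth None (lefts t) i
        = if i < apos a then acell a (apos a - i.+1) else None].

Lemma represents_write a t s d : represents a t ->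
  represents (awrite a s d) (write_move t (s, d)).
Proof.
case=> ts tr tl; case: d => /=.
- split=> /=.
  + rewrite -nth0 tl; case: (apos a) => [|p] //=.
    by rewrite subn1 /ascan /= ltn_eqF.
  + case E: (apos a) => [|p] [|i] //=; rewrite ?E ?eqxx //.
    * by rewrite tr E.
    * by rewrite addn0 eqxx.
    * by rewrite gtn_eqF ?tr ?E; [congr (acell a _)|]; lia.
  + move=> i; rewrite nth_behead tl; case: (apos a) => [|p] //=.
    by rewrite ltnS subSS; case: ltnP => // ip; rewrite ltn_eqF //; lia.
- split=> /=.
  + by rewrite /ascan /= eqxx.
  + by move=> i; rewrite tr gtn_eqF //; lia.
  + by move=> i; rewrite tl; case: ltnP => // ip; rewrite ltn_eqF //; lia.
- split=> /=.
  + by rewrite -nth0 tr addn0 /ascan /= gtn_eqF.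
  + by move=> i; rewrite nth_behead tr gtn_eqF; [congr (acell a _)|]; lia.
  + move=> [|i] /=; first by rewrite subn1 /= eqxx.
    rewrite tl ltnS; case: ltnP => // ip; rewrite subSS ltn_eqF //; lia.
Qed.

Definition represents_all A (c : {ffun 'I_nt.+2 -> tape M}) : Prop :=
  forall i : 'I_nt.+2, represents (A i) (c i).

Definition act_of (a : instr) (r : {ffun 'I_nt.+2 -> sym}) :
    {ffun 'I_nt.+2 -> sym * dir} :=
  [ffun i : 'I_nt.+2 => if a is Some (j, w, d) then
               if j == i :> nat then (odflt (r i) w, d) else (r i, Stay)
             else (r i, Stay)].

Lemma represents_stay a t : represents a t ->
  represents a (write_move t (scanned t, Stay)).
Proof. by case: t => l s r. Qed.

Lemma represents_act A c a : represents_all A c ->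
  (forall i w d, a = Some (i, w, d) -> i < nt.+2) ->
  represents_all (do_instr A a)
    [ffun i : 'I_nt.+2 => write_move (c i) (act_of a [ffun i : 'I_nt.+2 => scanned (c i)] i)].
Proof.
move=> Ac ab i; rewrite !ffunE; case: a ab => [[[j w] d]|] ab /=; last first.
  exact: represents_stay.
rewrite /upd (eq_sym _ j); have [->|_] := eqVneq j i; last exact: represents_stay.
by have [<- _ _] := Ac i; apply: represents_write.
Qed.

Variables (stp : config M -> config M) (p : prog) (e : option (pst p) -> S).
Hypothesis p_bounded : pbounded nt.+2 p.
Hypothesis stpE : forall s (c : {ffun 'I_nt.+2 -> tape M}),
  stp (@Config M (e (Some s)) c) =
  let r := [ffun i : 'I_nt.+2 => scanned (c i)] in
  let: (o, a) := pnext s (fun i => r (inord i)) in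
  @Config M (e o) [ffun i : 'I_nt.+2 => write_move (c i) (act_of a r i)].

(** Stated for any step function and any embedding [e] of control points, so that it serves the
    transducer, the verifier and the oracle machine. *)
Lemma simulation s A n B c : steps s A n B -> represents_all A c ->
  exists2 c', represents_all B c' &
    iter n stp (@Config M (e (Some s)) c) = @Config M (e None) c'.
Proof.
have key (s' : pst p) A' c' : represents_all A' c' ->
    pnext s' (fun i => [ffun i : 'I_nt.+2 => scanned (c' i)] (inord i)) = pnext s' (scans A').
  move=> Ac; apply: (pnext_ext s' p_bounded) => i ib; rewrite ffunE.
  by have [-> _ _] := Ac (inord i); rewrite inordK.
move=> H; elim: H c => {s A n B} [s A a E|s A s' a n B E _ IH] c Ac.
  eexists; last first.
    by rewrite /= stpE; cbv zeta; rewrite (key _ _ _ Ac) E.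
  apply: represents_act => // i w d Ea; rewrite Ea in E.
  exact: pnext_bounded p_bounded E.
have [|c' Bc' cE] := IH [ffun i : 'I_nt.+2 => write_move (c i)
    (act_of a [ffun i : 'I_nt.+2 => scanned (c i)] i)].
  apply: represents_act => // i w d Ea; rewrite Ea in E.
  exact: pnext_bounded p_bounded E.
by exists c' => //; rewrite iterSr stpE; cbv zeta; rewrite (key _ _ _ Ac) E.
Qed.

End Simulation.

(** * Expressions and their compilation *)

(** The base is at least 2, so that a larger exponent absorbs constants and sums. *)
Definition poly_bounded (f : nat -> nat) : Prop :=
  exists k, forall m, f m <= m.+2 ^ k.

Lemma poly_bounded_le f g : (forall m, f m <= g m) -> poly_bounded g -> poly_bounded f.
Proof. by move=> fg [k gk]; exists k => m; apply: leq_trans (gk m). Qed.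

Lemma poly_bounded_id : poly_bounded id.
Proof. by exists 1 => m; rewrite expn1; lia. Qed.

Lemma poly_bounded_cst c : poly_bounded (fun=> c).
Proof.
exists c => m; apply: leq_trans (ltnW (ltn_expl c (ltnSn 1))) _.
by case: c => // c; rewrite leq_exp2r.
Qed.

Lemma poly_bounded_add f g : poly_bounded f -> poly_bounded g ->
  poly_bounded (fun m => f m + g m).
Proof.
move=> [a fa] [b gb]; exists (maxn a b).+1 => m.
have H c : c <= maxn a b -> m.+2 ^ c <= m.+2 ^ maxn a b by rewrite leq_exp2l.
have := H a (leq_maxl _ _); have := H b (leq_maxr _ _).
have := fa m; have := gb m; rewrite expnS !mulSn; lia.
Qed.

Lemma poly_bounded_mul f g : poly_bounded f -> poly_bounded g ->
  poly_bounded (fun m => f m * g m).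
Proof.
by move=> [a fa] [b gb]; exists (a + b) => m; rewrite expnD leq_mul.
Qed.

Lemma poly_bounded_comp f g : poly_bounded f -> poly_bounded g ->
  poly_bounded (fun m => f (g m)).
Proof.
move=> [a fa] [b gb]; exists (b.+2 * a) => m; apply: leq_trans (fa _) _.
rewrite expnM; case: a {fa} => // a; rewrite leq_exp2r //.
have := gb m; have : 0 < m.+2 ^ b by rewrite expn_gt0.
have : 4 * m.+2 ^ b <= m.+2 ^ b.+2.
  by rewrite !expnS mulnA leq_mul2r -[4]/(2 * 2) leq_mul // orbT.
lia.
Qed.

Lemma poly_boundedP f : poly_bounded f ->
  exists p : {poly nat}, forall m, f m <= p.[m]%R.
Proof.
case=> k fk; exists (('X + 2%:P) ^+ k)%R => m.
by rewrite poly.horner_exp poly.hornerD poly.hornerX poly.hornerC; apply: leq_trans (fk m) _;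
  rewrite -[(_ + _)%R]/(m + 2) addn2; elim: (k) => // j IH; rewrite expnS GRing.exprS leq_mul.
Qed.

(* The innermost variable is the head of the environment; [EWk] drops it, [ESum]
   binds it.  The booleans select one of the two input strings. *)
Inductive expr :=
  | EVar | EWk of expr | EOne | ELen of bool | EBit of bool & expr
  | EAdd of expr & expr | ESub of expr & expr | ESum of expr & expr.

Fixpoint eval (xs : seq (seq bool)) (env : seq nat) (e : expr) : nat :=
  match e with
  | EVar => head 0 env
  | EWk e => eval xs (behead env) e
  | EOne => 1
  | ELen s => size (nth [::] xs s)
  | EBit s e => nth false (nth [::] xs s) (eval xs env e)
  | EAdd e f => eval xs env e + eval xs env f
  | ESub e f => eval xs env e - eval xs env f
  | ESum e f => \sum_(i < eval xs env e) eval xs (val i :: env) f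
  end.

(* A register holds [n] by the distance of the head to the marked cell 0. *)
Definition counter (n : nat) : atape :=
  ATape (fun i => if i is 0 then mark else None) n.

Definition string (x : seq bool) (p : nat) : atape :=
  ATape (nth None [seq Some (inl b) | b <- x]) p.

Definition nonzero (s : sym) : bool := if s is Some (inr _) then false else true.
Definition is_bit (s : sym) : bool := if s is Some (inl _) then true else false.
Definition is_true_bit (s : sym) : bool := if s is Some (inl true) then true else false.

Lemma atape_eq t t' : acell t =1 acell t' -> apos t = apos t' -> t = t'.
Proof. by case: t t' => [c p] [c' p'] /= /funext-> ->. Qed.

Lemma counter_inc n : awrite (counter n) (ascan (counter n)) MoveRight = counter n.+1.
Proof. by apply: atape_eq => //= i; rewrite /ascan /=; case: eqP => // ->. Qed.

Lemma counter_dec n : awrite (counter n.+1) (ascan (counter n.+1)) MoveLeft = counter n.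
Proof. by apply: atape_eq => //= i; rewrite /ascan /=; case: eqP => // ->. Qed.

Lemma string_right x p : awrite (string x p) (ascan (string x p)) MoveRight = string x p.+1.
Proof. by apply: atape_eq => //= i; rewrite /ascan /=; case: eqP => // ->. Qed.

Lemma string_left x p : awrite (string x p.+1) (ascan (string x p.+1)) MoveLeft = string x p.
Proof. by apply: atape_eq => //= i; rewrite /ascan /=; case: eqP => // ->. Qed.

Lemma nonzero_counter n : nonzero (ascan (counter n)) = (0 < n).
Proof. by case: n. Qed.

Lemma is_bit_string x p : is_bit (ascan (string x p)) = (p < size x).
Proof.
rewrite /ascan /=; case: ltnP => px; first by rewrite (nth_map false).
by rewrite nth_default // size_map.
Qed.

Lemma is_true_bit_string x p : is_true_bit (ascan (string x p)) = nth false x p.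
Proof.
rewrite /ascan /=; case: (ltnP p (size x)) => px.
  by rewrite (nth_map false) //=; case: nth.
by rewrite !nth_default // size_map.
Qed.

Definition inc i := Op i None MoveRight.
Definition dec i := Op i None MoveLeft.
Definition loop i p := While i nonzero (Seq (dec i) p).


Lemma ev_inc A i n : A i = counter n -> ev (inc i) A 1 (upd A i (counter n.+1)).
Proof.
move=> E; have : ev (inc i) A 1 (upd A i (awrite (A i) (ascan (A i)) MoveRight)).
  exact: ev_op.
by rewrite E counter_inc.
Qed.

Lemma ev_dec A i n : A i = counter n.+1 -> ev (dec i) A 1 (upd A i (counter n)).
Proof.
move=> E; have : ev (dec i) A 1 (upd A i (awrite (A i) (ascan (A i)) MoveLeft)).
  exact: ev_op.
by rewrite E counter_dec.
Qed.

Lemma ev_right A i x p : A i = string x p -> ev (inc i) A 1 (upd A i (string x p.+1)).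
Proof.
move=> E; have : ev (inc i) A 1 (upd A i (awrite (A i) (ascan (A i)) MoveRight)).
  exact: ev_op.
by rewrite E string_right.
Qed.

Lemma ev_left A i x p : A i = string x p.+1 -> ev (dec i) A 1 (upd A i (string x p)).
Proof.
move=> E; have : ev (dec i) A 1 (upd A i (awrite (A i) (ascan (A i)) MoveLeft)).
  exact: ev_op.
by rewrite E string_left.
Qed.

Lemma updE A i t j : upd A i t j = if j == i then t else A j.
Proof. by []. Qed.

Lemma upd_id A i t : A i = t -> upd A i t = A.
Proof. by move=> E; apply/funext => j; rewrite updE; case: eqP => // ->. Qed.

Lemma upd_upd A i t t' : upd (upd A i t) i t' = upd A i t'.
Proof. by apply/funext => j; rewrite !updE; case: eqP. Qed.

(* [F k] is the store when the counter [i] still holds [k]. *)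
Lemma ev_loop i p (F : nat -> store) n T :
  (forall k, k <= n -> F k i = counter k) ->
  (forall k, k < n -> exists2 t, t <= T &
     ev p (upd (F k.+1) i (counter k)) t (F k)) ->
  exists2 t, t <= n * T.+2 + 1 & ev (loop i p) (F n) t (F 0).
Proof.
elim: n => [|n IH] Fi body.
  by exists 1 => //; apply: ev_while0; rewrite Fi.
have [||t tT H] := IH; [by move=> k /leqW/Fi|by move=> k /leqW; apply: body|].
have [t' t'T H'] := body n (ltnSn n).
exists ((1 + t') + t).+1; first by rewrite mulSn; lia.
apply: ev_while1 H; first by rewrite Fi.
by apply: ev_seq H'; apply: ev_dec; apply: Fi.
Qed.


Lemma ev_loop_eq i p (F : nat -> store) n T A B :
  A = F n -> B = F 0 ->
  (forall k, k <= n -> F k i = counter k) ->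
  (forall k, k < n -> exists2 t, t <= T &
     ev p (upd (F k.+1) i (counter k)) t (F k)) ->
  exists2 t, t <= n * T.+2 + 1 & ev (loop i p) A t B.
Proof. by move=> -> ->; apply: ev_loop. Qed.

Lemma ev_clear i A n : A i = counter n ->
  exists2 t, t <= n.*2.+1 & ev (While i nonzero (dec i)) A t (upd A i (counter 0)).
Proof.
elim: n A => [|n IH] A Ai.
  by exists 1 => //; rewrite upd_id //; apply: ev_while0; rewrite Ai.
have [|t tT H] := IH (upd A i (counter n)); first by rewrite updE eqxx.
exists (1 + t).+1; first by lia.
rewrite -(upd_upd A i (counter n)); apply: ev_while1 H; first by rewrite Ai.
exact: ev_dec.
Qed.

Lemma ev_seq_eq p q A n B m C t D : ev p A n B -> ev q B m C -> t = n + m -> C = D ->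
  ev (Seq p q) A t D.
Proof. by move=> H1 H2 -> <-; apply: ev_seq H1 H2. Qed.

Lemma ev_eq p A t B B' : ev p A t B -> B = B' -> ev p A t B'.
Proof. by move=> H <-. Qed.

Definition skip := If 0 pred0 (inc 0).

Lemma ev_skip A : ev skip A 1 A.
Proof. exact: ev_if0. Qed.

(** Expressions read copies of the inputs, on tapes 2 and 3, because tape 0 or 1 is overwritten by
    the output or the query. *)
Definition string_tape (s : bool) : nat := s.+2.

(* Adds the value of [e] to the register [acc]; the registers from [d] on are
   free, [vars] are the registers of the variables. *)
Fixpoint compile (vars : seq nat) (e : expr) (acc d : nat) : prog :=
  match e with
  | EVar => if vars is v :: _ then
             Seq (loop v (Seq (inc acc) (inc d))) (loop d (inc v))
           else skip
  | EWk e => compile (behead vars) e acc d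
  | EOne => inc acc
  | ELen s =>
      Seq (While (string_tape s) is_bit
             (Seq (inc (string_tape s)) (Seq (inc acc) (inc d))))
          (loop d (dec (string_tape s)))
  | EBit s e =>
      Seq (compile vars e d d.+2)
      (Seq (loop d (Seq (inc (string_tape s)) (inc d.+1)))
      (Seq (If (string_tape s) is_true_bit (inc acc))
           (loop d.+1 (dec (string_tape s)))))
  | EAdd e f => Seq (compile vars e acc d) (compile vars f acc d)
  | ESub e f =>
      Seq (compile vars e d d.+2)
      (Seq (compile vars f d.+1 d.+2)
      (Seq (loop d.+1 (If d nonzero (dec d)))
           (loop d (inc acc))))
  | ESum e f =>
      Seq (compile vars e d d.+2)
      (Seq (loop d (Seq (compile (d.+1 :: vars) f acc d.+2) (inc d.+1)))
           (While d.+1 nonzero (dec d.+1)))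
  end.

(** The invariant of [compile]. Registers start at tape 4, after the strings; the accumulator
    differs from the variables, which must keep their values while it grows. *)
Definition holds xs (vars env : seq nat) (acc d : nat) A : Prop :=
  [/\ forall s : bool, A (string_tape s) = string (nth [::] xs s) 0,
      size vars = size env,
      forall k, k < size vars -> A (nth 0 vars k) = counter (nth 0 env k) /\
        4 <= nth 0 vars k < d /\ nth 0 vars k <> acc,
      forall j, d <= j -> A j = counter 0
    & 4 <= acc < d].

(** One bound for value and time: values bound the numbers of iterations and, under [ESum], the
    bound variable. *)
Definition compiles e := exists T : nat -> nat, poly_bounded T /\
  forall xs env m vars acc d v A,
  (forall s, size (nth [::] xs s) <= m) -> (forall k, nth 0 env k <= m) ->
  holds xs vars env acc d A -> A acc = counter v ->
  eval xs env e <= T m /\ exists2 t, t <= T m &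
    ev (compile vars e acc d) A t (upd A acc (counter (v + eval xs env e))).

Ltac store_cases := rewrite ?updE; repeat (case: eqP => ?);
  try (by []); try (by exfalso; lia); try (by congr counter; lia);
  try (by congr string; lia);
  try (by subst; repeat match goal with
       | H : _ = counter _ |- _ => rewrite H
       | H : _ = string _ _ |- _ => rewrite H end;
     first [by [] | congr counter; lia | congr string; lia]).
Ltac store := let j := fresh "j" in apply/funext => j; store_cases.

Lemma string_tape_lt s : string_tape s < 4.
Proof. by case: s. Qed.

(** Reading a register empties it, so its content goes to [acc] and to the scratch register [d] at
    once, and is then restored from [d]. *)
Lemma compiles_var : compiles EVar.
Proof.
exists (fun m => m * 4 + 1 + (m * 3 + 1) + m + 1); split.
  do ![apply: poly_bounded_add | apply: poly_bounded_mul
      | apply: poly_bounded_id | apply: poly_bounded_cst].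
move=> xs env m vars acc d v A _ em [_ se H zA /andP[acc4 accd]] Av /=.
case: vars env se H em => [|r vars] [|n env] //= _ H em.
  split=> //; exists 1; first by lia.
  by apply: ev_eq (ev_skip _) _; rewrite addn0 upd_id.
have /= nm := em 0; split; first by lia.
have [/= Ar [/andP[r4 rd] racc]] := H 0 isT.
have Ad := zA d (leqnn d).
have [||k kn|t1 t1T H1] := @ev_loop_eq r (Seq (inc acc) (inc d)) (fun k =>
    upd (upd (upd A r (counter k)) acc (counter (v + (n - k)))) d (counter (n - k)))
    n 2 A _ _ erefl.
- store.
- by move=> k kn; store_cases.
- exists 2 => //; refine (ev_seq_eq (@ev_inc _ _ (v + (n - k.+1)) _)
    (@ev_inc _ _ (n - k.+1) _) erefl _); by [store_cases | store].
have [|||k kn|t2 t2T H2] := @ev_loop_eq d (inc r) (fun k =>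
    upd (upd (upd A acc (counter (v + n))) r (counter (n - k))) d (counter k)) n 1
    (upd (upd (upd A r (counter 0)) acc (counter (v + (n - 0)))) d (counter (n - 0)))
    (upd A acc (counter (v + n))).
- store.
- store.
- by move=> k kn; store_cases.
- exists 1 => //; apply: ev_eq (@ev_inc _ _ (n - k.+1) _) _; by [store_cases | store].
by exists (t1 + t2); [lia | apply: ev_seq H1 H2].
Qed.

Lemma holds_weaken xs vars env acc d A acc' d' A' :
  holds xs vars env acc d A -> d <= d' -> acc' = acc \/ d <= acc' -> acc' < d' ->
  (forall j, j < d -> j <> acc -> A' j = A j) ->
  (forall j, d' <= j -> A' j = counter 0) -> holds xs vars env acc' d' A'.
Proof.
move=> [sA se H zA /andP[acc4 accd]] dd' Eacc accd' eA zA'; split=> //.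
- move=> s; have := string_tape_lt s => s4; rewrite eA ?sA //; lia.
- move=> k kv; have [Ak [kd kacc]] := H k kv.
  by rewrite eA ?Ak //; [split=> //; split|]; lia.
- by lia.
Qed.

Lemma ev_scan s x p (F : nat -> store) T A B : A = F 0 -> B = F (size x) ->
  (forall k, k <= size x -> F k s = string x k) ->
  (forall k, k < size x -> exists2 t, t <= T & ev p (F k) t (F k.+1)) ->
  exists2 t, t <= size x * T.+1 + 1 & ev (While s is_bit p) A t B.
Proof.
move=> -> -> Fs body.
suff H j : j <= size x -> exists2 t, t <= j * T.+1 + 1 &
    ev (While s is_bit p) (F (size x - j)) t (F (size x)).
  by have := H _ (leqnn _); rewrite subnn.
elim: j => [|j IH] jx.
  rewrite subn0; exists 1 => //; apply: ev_while0.
  by rewrite Fs // is_bit_string ltnn.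
have [t tT H] := IH (ltnW jx).
have [|t' t'T H'] := body (size x - j.+1); first by lia.
exists (t' + t).+1; first by rewrite mulSn; lia.
rewrite (_ : (size x - j.+1).+1 = size x - j) in H'; last by lia.
apply: ev_while1 H' H; rewrite Fs ?is_bit_string; lia.
Qed.

Ltac poly_closed :=
  do ![ assumption | apply: poly_bounded_add | apply: poly_bounded_mul
      | apply: poly_bounded_id | apply: poly_bounded_cst ].

Lemma compiles_one : compiles EOne.
Proof.
exists (fun=> 1); split; first by poly_closed.
move=> xs env m vars acc d v A _ _ _ Av; split=> //; exists 1 => //.
by rewrite addn1; apply: ev_inc.
Qed.

Lemma compiles_wk e : compiles e -> compiles (EWk e).
Proof.
case=> T [pT H]; exists T; split=> // xs env m vars acc d v A xm em.
case=> sA se Hv zA accd Av /=; apply: H => //.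
  by move=> k; rewrite nth_behead.
split=> //; first by rewrite !size_behead se.
by move=> k kv; rewrite !nth_behead; apply: Hv; move: kv; rewrite size_behead; lia.
Qed.

Lemma ev_rewind A s x d n : A (string_tape s) = string x n ->
  A d = counter n -> 4 <= d ->
  exists2 t, t <= n * 3 + 1 & ev (loop d (dec (string_tape s))) A t
    (upd (upd A (string_tape s) (string x 0)) d (counter 0)).
Proof.
move=> As Ad d4; have s4 := string_tape_lt s; set r := string_tape s in As s4 *.
apply: (@ev_loop_eq d (dec r) (fun k =>
  upd (upd A r (string x k)) d (counter k)) n 1).
- store.
- store.
- by move=> k kn; store_cases.
- move=> k kn; exists 1 => //; apply: ev_eq (@ev_left _ _ x k _) _.
    by store_cases.
  store.
Qed.

Lemma compiles_len s : compiles (ELen s).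
Proof.
exists (fun m => m * 4 + 1 + (m * 3 + 1) + m + 1); split; first by poly_closed.
move=> xs env m vars acc d v A xm _ [sA _ _ zA /andP[acc4 accd]] Av /=.
have := xm s; have As := sA s; have Ad := zA d (leqnn d).
move: (nth [::] xs s) As => x As sx; split; first by lia.
have s4 := string_tape_lt s; set r := string_tape s in As s4 *.
have [|||k kn|t1 t1T H1] := @ev_scan r x (Seq (inc r) (Seq (inc acc) (inc d)))
    (fun k => upd (upd (upd A r (string x k)) acc (counter (v + k))) d (counter k))
    3 A (upd (upd (upd A r (string x (size x))) acc (counter (v + size x))) d
      (counter (size x))).
- store.
- store.
- by move=> k kn; store_cases.
- exists 3 => //; refine (ev_seq_eq (@ev_right _ _ x k _) (ev_seq
    (@ev_inc _ _ (v + k) _) (@ev_inc _ _ k _)) erefl _); by [store_cases|store].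
have [|||t2 t2T H2] := @ev_rewind (upd (upd (upd A r (string x (size x))) acc
  (counter (v + size x))) d (counter (size x))) s x d (size x).
- by store_cases.
- by store_cases.
- by lia.
exists (t1 + t2); first by lia.
apply: ev_seq_eq H1 H2 erefl _; rewrite -/r; store.
Qed.

Lemma compiles_add e f : compiles e -> compiles f -> compiles (EAdd e f).
Proof.
move=> [T [pT H]] [T' [pT' H']]; exists (fun m => T m + T' m).
split; first by poly_closed.
move=> xs env m vars acc d v A xm em hA Av /=.
have [le [t tT evt]] := H xs env m vars acc d v A xm em hA Av.
have [||le' [t' tT' evt']] := H' xs env m vars acc d (v + eval xs env e)
   (upd A acc (counter (v + eval xs env e))) xm em.
- case: (hA) => _ _ _ zA accd; apply: (holds_weaken hA); rewrite ?leqnn //.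
  + by left.
  + by case/andP: accd.
  + by move=> j jd /eqP/negPf jacc; rewrite updE jacc.
  + by move=> j dj; store_cases; apply: zA.
- by rewrite updE eqxx.
split; first by lia.
exists (t + t'); first by lia.
by apply: ev_seq_eq evt evt' erefl _; rewrite upd_upd addnA.
Qed.

(** For operands evaluated into the scratch registers [d] and [d.+1]; the store [B] may already
    contain the first of them. *)
Lemma compiles_scratch xs env m vars acc d A e T i B :
  (forall xs env m vars acc d v A,
    (forall s, size (nth [::] xs s) <= m) -> (forall k, nth 0 env k <= m) ->
    holds xs vars env acc d A -> A acc = counter v ->
    eval xs env e <= T m /\ exists2 t, t <= T m &
      ev (compile vars e acc d) A t (upd A acc (counter (v + eval xs env e)))) ->
  (forall s, size (nth [::] xs s) <= m) -> (forall k, nth 0 env k <= m) ->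
  holds xs vars env acc d A -> i < 2 ->
  (forall j, j < d -> B j = A j) -> (forall j, d.+2 <= j -> B j = counter 0) ->
  B (d + i) = counter 0 ->
  eval xs env e <= T m /\ exists2 t, t <= T m &
    ev (compile vars e (d + i) d.+2) B t (upd B (d + i) (counter (eval xs env e))).
Proof.
move=> H xm em hA i2 eB zB Bi.
have := H xs env m vars (d + i) d.+2 0 B xm em; rewrite add0n; apply=> //.
case: (hA) => _ _ _ zA accd; apply: (holds_weaken hA).
- by lia.
- by right; lia.
- by lia.
- by move=> j jd _; apply: eB.
- exact: zB.
Qed.

(** The head walks to the position, counting in [d.+1] for the way back. Beyond the string it meets
    a blank, read as [false] like the default of [nth]. *)
Lemma compiles_bit s e : compiles e -> compiles (EBit s e).
Proof.
move=> [T [pT H]]; exists (fun m => T m + (T m * 4 + 1) + 2 + (T m * 3 + 1) + 1).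
split; first by poly_closed.
move=> xs env m vars acc d v A xm em hA Av /=.
case: (hA) => sA _ _ zA /andP[acc4 accd].
have Ad := zA d (leqnn d).
have [||||le [t0 tT evt]] := @compiles_scratch xs env m vars acc d A e T 0 A H xm em hA.
- by [].
- by [].
- by move=> j dj; apply: zA; lia.
- by rewrite addn0.
rewrite addn0 in evt; have As := sA s; move: (eval xs env e) le evt => n nT evt.
have Ad1 := zA d.+1 (leqnSn d).
move: (nth [::] xs s) As => x As; split; first by case: (nth _ _ _); lia.
have s4 := string_tape_lt s; set r := string_tape s in As s4 *.
pose A1 := upd (upd (upd A r (string x n)) d (counter 0)) d.+1 (counter n).
have [|||k kn|t1 t1T H1] := @ev_loop_eq d (Seq (inc r) (inc d.+1)) (fun k =>
  upd (upd (upd A r (string x (n - k))) d (counter k)) d.+1 (counter (n - k))) n 2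
  (upd A d (counter n)) A1.
- store.
- by rewrite /A1; store.
- by move=> k kn; store_cases.
- exists 2 => //; refine (ev_seq_eq (@ev_right _ _ x (n - k.+1) _)
    (@ev_inc _ _ (n - k.+1) _) erefl _); by [store_cases|store].
pose A2 := upd A1 acc (counter (v + nth false x n)).
have [t2 t2T H2] : exists2 t, t <= 2 & ev (If r is_true_bit (inc acc)) A1 t A2.
  have A1r : A1 r = string x n by rewrite /A1; store_cases.
  have A1a : A1 acc = counter v by rewrite /A1; store_cases.
  have := is_true_bit_string x n; rewrite /A2; case: (nth _ _ _) => E.
    exists 2 => //; rewrite addn1; apply: ev_if1; first by rewrite A1r E.
    exact: ev_inc.
  exists 1 => //; rewrite addn0 upd_id //; apply: ev_if0.
  by rewrite A1r E.
have [|||t3 t3T H3] := @ev_rewind A2 s x d.+1 n.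
- by rewrite /A2 /A1; store_cases.
- by rewrite /A2 /A1; store_cases.
- by lia.
exists (t0 + (t1 + (t2 + t3))); first by lia.
apply: (ev_seq evt); apply: (ev_seq H1); apply: (ev_seq H2).
by apply: ev_eq H3 _; rewrite -/r /A2 /A1; store.
Qed.

Lemma compiles_sub e f : compiles e -> compiles f -> compiles (ESub e f).
Proof.
move=> [T [pT H]] [T' [pT' H']].
exists (fun m => T m + T' m + (T' m * 4 + 1) + (T m * 3 + 1)).
split; first by poly_closed.
move=> xs env m vars acc d v A xm em hA Av /=.
case: (hA) => sA _ _ zA /andP[acc4 accd].
have Ad := zA d (leqnn d); have Ad1 := zA d.+1 (leqnSn d).
have [||||le [t0 tT evt]] := @compiles_scratch xs env m vars acc d A e T 0 A H xm em hA.
- by [].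
- by [].
- by move=> j dj; apply: zA; lia.
- by rewrite addn0.
rewrite addn0 in evt.
have [||||le' [t1 tT' evt']] := @compiles_scratch xs env m vars acc d A f T' 1
  (upd A d (counter (eval xs env e))) H' xm em hA.
- by [].
- by move=> j jd; store_cases.
- by move=> j dj; store_cases; apply: zA; lia.
- by rewrite addn1; store_cases.
rewrite addn1 in evt'.
move: (eval xs env e) (eval xs env f) le le' evt evt' => a b aT bT evt evt'.
split; first by lia.
pose A1 := upd A d (counter (a - b)).
have [|||k kn|t2 t2T H2] := @ev_loop_eq d.+1 (If d nonzero (dec d)) (fun k =>
  upd (upd A d (counter (a - (b - k)))) d.+1 (counter k)) b 2
  (upd (upd A d (counter a)) d.+1 (counter b)) A1.
- store.
- by rewrite /A1; store.
- by move=> k kn; store_cases.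
- set F := upd _ _ _; have Fd : F d = counter (a - (b - k.+1)).
    by rewrite /F; store_cases.
  case E: (a - (b - k.+1)) Fd => [|c] Fd.
    exists 1 => //; apply: ev_eq (ev_if0 _ _) _; first by rewrite Fd.
    by rewrite /F; store.
  exists 2 => //; apply: ev_if1; first by rewrite Fd.
  by apply: ev_eq (ev_dec Fd) _; rewrite /F; store.
have [|||k kn|t3 t3T H3] := @ev_loop_eq d (inc acc) (fun k =>
  upd (upd A d (counter k)) acc (counter (v + (a - b - k)))) (a - b) 1
  A1 (upd A acc (counter (v + (a - b)))).
- by rewrite /A1; store.
- by store.
- by move=> k kn; store_cases.
- exists 1 => //; apply: ev_eq (@ev_inc _ _ (v + (a - b - k.+1)) _) _;
    by [store_cases|store].
exists (t0 + (t1 + (t2 + t3))); first by lia.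
by apply: (ev_seq evt); apply: (ev_seq evt'); apply: (ev_seq H2 H3).
Qed.

Lemma compiles_sum e f : compiles e -> compiles f -> compiles (ESum e f).
Proof.
move=> [T [pT H]] [T' [pT' H']].
exists (fun m => T m + (T m * (T' (m + T m) + 1).+2 + 1) + (T m * 2 + 1)
  + T m * T' (m + T m)).
(* The bound variable ranges below [T m], so the body is evaluated in an environment bounded by
   [m + T m]. *)
have pT2 : poly_bounded (fun m => T' (m + T m)).
  by apply: (poly_bounded_comp pT' (g := fun m => m + T m)); poly_closed.
split.
  apply: (@poly_bounded_le _ (fun m => T m + (T m * (T' (m + T m) + 3) + 1)
    + (T m * 2 + 1) + T m * T' (m + T m))).
    by move=> m; rewrite (_ : (T' (m + T m) + 1).+2 = T' (m + T m) + 3) //; lia.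
  by poly_closed.
move=> xs env m vars acc d v A xm em hA Av /=.
case: (hA) => sA _ hv zA /andP[acc4 accd].
have Ad := zA d (leqnn d); have Ad1 := zA d.+1 (leqnSn d).
have [||||le [t0 tT evt]] := @compiles_scratch xs env m vars acc d A e T 0 A H xm em hA.
- by [].
- by [].
- by move=> j dj; apply: zA; lia.
- by rewrite addn0.
rewrite addn0 in evt.
move: (eval xs env e) le evt => n nT evt.
pose g i := eval xs (i :: env) f.
have xm' s : size (nth [::] xs s) <= m + T m by have := xm s; lia.
have em' i k : i < n -> nth 0 (i :: env) k <= m + T m.
  by case: k => [|k] /= lin; [|have := em k]; lia.
have step i v' B : i < n -> (forall j, j < d -> j <> acc -> B j = A j) ->
    B d.+1 = counter i -> (forall j, d.+2 <= j -> B j = counter 0) ->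
    B acc = counter v' ->
    g i <= T' (m + T m) /\ exists2 t, t <= T' (m + T m) &
      ev (compile (d.+1 :: vars) f acc d.+2) B t (upd B acc (counter (v' + g i))).
  move=> lin eB Bd zB Ba; apply: H' => //; first by move=> k; apply: em'.
  have [sB seB hB zB' aB] : holds xs vars env acc d.+2 B.
    by apply: (holds_weaken hA) => //; [lia|left|lia].
  split=> //; first by rewrite /= seB.
  by case=> [|k] /= kv; [split=> //; lia|apply: hB].
have sumT j : j <= n -> \sum_(i < j) g i <= j * T' (m + T m).
  elim: j => [|j IH] jn; first by rewrite big_ord0.
  rewrite big_ord_recr /= mulSn addnC leq_add ?IH //; last exact: ltnW.
  have [||||//|gT _] := step j 0 (upd (upd A acc (counter 0)) d.+1 (counter j)).
  - by [].
  - by move=> k kd ka; store_cases.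
  - by store_cases.
  - by move=> k dk; store_cases; apply: zA; lia.
  - by store_cases.
  by [].
split.
  apply: leq_trans (sumT n (leqnn n)) _; apply: leq_trans (leq_addl _ _).
  by rewrite leq_mul2r nT orbT.
pose S j := \sum_(i < j) g i.
pose A1 := upd (upd A acc (counter (v + S n))) d.+1 (counter n).
have [|||k kn|t1 t1T H1] := @ev_loop_eq d (Seq (compile (d.+1 :: vars) f acc d.+2) (inc d.+1))
  (fun k => upd (upd (upd A d (counter k)) acc (counter (v + S (n - k)))) d.+1
     (counter (n - k))) n (T' (m + T m) + 1) (upd A d (counter n)) A1.
- have S0 : S 0 = 0 by rewrite /S big_ord0.
  by rewrite subnn S0 addn0; store.
- by rewrite subn0 /A1; store.
- by move=> k kn; store_cases.
- set F := upd _ _ _.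
  have [|||||_ [t tT' evB]] := step (n - k.+1) (v + S (n - k.+1)) F.
  + by lia.
  + by move=> j jd ja; rewrite /F; store_cases.
  + by rewrite /F; store_cases.
  + by move=> j dj; rewrite /F; store_cases; apply: zA; lia.
  + by rewrite /F; store_cases.
  exists (t + 1); first by lia.
  refine (ev_seq_eq evB (@ev_inc _ _ (n - k.+1) _) erefl _).
    by rewrite /F; store_cases.
  have SE : S (n - k) = S (n - k.+1) + g (n - k.+1).
    rewrite (_ : n - k = (n - k.+1).+1); last by lia.
    by rewrite /S big_ord_recr.
  by rewrite /F SE; store.
have [|t2 t2T H2] := @ev_clear d.+1 A1 n; first by rewrite /A1; store_cases.
exists (t0 + (t1 + t2)).
  have : n * (T' (m + T m) + 1).+2 <= T m * (T' (m + T m) + 1).+2.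
    by rewrite leq_mul2r nT orbT.
  by move: t1T tT t2T; lia.
apply: (ev_seq evt); apply: (ev_seq_eq H1 H2 erefl); rewrite /A1 /S /g; store.
Qed.

Theorem compile_correct e : compiles e.
Proof.
elim: e => [|e IH||s|s e IH|e IHe f IHf|e IHe f IHf|e IHe f IHf].
- exact: compiles_var.
- exact: compiles_wk.
- exact: compiles_one.
- exact: compiles_len.
- exact: compiles_bit.
- exact: compiles_add.
- exact: compiles_sub.
- exact: compiles_sum.
Qed.

Fixpoint width (e : expr) : nat :=
  match e with
  | EVar | EOne | ELen _ => 2
  | EWk e => width e
  | EBit _ e => (width e).+2
  | EAdd e f => width e + width f
  | ESub e f | ESum e f => (width e + width f).+2
  end.

Lemma width_gt1 e : 1 < width e.
Proof. by elim: e => //=; lia. Qed.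

Lemma comp_bounded e vars acc d b : (forall k, k < size vars -> nth 0 vars k < d) ->
  acc < d -> 3 < d -> d + width e <= b -> pbounded b (compile vars e acc d).
Proof.
have st s d' : 3 < d' -> string_tape s < d' by have := string_tape_lt s; lia.
elim: e vars acc d b => [|e IH||s|s e IH|e IHe f IHf|e IHe f IHf|e IHe f IHf]
  vars acc d b Hv Ha d4 /= db; rewrite ?andbT.
- case: vars Hv => [|v vars] /= Hv; first by lia.
  by have := Hv 0 isT => /=; lia.
- apply: IH => // k; rewrite size_behead nth_behead => kv; apply: Hv; lia.
- by lia.
- by have := st s _ d4; lia.
- have s4 := st s _ d4; have := width_gt1 e => w1.
  rewrite IH //=; [lia| |lia..].
  by move=> k /Hv; lia.
- by rewrite IHe ?IHf //; have := width_gt1 e; have := width_gt1 f; lia.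
- have := width_gt1 e; have := width_gt1 f => w1 w2.
  rewrite IHe ?IHf //=; try lia; by move=> k /Hv; lia.
- have := width_gt1 e; have := width_gt1 f => w1 w2.
  rewrite IHe ?IHf //=; try lia; first by case=> [|k] //= /Hv; lia.
  by move=> k /Hv; lia.
Qed.

(** * Copies of the inputs and initialization of the registers *)

Definition write_bit i b := Op i (Some (Some (inl b))) Stay.

Definition is_false_bit (s : sym) : bool := if s is Some (inl false) then true else false.

Definition copy (src dst c : nat) : prog :=
  Seq (While src is_bit
        (Seq (If src is_true_bit (write_bit dst true))
        (Seq (If src is_false_bit (write_bit dst false))
        (Seq (inc src) (Seq (inc dst) (inc c))))))
      (loop c (Seq (dec src) (dec dst))).

Lemma string_write x p b : p < size x -> nth false x p = b ->
  awrite (string (take p x) p) (Some (inl b)) Stay = string (take p.+1 x) p.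
Proof.
move=> px xb; apply: atape_eq => //= i.
rewrite (take_nth false px) map_rcons nth_rcons size_map size_takel ?(ltnW px) //.
rewrite xb; case: ltngtP => // pi.
by rewrite nth_default // size_map size_takel //; lia.
Qed.

Lemma ev_copy A src dst c x : src != dst -> src != c -> dst != c ->
  A src = string x 0 -> A dst = string [::] 0 -> A c = counter 0 ->
  exists2 t, t <= size x * 12 + 2 & ev (copy src dst c) A t (upd A dst (string x 0)).
Proof.
move=> sd sc dc As Ad Ac.
pose F k := upd (upd (upd A src (string x k)) dst (string (take k x) k)) c (counter k).
have [|||k kx|t1 t1T H1] := @ev_scan src x
   (Seq (If src is_true_bit (write_bit dst true))
   (Seq (If src is_false_bit (write_bit dst false))
   (Seq (inc src) (Seq (inc dst) (inc c))))) F 7 A (F (size x)).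
- by rewrite /F take0; store.
- by [].
- by move=> k kx; rewrite /F; store_cases.
- pose B := upd (F k) dst (string (take k.+1 x) k).
  have Fs : F k src = string x k by rewrite /F; store_cases.
  have Bs : B src = string x k by rewrite /B /F; store_cases.
  have Fd : F k dst = string (take k x) k by rewrite /F; store_cases.
  have Bd : B dst = string (take k.+1 x) k by rewrite /B /F; store_cases.
  have sc1 : ascan (string x k) = Some (inl (nth false x k)).
    by rewrite /ascan /= (nth_map false).
  have [t [tT Ht]] : exists t, t <= 2 + 1 /\ ev (Seq (If src is_true_bit (write_bit dst true))
      (If src is_false_bit (write_bit dst false))) (F k) t B.
    case E: (nth false x k); rewrite {}E in sc1.
    - exists (2 + 1); split=> //; apply: (ev_seq (B := B)).
        apply: ev_if1; first by rewrite Fs sc1.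
        rewrite /B -(string_write kx (b := true)); last first.
          by move: sc1; rewrite /ascan /= (nth_map false) // => -[].
        by rewrite -Fd; apply: ev_op.
      by apply: ev_if0; rewrite Bs sc1.
    - exists (1 + 2); split=> //; apply: (ev_seq (B := F k)).
        by apply: ev_if0; rewrite Fs sc1.
      apply: ev_if1; first by rewrite Fs sc1.
      rewrite /B -(string_write kx (b := false)); last first.
        by move: sc1; rewrite /ascan /= (nth_map false) // => -[].
      by rewrite -Fd; apply: ev_op.
  (* The two conditionals are separated again, as in the program the second one is grouped with the
     moves that follow. *)
  have {Ht} [n [m [C [H1 H2 nm]]]] : exists n m C, [/\
      ev (If src is_true_bit (write_bit dst true)) (F k) n C,
      ev (If src is_false_bit (write_bit dst false)) C m B & t = n + m].
    by inversion Ht; subst; exists n, m, B0.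
  exists (n + (m + 3)); first by lia.
  refine (ev_seq_eq H1 (ev_seq H2 (ev_seq (@ev_right _ _ x k _)
    (ev_seq (@ev_right _ _ (take k.+1 x) k _) (@ev_inc _ _ k _)))) erefl _);
    rewrite /B /F; by [store_cases|store].
have [|||k kx|t2 t2T H2] := @ev_loop_eq c (Seq (dec src) (dec dst)) (fun k =>
  upd (upd (upd A src (string x k)) dst (string x k)) c (counter k)) (size x) 2
  (F (size x)) (upd A dst (string x 0)).
- by rewrite /F take_size.
- by store.
- by move=> k kx; store_cases.
- exists 2 => //; refine (ev_seq_eq (@ev_left _ _ x k _) (@ev_left _ _ x k _) erefl _);
    by [store_cases|store].
by exists (t1 + t2); [lia | apply: ev_seq H1 H2].
Qed.

(** Tapes start blank, whereas a register needs its mark in cell 0. *)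
Definition mark_all (b : nat) : prog :=
  foldr (fun i p => Seq (Op i (Some mark) Stay) p) skip (iota 4 (b - 4)).

(** The machine has no tapes from [b] on; counting them as zero registers makes the invariant
    [holds], which speaks of all registers, attainable. *)
Definition start_store (b : nat) (x w : seq bool) : store := fun i =>
  match i with
  | 0 => string x 0
  | 1 => string w 0
  | _ => if i < b then string [::] 0 else counter 0
  end.

Lemma ev_mark_all b x w : 4 <= b -> exists2 t, t <= b &
  ev (mark_all b) (start_store b x w) t
   (fun i => if i < 4 then start_store b x w i else counter 0).
Proof.
move=> b4; rewrite /mark_all.
suff H n j A : (forall i, j <= i < j + n -> A i = string [::] 0) ->
    exists2 t, t <= n.+1 & ev (foldr (fun i p => Seq (Op i (Some mark) Stay) p)
      skip (iota j n)) A t (fun i => if j <= i < j + n then counter 0 else A i).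
  have [|t tb Ht] := H (b - 4) 4 (start_store b x w).
    by case=> [|[|i]] //= ij; rewrite ifT //; lia.
  exists t; first by lia.
  apply: ev_eq Ht _; apply/funext => -[|[|i]] //=.
  by do ![case: ifP => ?] => //; exfalso; lia.
elim: n j A => [|n IH] j A Aj /=.
  exists 1 => //; apply: ev_eq (ev_skip A) _; apply/funext => i.
  by rewrite ifF //; lia.
have [i ij|t tn Ht] := IH j.+1 (upd A j (counter 0)).
  by rewrite updE ifF; [apply: Aj|]; lia.
exists (1 + t); first by lia.
apply: (@ev_seq _ _ _ _ (upd A j (counter 0))).
  have -> : counter 0 = awrite (A j) mark Stay.
    rewrite Aj; last by lia.
    by apply: atape_eq => //= i; rewrite nth_nil; case: i.
  exact: ev_op.
apply: ev_eq Ht _; apply/funext => i; rewrite updE.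
by do ![case: ifP => ?] => //; exfalso; lia.
Qed.

Lemma mark_all_bounded b : 0 < b -> pbounded b (mark_all b).
Proof.
move=> b0; rewrite /mark_all; have: all (fun i => i < b) (iota 4 (b - 4)).
  by apply/allP => i; rewrite mem_iota; lia.
by elim: (iota _ _) => /= [|i s IH]; [rewrite b0 | case/andP=> -> /IH].
Qed.

Definition prologue b : prog := Seq (mark_all b) (Seq (copy 0 2 4) (copy 1 3 4)).

Definition ready (x w : seq bool) : store := fun i =>
  match i with
  | 0 | 2 => string x 0
  | 1 | 3 => string w 0
  | _ => counter 0
  end.

Lemma ev_prologue b x w : 4 < b -> exists2 t, t <= b + 4 + (size x + size w) * 12 &
  ev (prologue b) (start_store b x w) t (ready x w).
Proof.
move=> b4; have [t1 t1T H1] := ev_mark_all x w (ltnW b4).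
set B := (fun i => _) in H1.
have b2 : 2 < b by lia.
have b3 : 3 < b by lia.
have [||||||t2 t2T H2] := @ev_copy B 0 2 4 x; rewrite /B //=; [by rewrite b2|].
have [||||||t3 t3T H3] := @ev_copy (upd B 2 (string x 0)) 1 3 4 w;
  rewrite /B //=; rewrite ?updE /=; [by rewrite b3|].
exists (t1 + (t2 + t3)); first by lia.
apply: (ev_seq H1); apply: ev_seq_eq H2 H3 erefl _.
by apply/funext => -[|[|[|[|i]]]].
Qed.

Lemma ready_holds x w d : 4 < d -> holds [:: x; w] [::] [::] 4 d (ready x w).
Proof.
move=> d4; split=> //.
- by case.
- by case=> [|[|[|[|j]]]] //; lia.
Qed.

Lemma mkseq_bits (s : seq sym) n (f : nat -> bool) :
  (forall i, i < n -> nth None s i = Some (inl (f i))) -> nth None s n = None ->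
  bits s = mkseq f n.
Proof.
elim: n s f => [|n IH] [|a s] f Hs Hn //=.
- by move: Hn => /= ->.
- by have := Hs 0 isT.
- have /= -> := Hs 0 isT; rewrite /mkseq /= (IH s (fun i => f i.+1)) //.
    by rewrite -[1]addn0 iotaDl -map_comp.
  by move=> i lin; apply: (Hs i.+1).
Qed.

(** * Programs that print a computed string *)

Section Output.
Variables (eb el : expr) (ot : nat).
Hypothesis ot2 : ot < 2.

(** Register 5 is the position and register 6 the value of its bit. Conditionals have one branch, so
    [false] is written first and corrected afterwards. *)
Definition emit : prog :=
  Seq (compile [:: 5] eb 6 7)
  (Seq (write_bit ot false)
  (Seq (If 6 nonzero (Seq (write_bit ot true) (While 6 nonzero (dec 6))))
  (Seq (inc ot) (inc 5)))).

(** The output tape may still carry input after the last bit, hence the final blank; register 5 then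
    counts the way back. *)
Definition output_prog (b : nat) : prog :=
  Seq (prologue b) (Seq (compile [::] el 4 6) (Seq (loop 4 emit)
   (Seq (Op ot (Some None) Stay) (loop 5 (dec ot))))).

Definition output_bound := 7 + width eb + width el.

Definition out_len x := eval [:: x; [::]] [::] el.
Definition out_bit x i := 0 < eval [:: x; [::]] [:: i] eb.

Definition out_cells x k (c : nat -> sym) : nat -> sym :=
  fun i => if i < k then Some (inl (out_bit x i)) else c i.

Lemma output_prog_bounded b : output_bound <= b -> pbounded b (output_prog b).
Proof.
rewrite /output_bound => bb; have we := width_gt1 eb; have wl := width_gt1 el.
rewrite /= mark_all_bounded; last by lia.
rewrite /= !comp_bounded //=; try lia.
by case.
Qed.

Lemma ev_write_bit A i b c p : A i = ATape c p ->
  ev (write_bit i b) A 1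
    (upd A i (ATape (fun j => if j == p then Some (inl b) else c j) p)).
Proof.
move=> E; have : ev (write_bit i b) A 1 (upd A i (awrite (A i) (Some (inl b)) Stay)).
  exact: ev_op.
by rewrite E.
Qed.

Lemma ev_write_test A c p v : A ot = ATape c p -> A 6 = counter v ->
  exists n1 n2 C, [/\ n1 + n2 <= v.*2 + 5, ev (write_bit ot false) A n1 C &
    ev (If 6 nonzero (Seq (write_bit ot true) (While 6 nonzero (dec 6)))) C n2
    (upd (upd A 6 (counter 0)) ot
      (ATape (fun j => if j == p then Some (inl (0 < v)) else c j) p))].
Proof.
move=> Ao A6; pose A1 := upd A ot (ATape (fun j => if j == p then Some (inl false) else c j) p).
have A16 : A1 6 = counter v by rewrite /A1; store_cases.
have H1 : ev (write_bit ot false) A 1 A1 by apply: ev_write_bit.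
case: v A6 A16 => [|v] A6 A16.
  exists 1, 1, A1; split=> //; apply: ev_eq (ev_if0 _ _) _; first by rewrite A16.
  by rewrite /A1; store.
have [|t2 t2T H2] := @ev_clear 6 (upd A1 ot
    (ATape (fun j => if j == p then Some (inl true)
                     else if j == p then Some (inl false) else c j) p)) v.+1.
  by rewrite /A1; store_cases.
exists 1, (1 + t2).+1, A1; split=> //; first by move: t2T; rewrite !doubleS; lia.
apply: ev_eq (ev_if1 _ (ev_seq (ev_write_bit _ _) H2)) _.
- by rewrite A16.
- by rewrite /A1 updE eqxx.
apply/funext => j; rewrite /A1 !updE.
have [->|j6] := eqVneq j 6; first by rewrite ifF //; lia.
have [_|//] := eqVneq j ot; apply: atape_eq => // a /=.
by case: eqP.
Qed.

Lemma ev_output b : output_bound <= b -> exists T : nat -> nat, poly_bounded T /\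
  forall x, exists2 t, t <= T (size x) &
  exists B : store, ev (output_prog b) (start_store b x [::]) t B /\
    exists2 c, B ot = ATape c 0 & forall i,
      i <= out_len x -> c i = if i < out_len x then Some (inl (out_bit x i)) else None.
Proof.
move=> bb; have [Tl [pl Hl]] := compile_correct el; have [Tb [pb Hb]] := compile_correct eb.
pose T m := b + 4 + m * 12 + Tl m
   + (Tl m * (Tb (m + Tl m) + (Tb (m + Tl m) * 2 + 9)) + 1) + (Tl m * 3 + 2).
have pT2 : poly_bounded (fun m => Tb (m + Tl m)).
  by apply: (poly_bounded_comp pb (g := fun m => m + Tl m)); poly_closed.
exists T; split; first by rewrite /T; poly_closed.
move=> x; have bgt : 4 < b by rewrite /output_bound in bb; lia.
have [t0 t0T H0] := ev_prologue x [::] bgt.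
pose m := size x.
have xm s : size (nth [::] [:: x; [::]] s) <= m.
  by case: s => [|[|s]] //=; rewrite nth_nil.
have [|||lT [t1 t1T H1]] := Hl [:: x; [::]] [::] m [::] 4 6 0 (ready x [::]) xm.
- by move=> k; rewrite nth_nil.
- exact: ready_holds.
- by [].
rewrite add0n -/(out_len x) in H1 lT; pose N := out_len x; rewrite -/N in H1 lT.
pose A0 := ready x [::]; pose c0 := acell (A0 ot).
have A0o : A0 ot = ATape c0 0 by rewrite /c0; move: ot2; case: (ot) => [|[|]].
pose F k := upd (upd (upd A0 4 (counter k)) 5 (counter (N - k)))
  ot (ATape (out_cells x (N - k) c0) (N - k)).
have [|||k kN|t2 t2T H2] := @ev_loop_eq 4 emit F N
    (Tb (m + Tl m) + (Tb (m + Tl m) * 2 + 7))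
    (upd (ready x [::]) 4 (counter N)) (F 0).
- rewrite /F subnn; apply/funext => j; rewrite !updE.
  have [->|jo] := eqVneq j ot; first by rewrite ifF -?/A0 ?A0o //; lia.
  by have [->|j4] := eqVneq j 5; last by [].
- by [].
- by move=> k kN; rewrite /F; store_cases.
- pose i := N - k.+1; pose B0 := upd (F k.+1) 4 (counter k).
  have iE : N - k = i.+1 by rewrite /i; lia.
  have [||||vT [t2 t2T H2]] := Hb [:: x; [::]] [:: i] (m + Tl m) [:: 5] 6 7 0 B0.
  + by move=> s; apply: leq_trans (xm s) _; lia.
  + by case=> [|j] /=; rewrite ?nth_nil /i; lia.
  + split=> //.
    * by move=> s; have := string_tape_lt s; have : 1 < string_tape s by [];
        move=> s2 s4; rewrite /B0 /F !updE !ifF; [case: (s)|lia..].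
    * by case=> [|j] //= _; split=> //; rewrite /B0 /F; store_cases.
    * move=> j j7; rewrite /B0 /F !updE !ifF; try lia.
      by case: j j7 => [|[|[|[|j]]]].
  + by rewrite /B0 /F; store_cases.
  set v := eval _ _ eb in vT H2; rewrite add0n in H2.
  have [||n1 [n2 [C [nT H3 H4]]]] := @ev_write_test (upd B0 6 (counter v))
     (out_cells x i c0) i v.
  + by rewrite /B0 /F; store_cases.
  + by rewrite updE.
  exists (t2 + (n1 + (n2 + 2))); first by lia.
  set D := upd _ ot _ in H4.
  have Do : exists2 c, D ot = ATape c i & c =1 out_cells x i.+1 c0.
    eexists; first by rewrite /D updE eqxx.
    move=> j; rewrite /out_cells ltnS (leq_eqVlt j) /=.
    by have [->|] := eqVneq j i.
  have [c Dc cE] := Do.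
  refine (ev_seq H2 (ev_seq H3 (ev_seq_eq H4 (@ev_seq _ _ _ 1
     (upd D ot (ATape c i.+1)) 1 _ _ (@ev_inc _ _ i _)) erefl _))).
  + have : ev (inc ot) D 1 (upd D ot (awrite (D ot) (ascan (D ot)) MoveRight)).
      exact: ev_op.
    rewrite Dc => H; apply: ev_eq H _; congr (upd D ot _).
    by apply: atape_eq => // j /=; rewrite /ascan /=; case: eqP => // ->.
  + rewrite /D /B0 /F; store_cases.
  + apply/funext => j; rewrite /F iE !updE.
    have [->|jo] := eqVneq j ot.
      by rewrite ifF; [apply: atape_eq|lia].
    rewrite /D /B0 /F !updE (negPf jo).
    have [_|j5] := eqVneq j 5; first by [].
    have [->|j6] := eqVneq j 6; first by [].
    by case: (eqVneq j 4).
have H3 := @ev_op ot (Some None) Stay (F 0).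
rewrite /do_instr /odflt /oapp /= in H3.
set D := upd (F 0) ot _ in H3.
pose c j : sym := if j == N then None else out_cells x N c0 j.
have Do : D ot = ATape c N by rewrite /D updE eqxx /F updE eqxx subn0.
have [|||k kN|t4 t4T H4] := @ev_loop_eq 5 (dec ot) (fun k =>
  upd (upd D 5 (counter k)) ot (ATape c k)) N 1 D (upd (upd D 5 (counter 0)) ot (ATape c 0)).
- apply/funext => j; rewrite !updE; have [->|jo] := eqVneq j ot; first by rewrite Do.
  have [->|//] := eqVneq j 5; rewrite /D /F !updE ifF; last by lia.
  by rewrite ifF ?subn0 //; lia.
- by [].
- by move=> k kN; store_cases.
- exists 1 => //; set E := upd _ 5 _.
  have Eo : E ot = ATape c k.+1 by rewrite /E; store_cases.
  have : ev (dec ot) E 1 (upd E ot (awrite (E ot) (ascan (E ot)) MoveLeft)).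
    exact: ev_op.
  rewrite Eo => H; apply: ev_eq H _; apply/funext => j; rewrite /E !updE.
  have [_|jo] := eqVneq j ot; last by case: (eqVneq j 5).
  by apply: atape_eq => // a /=; rewrite /ascan /=; case: eqP => // ->.
exists (t0 + (t1 + (t2 + (1 + t4)))).
  have : N * (Tb (m + Tl m) + (Tb (m + Tl m) * 2 + 7)).+2
      <= Tl m * (Tb (m + Tl m) + (Tb (m + Tl m) * 2 + 9)).
    by rewrite -!addnS leq_mul2r lT orbT.
  by move: t0T t1T t2T t4T; rewrite /T /= -/m; lia.
exists (upd (upd D 5 (counter 0)) ot (ATape c 0)); split.
  exact: ev_seq H0 (ev_seq H1 (ev_seq H2 (ev_seq H3 H4))).
exists c; first by rewrite updE eqxx.
by move=> i iN; rewrite /c -/N /out_cells; case: ltngtP iN.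
Qed.

End Output.

(** Halting configurations being fixed, a machine that stops early can be observed at the exact time
    prescribed by a polynomial. *)
Lemma iter_fixed (T : Type) (f : T -> T) x n m : n <= m ->
  f (iter n f x) = iter n f x -> iter m f x = iter n f x.
Proof.
move=> nm E; rewrite -(subnK nm) iterD; elim: (m - n) => //= k ->; exact: E.
Qed.

Section Initial.
Variables (nt : nat) (S : finType) (st : S) (hl ac : pred S).
Variable dl : S -> {ffun 'I_nt.+2 -> sym} -> S * {ffun 'I_nt.+2 -> sym * dir}.
Let M : TM := @MkTM nt unit S st hl ac dl.

Lemma represents_tape_of x : @represents nt S st hl ac dl (string x 0) (tape_of M x).
Proof.
split=> //=.
- by move=> i; rewrite nth_behead add0n.
- by case.
Qed.

Lemma represents_init x w xs : nth [::] xs 0 = x -> nth [::] xs 1 = w -> size xs <= 2 ->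
  @represents_all nt S st hl ac dl (start_store nt.+2 x w) (ctapes (init M xs)).
Proof.
move=> x0 w1 s2 i; rewrite /= ffunE; case: i => [[|[|i]] hi] /=.
- by rewrite x0; apply: represents_tape_of.
- by rewrite w1; apply: represents_tape_of.
- rewrite hi nth_default; first exact: represents_tape_of.
  by apply: leq_trans s2 _.
Qed.

Lemma represents_bits c (t : tape M) n f : represents (ATape c 0) t ->
  (forall i, i <= n -> c i = if i < n then Some (inl (f i)) else None) ->
  tape_bits t = mkseq f n.
Proof.
case=> [ts tr _] cE; rewrite /tape_bits; apply: mkseq_bits => [i lin|].
  case: i lin => [|i] lin; first by rewrite /= ts /ascan /= cE // lin.
  by rewrite /= tr /= add0n cE ?lin // ltnW.
have := cE n (leqnn n); rewrite ltnn.
by case: (n) => [|k] /= E; [rewrite ts | rewrite tr].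
Qed.

End Initial.

(** * The transducer, the oracle machine and the verifier *)

Definition run_delta nt (p : prog) (T : finType) (e : option (pst p) -> T) (s : pst p)
    (r : {ffun 'I_nt.+2 -> sym}) : T * {ffun 'I_nt.+2 -> sym * dir} :=
  let: (o, a) := pnext s (fun i => r (inord i)) in (e o, act_of a r).

Definition idle nt (r : {ffun 'I_nt.+2 -> sym}) : {ffun 'I_nt.+2 -> sym * dir} :=
  [ffun i => (r i, Stay)].

Definition fun_TM nt (p : prog) : TM :=
  @MkTM nt unit (option (pst p)) (Some (pstart p)) (fun s => s == None) pred0
    (fun s r => if s is Some s then run_delta id s r else (None, idle r)).

Lemma fun_step nt p s (c : {ffun 'I_nt.+2 -> tape (fun_TM nt p)}) :
  @step (fun_TM nt p) (@Config (fun_TM nt p) (Some s) c) =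
  let r := [ffun i : 'I_nt.+2 => scanned (c i)] in
  let: (o, a) := pnext s (fun i => r (inord i)) in
  @Config (fun_TM nt p) o [ffun i : 'I_nt.+2 => write_move (c i) (act_of a r i)].
Proof. by rewrite /step /= /run_delta; case: (pnext _ _). Qed.

(** After the query, states [inr 0] to [inr 2] compare the answer with two bits [true] and the end
    of the string, that is, with 2 in unary; state 3 accepts and state 4 rejects. *)
Definition oracle_base nt (p : prog) : TM :=
  @MkTM nt unit (option (pst p) + 'I_5)%type (inl (Some (pstart p)))
    (fun s => if s is inr i then 3 <= i else false)
    (fun s => if s is inr i then i == 3 :> nat else false)
    (fun s r => match s with
       | inl (Some s) => run_delta inl s r
       | inl None => (inl None, idle r)
       | inr i =>
         let a := r (inord 1) in
         let ok := if i < 2 then is_true_bit a else ~~ is_bit a in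
         (inr (inord (if ok then i.+1 else 4)),
          [ffun j => (r j, if j == 1 :> nat then MoveRight else Stay)])
       end).

Definition oracle_fun_TM nt p : oracleTM :=
  @MkOracleTM (oracle_base nt p)
    (fun s => if s is inl None then Some (inr ord0) else None).

Lemma oracle_step O nt p s (c : {ffun 'I_nt.+2 -> tape (oracle_fun_TM nt p)}) :
  @ostep O (oracle_fun_TM nt p) (@Config (oracle_fun_TM nt p) (inl (Some s)) c) =
  let r := [ffun i : 'I_nt.+2 => scanned (c i)] in
  let: (o, a) := pnext s (fun i => r (inord i)) in
  @Config (oracle_fun_TM nt p) (inl o)
    [ffun i : 'I_nt.+2 => write_move (c i) (act_of a r i)].
Proof. by rewrite /ostep /= /step /= /run_delta; case: (pnext _ _). Qed.

Definition rel_TM nt (p : prog) : TM :=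
  @MkTM nt unit (option (pst p) + bool)%type (inl (Some (pstart p)))
    (fun s => if s is inr _ then true else false)
    (fun s => if s is inr b then b else false)
    (fun s r => match s with
       | inl (Some s) => run_delta inl s r
       | inl None => (inr (nonzero (r (inord 4))), idle r)
       | inr b => (inr b, idle r)
       end).

Lemma rel_step nt p s (c : {ffun 'I_nt.+2 -> tape (rel_TM nt p)}) :
  @step (rel_TM nt p) (@Config (rel_TM nt p) (inl (Some s)) c) =
  let r := [ffun i : 'I_nt.+2 => scanned (c i)] in
  let: (o, a) := pnext s (fun i => r (inord i)) in
  @Config (rel_TM nt p) (inl o) [ffun i : 'I_nt.+2 => write_move (c i) (act_of a r i)].
Proof. by rewrite /step /= /run_delta; case: (pnext _ _). Qed.

Section Functions.
Variables (eb el : expr).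

Definition out_fun x := mkseq (out_bit eb x) (out_len el x).

Let nt := 5 + width eb + width el.

Theorem polytime_out_fun : polytime_fun out_fun.
Proof.
pose p := output_prog eb el 0 nt.+2.
have [T [pT HT]] := @ev_output eb el 0 isT nt.+2 (leqnn _).
have [q qT] := poly_boundedP pT.
exists (fun_TM nt p), q => x; have [t tT [B [H [c Bc cE]]]] := HT x.
have [|||c' Bc' E] := @simulation _ _ _ _ _ _ (@step (fun_TM nt p)) p id _ _ (pstart p) _ _ _
  (ctapes (init (fun_TM nt p) [:: x])) (ev_steps H).
- exact: output_prog_bounded.
- exact: fun_step.
- exact: represents_init.
have R : run (fun_TM nt p) [:: x] q.[size x]%R = @Config (fun_TM nt p) None c'.
  rewrite /run -E (@iter_fixed _ _ _ t); first by [].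
    by apply: leq_trans tT (qT _).
  by rewrite [iter t _ _]E.
rewrite /= R; split=> //; rewrite /output /=.
have := Bc' ord0; rewrite [B (ord0 : 'I_nt.+2)]Bc => R0.
exact: represents_bits R0 cE.
Qed.

Theorem oracle_out_fun : exists (M : oracleTM) (p : {poly nat}), forall O x,
  let c := orun O M [:: x] p.[size x]%R in
  halted c /\ (accepted c <-> O (out_fun x) = [:: true; true]).
Proof.
pose p := output_prog eb el 1 nt.+2.
have [T [pT HT]] := @ev_output eb el 1 isT nt.+2 (leqnn _).
(* Four more steps: the query and at most three cells of the answer. *)
have pT4 : poly_bounded (fun m => T m + 4) by poly_closed.
have [q qT] := poly_boundedP pT4.
exists (oracle_fun_TM nt p), q => O x; have [t tT [B [H [c Bc cE]]]] := HT x.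
have [|||c' Bc' E] := @simulation _ _ _ _ _ _ (@ostep O (oracle_fun_TM nt p)) p inl
  _ _ (pstart p) _ _ _
  (ctapes (init (oracle_fun_TM nt p) [:: x])) (ev_steps H).
- exact: output_prog_bounded.
- exact: oracle_step.
- exact: represents_init.
pose o1 : 'I_nt.+2 := inord 1.
have o1E : o1 = 1 :> nat by rewrite inordK.
have tb : tape_bits (c' o1) = out_fun x.
  have := Bc' o1; rewrite o1E Bc => R1; exact: represents_bits R1 cE.
set a := O (out_fun x).
have E1 : exists d, ostep O (@Config (oracle_fun_TM nt p) (inl None) c')
    = @Config (oracle_fun_TM nt p) (inr ord0) d /\ represents (string a 0) (d o1).
  eexists; split; first by rewrite /ostep /=.
  rewrite /= ffunE o1E eqxx tb; exact: represents_tape_of.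
have check (i : 'I_5) (d : {ffun 'I_nt.+2 -> tape (oracle_fun_TM nt p)}) k :
   i < 3 -> represents (string a k) (d o1) -> exists d',
   ostep O (@Config (oracle_fun_TM nt p) (inr i) d) =
     @Config (oracle_fun_TM nt p) (inr (inord (if (if i < 2 then nth false a k else ~~ (k < size a))
        then i.+1 else 4))) d' /\ represents (string a k.+1) (d' o1).
  move=> i3 Rd; eexists; split.
    rewrite /ostep /= leqNgt i3 /= /step /= leqNgt i3 /= ffunE.
    have [-> _ _] := Rd; rewrite is_true_bit_string is_bit_string.
    reflexivity.
  have Rw := represents_write (ascan (string a k)) MoveRight Rd.
  rewrite string_right in Rw; have [sE _ _] := Rd; rewrite -sE in Rw.
  by rewrite !ffunE o1E eqxx.
have halt (i : 'I_5) d : 2 < i -> ostep O (@Config (oracle_fun_TM nt p) (inr i) d) =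
    @Config (oracle_fun_TM nt p) (inr i) d.
  by move=> i3; rewrite /ostep /= i3.
have [d0 [E0 R0]] := E1.
have [d1 [F1 R1]] := check ord0 d0 0 isT R0.
have main : exists d, exists2 i : 'I_5, 2 < i &
    iter 4 (@ostep O (oracle_fun_TM nt p)) (@Config (oracle_fun_TM nt p) (inl None) c') =
    @Config (oracle_fun_TM nt p) (inr i) d /\ ((i == 3 :> nat) = (a == [:: true; true])).
  rewrite [iter _ _ _]/= E0 F1; move: R1.
  have [a0|a0] := boolP (nth false a 0); last first.
    move=> _; exists d1, (inord 4); first by rewrite inordK.
    rewrite /= !halt ?inordK //; split=> //.
    by case: (a) a0 => [|[] [|[] [|]]].
  move=> R1; have [|d2 [F2 R2]] := check (inord 1) d1 1 _ R1; first by rewrite inordK.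
  rewrite /= F2 inordK //=; have [a1|a1] := boolP (nth false a 1); last first.
    exists d2, (inord 4); first by rewrite inordK.
    rewrite halt ?inordK //; split=> //.
    by case: (a) a0 a1 => [|[] [|[] [|]]].
  have [|d3 [F3 R3]] := check (inord 2) d2 2 _ R2; first by rewrite inordK.
  rewrite F3 inordK //=.
  have [a2|a2] := ltnP 2 (size a).
    exists d3, (inord 4); first by rewrite inordK.
    split=> //; rewrite inordK //.
    by case: (a) a0 a1 a2 => [|[] [|[] [|]]].
  exists d3, (inord 3); first by rewrite inordK.
  split=> //; rewrite inordK //.
  by case: (a) a0 a1 a2 => [|[] [|[] [|]]].
have [d [i i3 [F iE]]] := main.
have R : orun O (oracle_fun_TM nt p) [:: x] q.[size x]%R = @Config (oracle_fun_TM nt p) (inr i) d.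
  have E4 : iter (4 + t) (@ostep O (oracle_fun_TM nt p)) (init (oracle_fun_TM nt p) [:: x])
      = @Config (oracle_fun_TM nt p) (inr i) d by rewrite iterD [iter t _ _]E.
  rewrite /orun -E4 (@iter_fixed _ _ _ (4 + t)) //.
    by apply: leq_trans (qT _); lia.
  by rewrite E4 /ostep /= i3.
rewrite /= R /halted /accepted /= i3; split=> //.
by rewrite iE; split=> [/eqP|->].
Qed.

End Functions.

Section Relations.
Variable e : expr.

Definition rel_prog nt := Seq (prologue nt.+2) (compile [::] e 4 5).

Lemma rel_prog_bounded nt : 3 + width e <= nt -> pbounded nt.+2 (rel_prog nt).
Proof.
rewrite /rel_prog -(leq_add2r 2) !addn2; move: nt.+2 => b bb.
have we := width_gt1 e; rewrite /= mark_all_bounded; last by lia.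
by rewrite comp_bounded //=; lia.
Qed.
Let nt := 4 + width e.

Theorem polytime_rel_expr : polytime_rel (fun x w => 0 < eval [:: x; w] [::] e).
Proof.
pose p := rel_prog nt.
have [T [pT HT]] := compile_correct e.
have pT4 : poly_bounded (fun m => nt + 8 + m * 12 + T m) by poly_closed.
have [q qT] := poly_boundedP pT4.
exists (rel_TM nt p), q => x w.
pose m := size x + size w.
have [|t1 t1T H1] := @ev_prologue nt.+2 x w; first by rewrite /nt.
have [||||vT [t2 t2T H2]] := HT [:: x; w] [::] m [::] 4 5 0 (ready x w).
- by case=> [|[|s]]; rewrite /m /= ?nth_nil ?leq_addr ?leq_addl.
- by move=> k; rewrite nth_nil.
- exact: ready_holds.
- by [].
set v := eval _ _ e in vT H2; rewrite add0n in H2.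
have H := ev_seq H1 H2.
have [|||c' Bc' E] := @simulation _ _ _ _ _ _ (@step (rel_TM nt p)) p inl _ _ (pstart p) _ _ _
  (ctapes (init (rel_TM nt p) [:: x; w])) (ev_steps H).
- by apply: rel_prog_bounded.
- exact: rel_step.
- exact: represents_init.
have R : run (rel_TM nt p) [:: x; w] q.[size x + size w]%R = @Config (rel_TM nt p) (inr (0 < v)) c'.
  have E1 : iter (1 + (t1 + t2)) (@step (rel_TM nt p)) (init (rel_TM nt p) [:: x; w])
      = @Config (rel_TM nt p) (inr (0 < v)) c'.
    rewrite iterD [iter (t1 + t2) _ _]E /= /step /= ffunE.
    have [-> _ _] := Bc' (inord 4); rewrite inordK; last by rewrite /nt.
    rewrite updE /= nonzero_counter; congr (@Config (rel_TM nt p) _ _).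
    by apply/ffunP => i; rewrite !ffunE /=; case: (c' i).
  rewrite /run -E1 (@iter_fixed _ _ _ (1 + (t1 + t2))) //.
    apply: leq_trans (qT m); rewrite -/m in t1T; move: (T m) t2T t1T => k.
    by move: (m * 12) => k'; move: (nt); lia.
  by rewrite E1.
by rewrite /= R.
Qed.

End Relations.

(** * Functions computed by expressions *)

Definition numfun := seq (seq bool) -> seq nat -> nat.

(** With closure under the usual operations, computability in polynomial time can be read off a
    formula, away from machines. *)
Definition cmp f : Prop := exists e, forall xs env, eval xs env e = f xs env.
Definition cmpb (b : seq (seq bool) -> seq nat -> bool) : Prop :=
  cmp (fun xs env => b xs env).

Lemma cmp_ext (f g : numfun) : (forall xs env, f xs env = g xs env) -> cmp f -> cmp g.
Proof. by move=> fg [e eE]; exists e => xs env; rewrite eE. Qed.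

Lemma cmp_var : cmp (fun xs env => head 0 env).
Proof. by exists EVar. Qed.

Lemma cmp_wk f : cmp f -> cmp (fun xs env => f xs (behead env)).
Proof. by case=> e eE; exists (EWk e) => xs env /=; rewrite eE. Qed.

Lemma cmp_add f g : cmp f -> cmp g -> cmp (fun xs env => f xs env + g xs env).
Proof. by move=> [e eE] [e' eE']; exists (EAdd e e') => xs env /=; rewrite eE eE'. Qed.

Lemma cmp_sub f g : cmp f -> cmp g -> cmp (fun xs env => f xs env - g xs env).
Proof. by move=> [e eE] [e' eE']; exists (ESub e e') => xs env /=; rewrite eE eE'. Qed.

Lemma cmp_const c : cmp (fun _ _ => c).
Proof.
elim: c => [|c IH]; first by exists (ESub EOne EOne).
by apply: cmp_ext (cmp_add (ex_intro _ EOne _) IH) => //= xs env; rewrite add1n.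
Qed.

Lemma cmp_len (s : bool) : cmp (fun xs env => size (nth [::] xs s)).
Proof. by exists (ELen s). Qed.

Lemma cmp_bit (s : bool) f : cmp f ->
  cmpb (fun xs env => nth false (nth [::] xs s) (f xs env)).
Proof. by move=> [e eE]; exists (EBit s e) => xs env /=; rewrite eE. Qed.

Lemma cmp_sum (n : numfun) (F : nat -> numfun) : cmp n ->
  cmp (fun xs env => F (head 0 env) xs (behead env)) ->
  cmp (fun xs env => \sum_(i < n xs env) F i xs env).
Proof.
move=> [e eE] [e' eE']; exists (ESum e e') => xs env /=; rewrite eE.
by apply: eq_bigr => i _; rewrite eE'.
Qed.

Lemma cmp_mul f g : cmp f -> cmp g -> cmp (fun xs env => f xs env * g xs env).
Proof.
move=> cf cg; apply: cmp_ext (@cmp_sum f (fun _ => g) cf (cmp_wk cg)) => xs env.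
by rewrite sum_nat_const card_ord.
Qed.

Lemma cmp_succ f : cmp f -> cmp (fun xs env => (f xs env).+1).
Proof.
by move=> cf; apply: cmp_ext (cmp_add cf (cmp_const 1)) => xs env; rewrite addn1.
Qed.

Lemma cmp_double f : cmp f -> cmp (fun xs env => (f xs env).*2).
Proof. by move=> cf; apply: cmp_ext (cmp_add cf cf) => xs env; rewrite addnn. Qed.

Lemma cmpb_leq f g : cmp f -> cmp g -> cmpb (fun xs env => f xs env <= g xs env).
Proof.
move=> cf cg; apply: cmp_ext (cmp_sub (cmp_const 1) (cmp_sub cf cg)) => xs env.
by rewrite -subn_eq0; case: (f xs env - g xs env) => [|[|k]].
Qed.

Lemma cmpb_neg b : cmpb b -> cmpb (fun xs env => ~~ b xs env).
Proof.
by move=> cb; apply: cmp_ext (cmp_sub (cmp_const 1) cb) => xs env; case: (b xs env).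
Qed.

Lemma cmpb_and b c : cmpb b -> cmpb c -> cmpb (fun xs env => b xs env && c xs env).
Proof.
move=> cb cc; apply: cmp_ext (cmp_mul cb cc) => xs env.
by case: (b xs env); case: (c xs env).
Qed.

Lemma cmpb_or b c : cmpb b -> cmpb c -> cmpb (fun xs env => b xs env || c xs env).
Proof.
move=> cb cc; apply: cmp_ext (cmpb_neg (cmpb_and (cmpb_neg cb) (cmpb_neg cc))) => xs env.
by case: (b xs env); case: (c xs env).
Qed.

Lemma cmpb_eq f g : cmp f -> cmp g -> cmpb (fun xs env => f xs env == g xs env).
Proof.
move=> cf cg; apply: cmp_ext (cmpb_and (cmpb_leq cf cg) (cmpb_leq cg cf)) => xs env.
by rewrite eqn_leq.
Qed.

Lemma cmp_if b f g : cmpb b -> cmp f -> cmp g ->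
  cmp (fun xs env => if b xs env then f xs env else g xs env).
Proof.
move=> cb cf cg.
apply: cmp_ext (cmp_add (cmp_mul cb cf) (cmp_mul (cmpb_neg cb) cg)) => xs env.
by case: (b xs env); rewrite ?mul1n ?mul0n ?addn0.
Qed.

Lemma cmpb_if b c d : cmpb b -> cmpb c -> cmpb d ->
  cmpb (fun xs env => if b xs env then c xs env else d xs env).
Proof.
by move=> cb cf cg; apply: cmp_ext (cmp_if cb cf cg) => xs env; case: (b xs env).
Qed.

Lemma cmpb_eqb b c : cmpb b -> cmpb c -> cmpb (fun xs env => b xs env == c xs env).
Proof.
move=> cb cc; apply: cmp_ext (cmpb_eq cb cc) => xs env.
by case: (b xs env); case: (c xs env).
Qed.

Lemma cmpb_has (n : numfun) (B : nat -> seq (seq bool) -> seq nat -> bool) : cmp n ->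
  cmpb (fun xs env => B (head 0 env) xs (behead env)) ->
  cmpb (fun xs env => has (fun i => B i xs env) (iota 0 (n xs env))).
Proof.
move=> cn cB; have cS := @cmp_sum n (fun i xs env => B i xs env) cn cB.
apply: cmp_ext (cmpb_leq (cmp_const 1) cS) => xs env; congr nat_of_bool.
rewrite -(big_mkord xpredT (fun i => B i xs env : nat)) lt0n sum_nat_seq_neq0.
by rewrite /index_iota subn0; apply: eq_has => i /=; rewrite eqb0 negbK.
Qed.

Lemma cmpb_all (n : numfun) (B : nat -> seq (seq bool) -> seq nat -> bool) : cmp n ->
  cmpb (fun xs env => B (head 0 env) xs (behead env)) ->
  cmpb (fun xs env => all (fun i => B i xs env) (iota 0 (n xs env))).
Proof.
move=> cn cB; have := cmpb_neg (@cmpb_has n (fun i xs env => ~~ B i xs env) cn (cmpb_neg cB)).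
apply: cmp_ext => xs env; congr nat_of_bool; rewrite -all_predC.
by apply: eq_all => i /=; rewrite negbK.
Qed.

(** A number as the count of smaller indices: quotients and unary codes are obtained in this way
    from bounded sums. *)
Lemma sum_ltn m k : k <= m -> \sum_(i < m) (i < k) = k.
Proof.
move=> km; rewrite -(big_mkord xpredT (fun i => (i < k) : nat)).
rewrite (big_cat_nat (n := k)) //= big_nat (eq_bigr (fun=> 1)) => [|i /andP[_ ->]] //.
rewrite -big_nat sum_nat_const_nat subn0 muln1 big_nat big1 ?addn0 // => i /andP[le _].
by rewrite ltnNge le.
Qed.

(** Counts the multiples of the divisor up to [f]; a zero divisor, for which every index would
    count, is treated apart. *)
Lemma cmp_div f g : cmp f -> cmp g -> cmp (fun xs env => f xs env %/ g xs env).
Proof.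
move=> cf cg.
have c1 : cmpb (fun xs env => (head 0 env).+1 * g xs (behead env) <= f xs (behead env)).
  by apply: cmpb_leq (cmp_wk cf); apply: cmp_mul (cmp_succ cmp_var) (cmp_wk cg).
have c2 := cmpb_leq (cmp_const 1) cg.
apply: cmp_ext (cmp_if c2 (@cmp_sum f
  (fun i xs env => i.+1 * g xs env <= f xs env) cf c1) (cmp_const 0)) => xs env.
move: (f xs env) (g xs env) => m d; case: posnP => [->|d0]; first by rewrite divn0.
rewrite (eq_bigr (fun i : 'I_m => nat_of_bool (i < m %/ d))); last first.
  by move=> i _; rewrite leq_divRL.
exact/sum_ltn/leq_div.
Qed.

Lemma cmp_mod f g : cmp f -> cmp g -> cmp (fun xs env => f xs env %% g xs env).
Proof.
move=> cf cg; apply: cmp_ext (cmp_sub cf (cmp_mul (cmp_div cf cg) cg)) => xs env.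
by rewrite {1}(divn_eq (f xs env) (g xs env)) addKn.
Qed.

Lemma cmp_half f : cmp f -> cmp (fun xs env => (f xs env)./2).
Proof. by move=> cf; apply: cmp_ext (cmp_div cf (cmp_const 2)) => xs env; rewrite divn2. Qed.

Lemma cmpb_odd f : cmp f -> cmpb (fun xs env => odd (f xs env)).
Proof. by move=> cf; apply: cmp_ext (cmp_mod cf (cmp_const 2)) => xs env; rewrite modn2. Qed.

Lemma cmp_nth d (s : seq nat) f : cmp f -> cmp (fun xs env => nth d s (f xs env)).
Proof.
move=> cf; elim: s f cf => [|a s IH] f cf.
  by apply: cmp_ext (cmp_const d) => xs env; rewrite nth_nil.
apply: cmp_ext (cmp_if (cmpb_eq cf (cmp_const 0)) (cmp_const a)
  (IH _ (cmp_sub cf (cmp_const 1)))) => xs env.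
by case: (f xs env) => //= k; rewrite subn1.
Qed.

Lemma cmp_table (F : nat -> nat -> nat) m n f g : cmp f -> cmp g ->
  cmp (fun xs env => if (f xs env < m) && (g xs env < n) then F (f xs env) (g xs env) else 0).
Proof.
move=> cf cg.
apply: cmp_ext (cmp_if (cmpb_and (cmpb_leq (cmp_succ cf) (cmp_const m))
    (cmpb_leq (cmp_succ cg) (cmp_const n)))
  (cmp_nth 0 (mkseq (fun k => F (k %/ n) (k %% n)) (m * n))
    (cmp_add (cmp_mul cf (cmp_const n)) cg)) (cmp_const 0)) => xs env.
case: ifP => // /andP[fm gn]; rewrite nth_mkseq.
  by rewrite divnMDl ?modnMDl ?divn_small ?modn_small ?addn0 //; lia.
have : (f xs env).+1 * n <= m * n by rewrite leq_mul2r fm orbT.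
by rewrite mulSn; lia.
Qed.

Lemma cmp_poly (p : {poly nat}) f : cmp f -> cmp (fun xs env => p.[f xs env]%R).
Proof.
move=> cf; rewrite /poly.horner; elim: (polyseq p) => [|c s IH] /=; first exact: cmp_const.
exact: cmp_add (cmp_mul IH cf) (cmp_const c).
Qed.

Lemma poly_mono (p : {poly nat}) m n : m <= n -> p.[m]%R <= p.[n]%R.
Proof.
move=> mn; rewrite /poly.horner; elim: (polyseq p) => //= c s IH.
by rewrite leq_add2r leq_mul.
Qed.

Ltac cmp_step :=
  cbv beta;
  lazymatch goal with
  | |- cmpb _ => fail
  | |- cmp (fun xs env => nat_of_bool (@?b xs env)) => change (cmpb b)
  | |- cmp (fun xs env => addn (@?f xs env) (@?g xs env)) => apply (@cmp_add f g)
  | |- cmp (fun xs env => subn (@?f xs env) (@?g xs env)) => apply (@cmp_sub f g)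
  | |- cmp (fun xs env => muln (@?f xs env) (@?g xs env)) => apply (@cmp_mul f g)
  | |- cmp (fun xs env => divn (@?f xs env) (@?g xs env)) => apply (@cmp_div f g)
  | |- cmp (fun xs env => modn (@?f xs env) (@?g xs env)) => apply (@cmp_mod f g)
  | |- cmp (fun xs env => double (@?f xs env)) => apply (@cmp_double f)
  | |- cmp (fun xs env => half (@?f xs env)) => apply (@cmp_half f)
  | |- cmp (fun xs env => S (@?f xs env)) => apply (@cmp_succ f)
  | |- cmp _ => refine (@cmp_if _ _ _ _ _ _)
  end.

Ltac cmpb_step :=
  cbv beta;
  lazymatch goal with
  | |- cmpb (fun xs env => leq (@?f xs env) (@?g xs env)) => apply (@cmpb_leq f g)
  | |- cmpb (fun xs env => negb (@?f xs env)) => apply (@cmpb_neg f)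
  | |- cmpb (fun xs env => andb (@?f xs env) (@?g xs env)) => apply (@cmpb_and f g)
  | |- cmpb (fun xs env => orb (@?f xs env) (@?g xs env)) => apply (@cmpb_or f g)
  | |- cmpb (fun xs env => odd (@?f xs env)) => apply (@cmpb_odd f)
  | |- cmpb (fun xs env => @eq_op nat (@?f xs env) (@?g xs env)) => apply (@cmpb_eq f g)
  | |- cmpb (fun xs env => @eq_op bool (@?f xs env) (@?g xs env)) => apply (@cmpb_eqb f g)
  | |- cmpb (fun xs env => @eq_op _ (@?f xs env) (@?g xs env)) =>
      first [apply (@cmpb_eq f g) | apply (@cmpb_eqb f g)]
  | |- cmpb (fun xs env => has (@?B xs env) (iota 0 (@?n xs env))) =>
      apply (@cmpb_has n (fun i xs env => B xs env i))
  | |- cmpb (fun xs env => all (@?B xs env) (iota 0 (@?n xs env))) =>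
      apply (@cmpb_all n (fun i xs env => B xs env i))
  | |- cmpb (fun xs env => nth false (nth [::] xs 0) (@?f xs env)) =>
      apply (@cmp_bit false f)
  | |- cmpb (fun xs env => nth false (nth [::] xs 1) (@?f xs env)) =>
      apply (@cmp_bit true f)
  | |- cmpb _ => refine (@cmpb_if _ _ _ _ _ _)
  end.

Ltac cmp_leaf :=
  match goal with
  | |- cmp (fun _ env => head 0 env) => exact cmp_var
  | |- cmp (fun _ _ => ?c) => exact (cmp_const c)
  | |- cmp (fun xs _ => size (nth [::] xs 0)) => exact (cmp_len false)
  | |- cmp (fun xs _ => size (nth [::] xs 1)) => exact (cmp_len true)
  | |- _ => assumption
  | H : cmp _ |- cmp _ => exact H
  | H : cmp _ |- cmp _ => exact (cmp_wk H)
  | H : cmp _ |- cmp _ => exact (cmp_wk (cmp_wk H))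
  | H : cmp _ |- cmp _ => exact (cmp_wk (cmp_wk (cmp_wk H)))
  | |- cmp _ => exact (cmp_wk cmp_var)
  | |- cmp _ => exact (cmp_wk (cmp_wk cmp_var))
  | |- cmp _ => exact (cmp_wk (cmp_wk (cmp_wk cmp_var)))
  | |- cmp _ => exact (cmp_wk (cmp_wk (cmp_wk (cmp_wk cmp_var))))
  end.

Ltac cmp_tac := repeat first [cmp_leaf | cmp_step | cmpb_step].

(** * The tableau of a machine as clauses *)

Lemma radix_div a b n : b < n -> (a * n + b) %/ n = a.
Proof. by move=> bn; rewrite divnMDl ?divn_small ?addn0 //; lia. Qed.

Lemma radix_mod a b n : b < n -> (a * n + b) %% n = b.
Proof. by move=> bn; rewrite modnMDl modn_small. Qed.

Lemma radix_lt a b n k : a < k -> b < n -> a * n + b < k * n.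
Proof.
move=> ak bn; have : a.+1 * n <= k * n by rewrite leq_mul2r ak orbT.
by rewrite mulSn; lia.
Qed.

Section Tableau.
Variable M : TM.
Let nt := (ntapes M).+2.

Definition tableau_tapes := nt.+1.
Notation I := tableau_tapes.

Definition rule : finType := (state M * {ffun 'I_nt -> symbol M})%type.
Definition nrules := #|{: rule}|.
(** A common range for symbols and states; the two codings may overlap, as a tape or the pseudo-tape
    holds one kind only. *)
Definition nsymbols := #|{: symbol M}| + #|{: state M}|.

Definition sym_code (a : symbol M) : nat := enum_rank a.
Definition state_code (q : state M) : nat := enum_rank q.

(** Halting becomes an ordinary transition that changes nothing, which spares the clauses a special
    case. *)
Definition total_delta (r : rule) : state M * {ffun 'I_nt -> symbol M * dir} :=
  if halting r.1 then (r.1, [ffun i => (r.2 i, Stay)]) else delta r.1 r.2.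

(* The finite tables of the machine; the pseudo-tape [nt] holds the state. *)
Definition rule_at (k : nat) : rule := nth (start M, [ffun=> None]) (enum rule) k.

Definition read_table k i : nat :=
  if i < nt then sym_code ((rule_at k).2 (inord i)) else state_code (rule_at k).1.

Definition write_table k i : nat :=
  if i < nt then sym_code ((total_delta (rule_at k)).2 (inord i)).1
  else state_code (total_delta (rule_at k)).1.

Definition move_table k i : nat :=
  if i < nt then
    match ((total_delta (rule_at k)).2 (inord i)).2 with
    | MoveLeft => 0 | Stay => 1 | MoveRight => 2
    end
  else 1.

Definition reject_table s : bool :=
  if insub s is Some j then ~~ accepting (enum_val (j : 'I_#|{: state M}|)) else false.

Definition blank_code := sym_code None.
Definition bit_code (b : bool) := sym_code (Some (inl b)).

(* [T] steps, certificates of length at most [Q].  Frames are relative to the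
   heads, which are at offset [T]. *)
Variables (x : seq bool) (T Q : nat).

(** Each step loses one known cell at either end, so [T] cells on both sides of the head last for
    [T] steps; [Q] makes room for the certificate. *)
Definition frame_width := (T + T + Q).+1.
Notation W := frame_width.
Notation S := nsymbols.

Definition tape_cell (t : tape M) (o : nat) : symbol M :=
  if o < T then nth None (lefts t) (T - o.+1)
  else if o == T then scanned t else nth None (rights t) (o - T.+1).

Definition cell_code (c : config M) (i o : nat) : nat :=
  if i < nt then sym_code (tape_cell (ctapes c (inord i)) o)
  else if o == T then state_code (cstate c) else state_code (start M).

Definition rule_code (c : config M) : nat :=
  enum_rank ((cstate c, [ffun i => scanned (ctapes c i)]) : rule).

Lemma rule_at_code c :
  rule_at (rule_code c) = (cstate c, [ffun i => scanned (ctapes c i)]).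
Proof. exact: nth_enum_rank. Qed.

Lemma rule_code_lt c : rule_code c < nrules.
Proof. exact: ltn_ord. Qed.

Lemma read_table_code c i : read_table (rule_code c) i = cell_code c i T.
Proof.
rewrite /read_table rule_at_code /cell_code /tape_cell ltnn eqxx /=.
by case: ifP => // _; rewrite ffunE.
Qed.

Lemma stepE c : step c =
  let: (q, a) := total_delta (cstate c, [ffun i => scanned (ctapes c i)]) in
  Config q [ffun i => write_move (ctapes c i) (a i)].
Proof.
rewrite /step /total_delta /=; case: ifP => // _.
case: c => q t /=; congr (Config q _).
by apply/ffunP => i; rewrite !ffunE; case: (t i).
Qed.

(** The head stays at offset [T] and the tape slides under it: with moves coded 0, 1, 2, cell [o]
    comes from [o + move - 1], where offset [T] has just been rewritten. *)
Lemma cell_code_step c i o : let r := rule_code c in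
  0 < o + move_table r i ->
  cell_code (step c) i o =
    if o + move_table r i - 1 == T then write_table r i
    else cell_code c i (o + move_table r i - 1).
Proof.
rewrite /= /move_table /write_table /cell_code rule_at_code stepE.
case E: (total_delta _) => [q a] /=; case: ifP => [iI|_] /=; last first.
  by rewrite addn1 subn1 /=; case: eqP.
rewrite ffunE; case: (a (inord i)) => s d /=.
move: (ctapes c (inord i)) => [l h r] {E c iI i q a}.
rewrite /tape_cell; case: d => /= o0.
- rewrite addn0 in o0 *; have -> : o - 1 = o.-1 by lia.
  case: (ltngtP o T) => oT.
  + rewrite ifF ?ifT; [|lia..].
    by rewrite nth_behead; congr (sym_code (nth _ _ _)); lia.
  + case: (ltngtP o.-1 T) => oT'; [lia| |].
      by rewrite (_ : o - T.+1 = (o.-1 - T.+1).+1) //; lia.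
    by rewrite (_ : o - T.+1 = 0) //; lia.
  + rewrite ifF ?ifT; [|lia..].
    by rewrite -nth0; congr (sym_code (nth _ _ _)); lia.
- by rewrite addn1 subn1 /=; case: ltngtP.
- rewrite (_ : o + 2 - 1 = o.+1); last by lia.
  case: (ltngtP o T) => oT.
  + case: (ltngtP o.+1 T) => oT'; [|lia|].
      by rewrite (_ : T - o.+1 = (T - o.+2).+1) //; lia.
    by rewrite (_ : T - o.+1 = 0) //; lia.
  + do 3 (rewrite ifF; last by lia).
    by rewrite nth_behead (_ : (o - T.+1).+1 = o.+1 - T.+1) //; lia.
  + do 3 (rewrite ifF; last by lia).
    by rewrite -nth0 (_ : o.+1 - T.+1 = 0) //; lia.
Qed.

Lemma sym_code_lt a : sym_code a < S.
Proof. by apply: leq_trans (ltn_ord (enum_rank a)) _; apply: leq_addr. Qed.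

Lemma state_code_lt q : state_code q < S.
Proof. by apply: leq_trans (ltn_ord (enum_rank q)) _; apply: leq_addl. Qed.

Lemma cell_code_lt c i o : cell_code c i o < S.
Proof. by rewrite /cell_code; do ![case: ifP => _]; rewrite ?sym_code_lt ?state_code_lt. Qed.

Lemma read_table_lt k i : read_table k i < S.
Proof. by rewrite /read_table; case: ifP => _; rewrite ?sym_code_lt ?state_code_lt. Qed.

Lemma write_table_lt k i : write_table k i < S.
Proof. by rewrite /write_table; case: ifP => _; rewrite ?sym_code_lt ?state_code_lt. Qed.

Lemma sym_code_inj : injective sym_code.
Proof. by move=> a b /ord_inj/enum_rank_inj. Qed.

Lemma rule_code_eq c k : k < nrules ->
  (forall i, i < I -> cell_code c i T = read_table k i) -> rule_code c = k.
Proof.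
move=> kR E.
have Ek : rule_at k = rule_at (rule_code c).
  rewrite rule_at_code; case Er: (rule_at k) => [q u]; congr (_, _).
    have := E nt (ltnSn _); rewrite /cell_code /read_table ltnn eqxx Er /=.
    by move/ord_inj/enum_rank_inj.
  apply/ffunP => i; have := E i (ltnW (ltn_ord i)).
  rewrite /cell_code /read_table ltn_ord Er inord_val /tape_cell ltnn eqxx /=.
  by move/sym_code_inj => <-; rewrite ffunE.
have kE : k < size (enum rule) by rewrite -cardE.
have cE : rule_code c < size (enum rule) by rewrite -cardE rule_code_lt.
by apply/eqP; rewrite -(nth_uniq (start M, [ffun=> None]) cE kE (enum_uniq _)); apply/eqP.
Qed.

Lemma reject_tableP q : reject_table (state_code q) = ~~ accepting q.
Proof.
rewrite /reject_table /state_code; case: insubP => [j _ jE|]; last by rewrite ltn_ord.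
by rewrite (ord_inj jE) enum_rankK.
Qed.

Lemma reject_table_code s : reject_table s ->
  exists2 q, s = state_code q & ~~ accepting q.
Proof.
rewrite /reject_table; case: insubP => [j _ <-|//] jr.
by exists (enum_val j) => //; rewrite /state_code enum_valK.
Qed.

Lemma CW : T < W.
Proof. by rewrite /frame_width; lia. Qed.

Notation R := nrules.
Notation C := T.
Notation Ik := nt.

(* Variable 0 is true, variable 1 is false, and the others say that cell
   [(i, o)] of the frame of time [t] has symbol [s]. *)
Definition cell_var t i o s := ((((t * I + i) * W + o) * S + s)).+2.

Definition pos_lit v := v.*2.
Definition neg_lit v := v.*2.+1.

(** [k] numbers the literals of a clause: a certificate cell is blank or one of two bits, any other
    cell repeats a single literal. *)
Definition initial_code i o k : nat :=
  if i == 0 then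
    if (C <= o) && (o - C < size x) then bit_code (nth false x (o - C)) else blank_code
  else if i == 1 then
    if (C <= o) && (o - C < Q) then
      (if k == 0 then blank_code else bit_code (k != 1))
    else blank_code
  else if i == Ik then state_code (start M) else blank_code.

(** An implication: if the head cells match rule [r] and the source cell holds [s], then the target
    cell is determined. For a source outside the frame, the clause contains the negation of variable
    1, which [truth] makes false. *)
Definition transition_lit t i o r s k : nat :=
  if T <= t then pos_lit 0
  else if k < I then neg_lit (cell_var t k C (read_table r k))
  else
    let o' := o + move_table r i in
    if k == I then
      neg_lit (if (0 < o') && (o' - 1 < W) then cell_var t i (o' - 1) s else 1)
    else pos_lit (cell_var t.+1 i o (if o' - 1 == C then write_table r i else s)).

(** A blank is followed by blanks, so that the certificate is a contiguous string. *)
Definition blank_lit o k : nat :=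
  if (C <= o) && (o.+1 < W) then
    (if k == 0 then neg_lit (cell_var 0 1 o blank_code)
     else pos_lit (cell_var 0 1 o.+1 blank_code))
  else pos_lit 0.

Definition final_lit s : nat :=
  if reject_table s then neg_lit (cell_var T Ik C s) else pos_lit 0.

(* The families are transitions (0), initial frame (1), blanks after the
   certificate (2) and acceptance (3). *)
Definition tableau_lit fam t i o r s k : nat :=
  if fam == 0 then transition_lit t i o r s k
  else if fam == 1 then pos_lit (cell_var 0 i o (initial_code i o k))
  else if fam == 2 then blank_lit o k
  else final_lit s.

Definition clause_width := I.+2.
Definition nclauses := T.+1 * I * W * R * S * 4.
Definition nvars := (T.+1 * I * W * S).+2.

Definition clause_lit j k : nat :=
  let u := j %/ 4 in let u1 := u %/ S in let u2 := u1 %/ R in let u3 := u2 %/ W in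
  tableau_lit (j %% 4) (u3 %/ I) (u3 %% I) (u2 %% W) (u1 %% R) (u %% S) k.

Definition clauses_hold (a : nat -> bool) : Prop := forall fam t i o r s,
  fam < 4 -> t <= T -> i < I -> o < W -> r < R -> s < S ->
  exists2 k, k < clause_width & lit_val a (tableau_lit fam t i o r s k).

Lemma R_gt0 : 0 < R.
Proof. by apply: leq_ltn_trans (leq0n _) (rule_code_lt (init M [::])). Qed.

Lemma S_gt0 : 0 < S.
Proof. by apply: leq_ltn_trans (leq0n _) (sym_code_lt None). Qed.

Lemma satisfiable_clauses : satisfiable nclauses clause_width clause_lit <->
  exists a : nat -> bool, a 0 /\ clauses_hold a.
Proof.
split=> -[a [a0 H]]; exists a; split=> //.
  move=> fam t i o r s f4 tT iI oW rR sS.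
  pose u3 := t * I + i; pose u2 := u3 * W + o; pose u1 := u2 * R + r.
  pose u := u1 * S + s; have jm : u * 4 + fam < nclauses.
    by do !apply: radix_lt => //.
  have [k kK Hk] := H _ jm; exists k => //; move: Hk.
  rewrite /clause_lit radix_div // radix_mod //.
  by rewrite /u /u1 /u2 /u3 !(radix_div, radix_mod).
move=> j jm; apply: H.
- by rewrite ltn_mod.
- have : j < T.+1 * I * W * R * S * 4 := jm.
  by have S0 := S_gt0; have R0 := R_gt0; rewrite -!ltn_divLR.
- by rewrite ltn_mod.
- by rewrite ltn_mod.
- by rewrite ltn_mod R_gt0.
- by rewrite ltn_mod S_gt0.
Qed.

Lemma cell_var_le t i o s : t <= T -> i < I -> o < W -> s < S -> cell_var t i o s < nvars.
Proof. by move=> tT iI oW sS; rewrite /cell_var /nvars !ltnS; do !apply: radix_lt. Qed.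

Lemma initial_code_lt i o k : initial_code i o k < S.
Proof. by rewrite /initial_code; do ![case: ifP => _]; rewrite ?sym_code_lt ?state_code_lt. Qed.

Lemma clause_lit_lt j k : j < nclauses -> k < clause_width -> clause_lit j k < nvars.*2.+2.
Proof.
move=> jm kK; rewrite /clause_lit; set u := j %/ 4; set u1 := u %/ S.
set u2 := u1 %/ R; set u3 := u2 %/ W.
have tT : u3 %/ I <= T.
  have : j < T.+1 * I * W * R * S * 4 := jm.
  by have S0 := S_gt0; have R0 := R_gt0; rewrite -!ltn_divLR.
have iI : u3 %% I < I by rewrite ltn_mod.
have oW : u2 %% W < W by rewrite ltn_mod.
have sS : u %% S < S by rewrite ltn_mod S_gt0.
move: (u3 %/ I) (u3 %% I) (u2 %% W) (u1 %% R) (u %% S) tT iI oW sS.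
move: (j %% 4) => fam t i o r s tT iI oW sS {u u1 u2 u3 jm j}.
have CW : C < W by rewrite /frame_width; lia.
have lP v : v < nvars -> pos_lit v < nvars.*2.+2 by rewrite /pos_lit; lia.
have lN v : v < nvars -> neg_lit v < nvars.*2.+2 by rewrite /neg_lit; lia.
have P0 : pos_lit 0 < nvars.*2.+2 by [].
rewrite /tableau_lit /transition_lit /blank_lit /final_lit.
case: ifP => _; first case: ifP => // tT'; first case: ifP => kI.
- apply/lN/cell_var_le => //; exact: read_table_lt.
- case: ifP => _; [apply: lN; case: ifP => // /andP[_ oo]|apply/lP/cell_var_le] => //.
  + exact: cell_var_le.
  + by lia.
  + by case: ifP; rewrite ?write_table_lt.
- case: ifP => _; first by apply/lP/cell_var_le => //; apply: initial_code_lt.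
  case: ifP => _.
    case: ifP => // /andP[_ oW']; case: ifP => _; [apply: lN|apply: lP];
      apply: cell_var_le => //; exact: sym_code_lt.
  by case: ifP => // _; apply/lN/cell_var_le.
Qed.

Lemma lit_val_pos a v : lit_val a (pos_lit v) = a v.
Proof. by rewrite /lit_val /pos_lit odd_double doubleK. Qed.

Lemma lit_val_neg a v : lit_val a (neg_lit v) = ~~ a v.
Proof.
rewrite /lit_val /neg_lit; have -> : v.*2.+1./2 = v by lia.
by rewrite oddS odd_double.
Qed.

Notation run w t := (run M [:: x; w] t).

Lemma runS w t : run w t.+1 = step (run w t).
Proof. by []. Qed.

Lemma nth_tape_of (y : seq bool) o : C <= o ->
  tape_cell (tape_of M y) o = nth None [seq Some (inl b) | b <- y] (o - C).
Proof.
move=> Co; rewrite /tape_cell ltnNge Co /=.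
case: eqP => [->|oC]; first by rewrite subnn nth0.
by rewrite nth_behead; congr nth; lia.
Qed.

Lemma tape_of_left (y : seq bool) o : o < C -> tape_cell (tape_of M y) o = None.
Proof. by rewrite /tape_cell => ->; rewrite nth_nil. Qed.

Lemma nth_string (y : seq bool) p :
  sym_code (nth None [seq Some (inl b) | b <- y] p) =
  if p < size y then bit_code (nth false y p) else blank_code.
Proof.
case: ltnP => py; first by rewrite (nth_map false).
by rewrite nth_default // size_map.
Qed.

Lemma cell_code_init w i o : i < I ->
  cell_code (run w 0) i o =
    if i == 0 then
      if (C <= o) && (o - C < size x) then bit_code (nth false x (o - C)) else blank_code
    else if i == 1 then
      if (C <= o) && (o - C < size w) then bit_code (nth false w (o - C)) else blank_code
    else if i == Ik then state_code (start M) else blank_code.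
Proof.
move=> iI; rewrite /cell_code /=; case: ifP => iN; last first.
  have -> : i = nt by move: iI; rewrite ltnS leq_eqVlt iN orbF => /eqP.
  by rewrite eqxx; case: eqP.
have cell y : sym_code (tape_cell (tape_of M y) o) =
    if (C <= o) && (o - C < size y) then bit_code (nth false y (o - C)) else blank_code.
  case: (leqP C o) => Co; last by rewrite tape_of_left.
  by rewrite nth_tape_of // nth_string.
rewrite ffunE inordK // cell.
case: i iN {iI} => [|[|i]] iN //=.
by rewrite nth_nil /= andbF ifF //; apply/negbTE/eqP => E; rewrite E ltnn in iN.
Qed.

(** * From a satisfying assignment to an accepted certificate *)

Section SatisfiedTableau.
Variable a : nat -> bool.
Hypothesis a0 : a 0.
Hypothesis aH : clauses_hold a.

(** The certificate ends at the first cell with a true blank. A cell may have several true symbols,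
    so the variable of the bit [true] settles its bit. *)
Definition extracted : seq bool :=
  mkseq (fun p => a (cell_var 0 1 (C + p) (bit_code true)))
    (find (fun p => a (cell_var 0 1 (C + p) blank_code)) (iota 0 Q)).

Lemma size_extracted : size extracted <= Q.
Proof. by rewrite size_mkseq -[leqRHS](size_iota 0) find_size. Qed.

Let holds t i o (c : config M) := a (cell_var t i o (cell_code c i o)).

Lemma initial_clause i o : i < I -> o < W ->
  exists2 k, k < clause_width & a (cell_var 0 i o (initial_code i o k)).
Proof.
move=> iI oW.
have [k kK] := @aH 1 0 i o 0 0 isT (leq0n _) iI oW R_gt0 S_gt0.
by rewrite lit_val_pos => H; exists k.
Qed.

Lemma blank_propagates o : C <= o -> o.+1 < W ->
  a (cell_var 0 1 o blank_code) -> a (cell_var 0 1 o.+1 blank_code).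
Proof.
move=> Co oW H.
have [k kK] := @aH 2 0 0 o 0 0 isT (leq0n _) isT (ltnW oW) R_gt0 S_gt0.
rewrite /tableau_lit /= /blank_lit Co oW /=; case: ifP => _.
  by rewrite lit_val_neg H.
by rewrite lit_val_pos.
Qed.

Lemma initial_holds i o : i < I -> o < W -> holds 0 i o (run extracted 0).
Proof.
move=> iI oW; rewrite /holds cell_code_init //.
have [k kK H] := initial_clause iI oW; move: H; rewrite /initial_code.
have [->//|i0] := eqVneq i 0; have [Ei|//] := eqVneq i 1; subst i.
set n := find (fun p => a (cell_var 0 1 (C + p) blank_code)) (iota 0 Q).
have sE : size extracted = n by rewrite size_mkseq.
have nQ : n <= Q by rewrite -sE size_extracted.
rewrite sE; case: (leqP C o) => Co /=; last by [].
have [oQ|oQ] := ltnP (o - C) Q; last by rewrite ifF //; lia.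
have [on|on] := ltnP (o - C) n; last first.
  move=> _; have nQ' : n < Q by lia.
  have An : a (cell_var 0 1 (C + n) blank_code).
    have : has (fun p => a (cell_var 0 1 (C + p) blank_code)) (iota 0 Q).
      by rewrite has_find size_iota.
    by move/(nth_find 0); rewrite nth_iota // add0n.
  have Ad d : C + n + d < W -> a (cell_var 0 1 (C + n + d) blank_code).
    elim: d => [|d IH] dW; first by rewrite addn0.
    rewrite addnS; apply: blank_propagates; [lia|lia|apply: IH; lia].
  by have := Ad (o - (C + n)); rewrite subnKC; [apply; lia|lia].
(* Before the first blank the clause of the cell leaves the two bits; if the variable of [true] is
   not set, that of [false] is. *)
have nb : ~~ a (cell_var 0 1 o blank_code).
  have := before_find 0 on; rewrite nth_iota; last by lia.
  by rewrite add0n subnKC // => ->.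
case: eqP => [_ H|_]; first by rewrite H in nb.
rewrite (nth_mkseq false) // subnKC //.
case: (k != 1); first by move=> E; rewrite !E.
by case E: (a (cell_var 0 1 o (bit_code true))) => //; rewrite E.
Qed.

(** The symbol of the actual run is among those set in each cell, inside a window that shrinks with
    time. This is enough, since the acceptance clauses forbid every rejecting state. *)
Lemma tableau_holds t i o : t <= T -> i < I -> t <= o -> o + t < W ->
  holds t i o (run extracted t).
Proof.
elim: t i o => [|t IH] i o tT iI to oW.
  by apply: initial_holds => //; rewrite addn0 in oW.
set c := run extracted t in IH *; pose r := rule_code c.
have m2 : move_table r i < 3 by rewrite /move_table; case: ifP => // _; case: (_.2).
have o'0 : 0 < o + move_table r i by lia.
have o'W : o + move_table r i - 1 < W by lia.
have H : a (cell_var t i (o + move_table r i - 1)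
             (cell_code c i (o + move_table r i - 1))).
  by apply: IH; lia.
(* For the rule in force and the actual source symbol, the premises of the implication hold. *)
have [k kK] := @aH 0 t i o r (cell_code c i (o + move_table r i - 1)) isT (ltnW tT) iI
  (ltac:(lia)) (rule_code_lt c) (cell_code_lt c _ _).
rewrite /holds runS -/c cell_code_step // -/r.
rewrite /tableau_lit /= /transition_lit leqNgt tT /=.
case: ifP => kI.
  rewrite read_table_code lit_val_neg => /negP[]; apply: IH => //; [lia|lia|].
  by have := CW; rewrite /frame_width; lia.
case: ifP => _; first by rewrite o'0 o'W lit_val_neg H.
by rewrite lit_val_pos.
Qed.

Lemma extracted_accepted : accepted (run extracted T).
Proof.
rewrite /accepted; set c := run extracted T; apply: contraT => rej.
have H : holds T Ik C c by apply: tableau_holds => //; rewrite /frame_width; lia.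
rewrite /holds /cell_code ltnn eqxx in H.
have [k kK] := @aH 3 0 0 0 0 (state_code (cstate c)) isT (leq0n _) isT isT R_gt0
  (state_code_lt _).
by rewrite /tableau_lit /= /final_lit reject_tableP rej lit_val_neg H.
Qed.

End SatisfiedTableau.

(** * From an accepting run to a satisfying assignment *)

Section AcceptingRun.
Variable w : seq bool.
Hypothesis wQ : size w <= Q.
Hypothesis acc : accepted (run w T).

Definition truth (v : nat) : bool :=
  (v == 0) || (1 < v) && let u := v - 2 in let u1 := u %/ S in let u2 := u1 %/ W in
    cell_code (run w (u2 %/ I)) (u2 %% I) (u1 %% W) == u %% S.

Lemma truth_cell t i o s : i < I -> o < W -> s < S ->
  truth (cell_var t i o s) = (cell_code (run w t) i o == s).
Proof.
move=> iI oW sS; rewrite /truth /cell_var /= subn2 /=.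
by rewrite !(radix_div, radix_mod).
Qed.

Lemma truth_initial i o : i < I -> o < W ->
  exists2 k, k < clause_width & cell_code (run w 0) i o = initial_code i o k.
Proof.
move=> iI oW; rewrite cell_code_init // /initial_code.
have [_|i0] := eqVneq i 0; first by exists 0.
have [_|i1] := eqVneq i 1; last by exists 0.
case: (leqP C o) => Co /=; last by exists 0.
have [ow|ow] := ltnP (o - C) (size w); last by exists 0 => //=; case: ifP.
exists (if nth false w (o - C) then 2 else 1); first by case: ifP.
by rewrite ifT; [case: (nth _ _ _)|lia].
Qed.

Lemma truth_holds : clauses_hold truth.
Proof.
have t0 : exists2 k, k < clause_width & lit_val truth (pos_lit 0).
  by exists 0; rewrite ?lit_val_pos.
have CW' := CW; move=> fam t i o r s _ tT iI oW rR sS; rewrite /tableau_lit.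
have [_|f0] := eqVneq fam 0.
  rewrite /transition_lit; case: (leqP T t) => tT'; first exact: t0.
  (* If the head cells do not match [r], one of the first literals holds; if they do, the last two
     decide. *)
  have [E|] := pselect (forall k, k < I -> cell_code (run w t) k T = read_table r k).
    have rE := rule_code_eq rR E.
    have [src|src] := boolP [&& 0 < o + move_table r i, o + move_table r i - 1 < W
        & cell_code (run w t) i (o + move_table r i - 1) == s].
      case/and3P: src => o0 oW' /eqP sE.
      exists I.+1 => //; rewrite ltnNge leqnSn /= gtn_eqF // lit_val_pos.
      rewrite truth_cell //; last by case: ifP; rewrite ?write_table_lt.
      by rewrite runS cell_code_step rE // sE.
    exists I => //; rewrite ltnn eqxx lit_val_neg.
    move: src; rewrite andbA; case: ifP => //= /andP[_ oW'].
    by rewrite truth_cell.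
  move=> /existsNP[k /not_implyP[kI kN]]; exists k; first by rewrite /clause_width; lia.
  rewrite kI lit_val_neg truth_cell; first by apply/eqP.
  - by [].
  - exact: CW'.
  - exact: read_table_lt.
have [_|f1] := eqVneq fam 1.
  have [h hK E] := truth_initial iI oW; exists h => //.
  by rewrite lit_val_pos truth_cell ?initial_code_lt // E.
have [_|f2] := eqVneq fam 2.
  rewrite /blank_lit; case: (boolP ((C <= o) && (o.+1 < W))) => [/andP[Co oW']|_];
    last exact: t0.
  have [E|E] := eqVneq (cell_code (run w 0) 1 o) blank_code; last first.
    by exists 0 => //=; rewrite lit_val_neg truth_cell ?sym_code_lt.
  exists 1 => //=; rewrite lit_val_pos truth_cell ?sym_code_lt //.
  move: E; rewrite !cell_code_init //= Co (leqW Co) /=.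
  case: ifP => ow; first by move/sym_code_inj.
  by rewrite ifF //; lia.
exists 0 => //; rewrite /final_lit; case: ifP => [/reject_table_code[q -> rej]|_];
  last by rewrite lit_val_pos.
rewrite lit_val_neg truth_cell; [|by []|exact: CW'|exact: state_code_lt].
rewrite /cell_code ltnn eqxx.
apply: contra rej => /eqP/ord_inj/enum_rank_inj <-; exact: acc.
Qed.

End AcceptingRun.

Theorem tableau_satisfiable : satisfiable nclauses clause_width clause_lit <->
  exists2 w, size w <= Q & accepted (run w T).
Proof.
rewrite satisfiable_clauses; split=> [[a [a0 aH]]|[w wQ acc]].
  exists (extracted a); first exact: size_extracted.
  exact: extracted_accepted.
by exists (truth w); split=> //; apply: truth_holds.
Qed.

End Tableau.

Lemma cmp_min f m : cmp f -> cmp (fun xs env => minn (f xs env) m).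
Proof.
move=> cf; apply: cmp_ext (cmp_if (cmpb_leq cf (cmp_const m)) cf (cmp_const m)) => xs env.
by rewrite /minn; case: ltngtP.
Qed.

(** Larger arguments act like the bounds, so a finite table determines [F]. *)
Lemma cmp_finite (F : nat -> nat -> nat) m n f g :
  (forall a b, F a b = F (minn a m) (minn b n)) -> cmp f -> cmp g ->
  cmp (fun xs env => F (f xs env) (g xs env)).
Proof.
move=> FE cf cg.
apply: cmp_ext (@cmp_table F m.+1 n.+1 _ _ (cmp_min m cf) (cmp_min n cg)) => xs env.
by rewrite !ltnS !geq_minr /= -FE.
Qed.

Section TableauComputable.
Variable M : TM.

Lemma rule_at_min k : @rule_at M k = @rule_at M (minn k (nrules M)).
Proof.
rewrite /rule_at; have [le|/ltnW le] := leqP k (nrules M).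
  by [].
by rewrite !nth_default // -cardE.
Qed.

Lemma lt_min i n : (minn i n < n) = (i < n).
Proof. by rewrite gtn_min ltnn orbF. Qed.

Lemma min_lt i n : i < n -> minn i n = i.
Proof. by move=> /ltnW/minn_idPl. Qed.

Lemma cmp_read f g : cmp f -> cmp g ->
  cmp (fun xs env => @read_table M (f xs env) (g xs env)).
Proof.
apply: (@cmp_finite _ (nrules M) (ntapes M).+2) => k i.
rewrite /read_table -rule_at_min lt_min; case: ifP => // iI.
by rewrite min_lt.
Qed.

Lemma cmp_write f g : cmp f -> cmp g ->
  cmp (fun xs env => @write_table M (f xs env) (g xs env)).
Proof.
apply: (@cmp_finite _ (nrules M) (ntapes M).+2) => k i.
rewrite /write_table -rule_at_min lt_min; case: ifP => // iI.
by rewrite min_lt.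
Qed.

Lemma cmp_move f g : cmp f -> cmp g ->
  cmp (fun xs env => @move_table M (f xs env) (g xs env)).
Proof.
apply: (@cmp_finite _ (nrules M) (ntapes M).+2) => k i.
rewrite /move_table -rule_at_min lt_min; case: ifP => // iI.
by rewrite min_lt.
Qed.

Lemma cmp_reject f : cmp f -> cmpb (fun xs env => @reject_table M (f xs env)).
Proof.
move=> cf; apply: (@cmp_finite (fun a _ => @reject_table M a) #|{: state M}| 0 f f) => // a _.
congr nat_of_bool; case: (ltnP a #|{: state M}|) => [//|le].
by rewrite /reject_table !insubF ?ltnn // ltnNge le.
Qed.

Lemma cmp_bit_code b : cmpb b -> cmp (fun xs env => bit_code M (b xs env)).
Proof.
move=> cb; apply: cmp_ext (cmp_if cb (cmp_const (bit_code M true))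
  (cmp_const (bit_code M false))) => xs env.
by case: (b xs env).
Qed.

Variables Tn Qn : numfun.
Hypothesis cT : cmp Tn.
Hypothesis cQ : cmp Qn.

Ltac tab :=
  repeat first
    [ match goal with
      | |- cmp (fun xs env => @read_table M (@?f xs env) (@?g xs env)) => apply (@cmp_read f g)
      | |- cmp (fun xs env => @write_table M (@?f xs env) (@?g xs env)) => apply (@cmp_write f g)
      | |- cmp (fun xs env => @move_table M (@?f xs env) (@?g xs env)) => apply (@cmp_move f g)
      | |- cmpb (fun xs env => @reject_table M (@?f xs env)) => apply (@cmp_reject f)
      | |- cmp (fun xs env => bit_code M (@?b xs env)) => apply (@cmp_bit_code b)
      end
    | cmp_leaf | cmp_step | cmpb_step ].

Lemma cmp_clause_lit j k : cmp j -> cmp k ->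
  cmp (fun xs env => clause_lit M (nth [::] xs 0) (Tn xs env) (Qn xs env) (j xs env) (k xs env)).
Proof.
move=> cj ck; rewrite /clause_lit /tableau_lit /transition_lit /initial_code /blank_lit
  /final_lit /pos_lit /neg_lit /cell_var /frame_width.
tab.
Qed.

Lemma cmp_nvars : cmp (fun xs env => nvars M (Tn xs env) (Qn xs env)).
Proof. by rewrite /nvars /frame_width; tab. Qed.

Lemma cmp_nclauses : cmp (fun xs env => nclauses M (Tn xs env) (Qn xs env)).
Proof. by rewrite /nclauses /frame_width; tab. Qed.

End TableauComputable.

(** * The encoding of the reduced graph *)

(** [encode] lists the vertices in the order of [enum], so codes given by arithmetic must increase
    by one along it. *)
Definition numbering (T : finType) (c : T -> nat) : Prop :=
  [seq c x | x <- enum T] = iota 0 #|T|.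

Lemma numbering_ord n : numbering (@nat_of_ord n).
Proof. by rewrite /numbering val_enum_ord card_ord. Qed.

Lemma numbering_sum (S T : finType) (c : S -> nat) (d : T -> nat) :
  numbering c -> numbering d ->
  numbering (fun u : S + T => match u with inl x => c x | inr y => #|S| + d y end).
Proof.
rewrite /numbering => cE dE; rewrite card_sum iotaD -cE.
rewrite [0 + _]addnC iotaDl -dE.
have -> : enum {: S + T} = [seq inl x | x <- enum S] ++ [seq inr x | x <- enum T].
  by rewrite [LHS]enumT unlock /= /sum_enum -!enumT.
by rewrite map_cat -!map_comp.
Qed.

Lemma enum_pair (S T : finType) :
  enum {: S * T} = [seq (x, y) | x <- enum S, y <- enum T].
Proof. by rewrite [LHS]enumT unlock. Qed.

Lemma numbering_pair (S T : finType) (c : S -> nat) (d : T -> nat) :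
  numbering c -> numbering d ->
  numbering (fun u : S * T => c u.1 * #|T| + d u.2).
Proof.
rewrite /numbering => cE dE; rewrite card_prod.
rewrite enum_pair.
have -> : iota 0 (#|S| * #|T|) =
    flatten [seq [seq i * #|T| + j | j <- iota 0 #|T|] | i <- iota 0 #|S|].
  elim: #|S| => [|n IH] //.
  rewrite mulSnr iotaD IH -addn1 iotaD map_cat flatten_cat /= cats0; congr (_ ++ _).
  by rewrite -iotaDl addnC.
rewrite map_flatten -cE -dE -!map_comp; congr flatten; apply: eq_map => x /=.
by rewrite -!map_comp.
Qed.

Lemma numbering_lt (T : finType) (c : T -> nat) x : numbering c -> c x < #|T|.
Proof.
move=> cE; have : c x \in [seq c x | x <- enum T] by rewrite map_f ?mem_enum.
by rewrite cE mem_iota.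
Qed.

Lemma numbering_inj (T : finType) (c : T -> nat) : numbering c -> injective c.
Proof.
move=> cE; have /injectiveP // : injectiveb c.
by rewrite /injectiveb /dinjectiveb [map _ _]cE iota_uniq.
Qed.

Lemma encode_numbering (G : sgraph) (c : G -> nat) (A : nat -> nat -> bool) :
  numbering c -> (forall u v, A (c u) (c v) = adj u v) ->
  encode G = nseq #|G| true ++
    false :: mkseq (fun k => A (k %/ #|G|) (k %% #|G|)) (#|G| * #|G|).
Proof.
move=> cE AE; rewrite /encode; congr (_ ++ _ :: _).
have := numbering_pair cE cE; rewrite /numbering card_prod /mkseq => <-.
rewrite enum_pair -!map_comp map_allpairs.
apply: eq_allpairs => u v /=.
by rewrite radix_div ?radix_mod ?AE ?numbering_lt.
Qed.

(** [gadget_adj0] on numbers: four hubs, then [nh] hosts, [ng] guests and the leaves, two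
    consecutive ones for each guest. *)
Definition gadget_adjn (nh ng : nat) (nbn : nat -> nat -> nat) (u v : nat) : bool :=
  if u < 4 then (if v < 4 then u != v else v < 4 + nh)
  else if (4 + nh <= u) && (u < 4 + (nh + ng)) then
    if v < 4 + (nh + ng) then has (fun i => nbn (u - (4 + nh)) i == v) (iota 0 3)
    else (v - (4 + (nh + ng))) %/ 2 == u - (4 + nh)
  else false.

Section GadgetNumbering.
Variables (G H : finType) (nb : G -> 'I_3 -> G + H).
Variables (cg : G -> nat) (ch : H -> nat) (nbn : nat -> nat -> nat).
Hypothesis cgN : numbering cg.
Hypothesis chN : numbering ch.

Definition gadget_code (u : gadget_vertex G H) : nat :=
  match u with
  | inl (inl c) => c
  | inl (inr h) => 4 + ch h
  | inr (inl g) => 4 + (#|H| + cg g)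
  | inr (inr (g, b)) => 4 + (#|H| + (#|G| + (cg g * 2 + b)))
  end.

Lemma numbering_gadget : numbering gadget_code.
Proof.
have := numbering_sum (numbering_sum (numbering_ord 4) chN)
  (numbering_sum cgN (numbering_pair cgN (numbering_ord 2))).
rewrite /numbering => <-; apply: eq_map => -[[c|h]|[g|[g b]]] //=;
  by rewrite ?card_sum ?card_ord -?addnA.
Qed.

Hypothesis nbnE : forall g (i : 'I_3),
  nbn (cg g) i = match nb g i with
                 | inl k => 4 + (#|H| + cg k)
                 | inr h => 4 + ch h
                 end.

Lemma gadget_adjnE u v :
  gadget_adjn #|H| #|G| nbn (gadget_code u) (gadget_code v) = gadget_adj0 nb u v.
Proof.
have hg g := numbering_lt g cgN.
have hh h := numbering_lt h chN.
have nbE g w : has (fun i => nbn (cg g) i == gadget_code w) (iota 0 3)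
           = [exists i, nbv nb g i == w].
  apply/hasP/existsP => [[i]|[i /eqP E]].
    rewrite mem_iota /= add0n => i3 /eqP E; exists (Ordinal i3).
    rewrite -(inj_eq (numbering_inj numbering_gadget)) -E.
    by rewrite (nbnE g (Ordinal i3)) /nbv; case: (nb g _).
  exists (val i); first by rewrite mem_iota /=.
  by rewrite -E nbnE /nbv; case: (nb g i).
have codeE g : 4 + (#|H| + cg g) - (4 + #|H|) = cg g by lia.
rewrite /gadget_adjn.
have e1 h : (4 + h < 4) = false by lia.
have e2 h : (4 + #|H| <= 4 + ch h) = false by have := hh h; lia.
have e3 k : (4 + #|H| <= 4 + (#|H| + k)) by lia.
have e4 g : 4 + (#|H| + cg g) < 4 + (#|H| + #|G|) by have := hg g; lia.
have e5 k : (4 + (#|H| + (#|G| + k)) < 4 + (#|H| + #|G|)) = false by lia.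
case: u => [[c|h]|[g|[g b]]]; rewrite /gadget_code ?ltn_ord ?e1 ?e2 ?e3 ?e4 ?e5 //=.
- case: v => [[d|h']|[g'|[g' b']]]; rewrite ?ltn_ord ?e1 ?ltn_add2l ?hh //=; lia.
- rewrite codeE (_ : [|| _, _, _ | _] = [exists i, nbv nb g i == v]); last exact: nbE.
  case: v => [[d|h']|[g'|[g' b']]] /=.
  + by rewrite (leq_trans (ltn_ord d)) ?leq_addr.
  + by rewrite ltn_add2l ltn_addr // hh.
  + by rewrite e4.
  + rewrite e5 (_ : _ - _ = cg g' * 2 + b'); last by lia.
    by rewrite radix_div // (inj_eq (numbering_inj cgN)) eq_sym.
Qed.

End GadgetNumbering.

Section SatNumbering.
Variables (n m K : nat) (lit : nat -> nat -> nat).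
Notation E := (nconstraints m K).
Notation S := (nsignals n m K).
Notation L := (nslots m K).

Definition sat_guest_code (g : sat_guest n m K) : nat :=
  match g with
  | inl (s, t) => s * L + t
  | inr (e, b) => S * L + (e * 2 + b)
  end.

Definition sat_host_code (h : sat_host n m K) : nat := h.1 * L + h.2.

(** [sat_nb] on numbers: hosts are shifted by the 4 hubs, guests also by the hosts. Adding [L]
    before [.-1] gives the cyclic predecessor. *)
Definition sat_nbn (g i : nat) : nat :=
  if g < S * L then
    if i == 0 then 4 + (S * L + (g %/ L * L + (g %% L).+1 %% L))
    else if i == 1 then 4 + (S * L + (g %/ L * L + (g %% L + L).-1 %% L))
    else if (g %% L == 0) && (g %/ L < n.*2.+2) then 4 + (g %/ L)./2.*2 * L
    else 4 + g
  else if i == 0 then 4 + (S * L + (S * L + ((g - S * L) %/ 2 * 2 + (1 - (g - S * L) %% 2))))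
  else 4 + (entry n K lit ((g - S * L) %/ 2) ((g - S * L) %% 2) (i - 1) * L
            + slot ((g - S * L) %/ 2) ((g - S * L) %% 2) (i - 1)).

Lemma card_sat_host : #|sat_host n m K| = S * L.
Proof. by rewrite card_prod !card_ord. Qed.

Lemma card_sat_guest : #|sat_guest n m K| = S * L + E * 2.
Proof. by rewrite card_sum !card_prod !card_ord. Qed.

Lemma numbering_sat_host : numbering sat_host_code.
Proof.
have := numbering_pair (@numbering_ord S) (@numbering_ord L).
by rewrite /numbering => <-; apply: eq_map => -[s t]; rewrite /= card_ord.
Qed.

Lemma numbering_sat_guest : numbering sat_guest_code.
Proof.
have := numbering_sum (numbering_pair (@numbering_ord S) (@numbering_ord L))
  (numbering_pair (@numbering_ord E) (@numbering_ord 2)).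
rewrite /numbering => <-; apply: eq_map => -[[s t]|[e b]] /=;
  by rewrite ?card_prod !card_ord.
Qed.

(** Guests count three times, with their two leaves. *)
Definition sat_size : nat := 4 + (S * L + ((S * L + E * 2) * 3)).

Lemma card_sat_gadget : #|gadget_vertex (sat_guest n m K) (sat_host n m K)| = sat_size.
Proof. by rewrite !card_sum !card_prod !card_ord card_sat_guest /sat_size; lia. Qed.

Hypothesis K_gt0 : 0 < K.
Hypothesis lit_lt : forall j k, j < m -> k < K -> lit j k < n.*2.+2.

Lemma sat_nbnE g (i : 'I_3) :
  sat_nbn (sat_guest_code g) i =
  match @sat_nb n m K lit g i with
  | inl k => 4 + (#|sat_host n m K| + sat_guest_code k)
  | inr h => 4 + sat_host_code h
  end.
Proof.
rewrite card_sat_host /sat_nbn; case: g => [[s t]|[e b]] /=.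
  rewrite radix_lt // radix_div // radix_mod //.
  case: i => [[|[|[|i]]] hi] //=.
  rewrite /signal_host /sat_host_code (_ : (t == ord0) = (t == 0 :> nat)) //.
  case: ifP => // /andP[/eqP -> sn] /=; rewrite addn0 inordK //.
  by have := ltn_ord s; have := odd_double_half s; lia.
rewrite ifF; last by lia.
rewrite addKn radix_div // radix_mod //.
case: i => [[|i] hi] //=.
rewrite subn1 /= /sat_host_code /= !inordK //; first exact: slot_lt.
exact: (entry_lt K_gt0 lit_lt).
Qed.

Definition sat_adjn (u v : nat) : bool :=
  gadget_adjn (S * L) (S * L + E * 2) sat_nbn u v ||
  gadget_adjn (S * L) (S * L + E * 2) sat_nbn v u.

Definition sat_graph : sgraph :=
  gadget_graph (@sat_nb_irr n m K lit K_gt0).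

Lemma encode_sat_graph : encode sat_graph =
  nseq sat_size true ++
  false :: mkseq (fun k => sat_adjn (k %/ sat_size) (k %% sat_size)) (sat_size * sat_size).
Proof.
rewrite -card_sat_gadget.
apply: (@encode_numbering sat_graph (gadget_code sat_guest_code sat_host_code)).
  exact: (numbering_gadget numbering_sat_guest numbering_sat_host).
move=> u v; rewrite /sat_adjn -card_sat_guest -card_sat_host.
by rewrite !(gadget_adjnE numbering_sat_guest numbering_sat_host sat_nbnE).
Qed.

Lemma sat_graph_two_coloring :
  has_proper_path_coloring sat_graph 2 <-> @satisfiable m K lit.
Proof.
apply: iff_trans (stable_choiceP K_gt0 lit_lt).
exact: (gadget_two_coloring (@sat_nb_inj n m K lit K_gt0) (@sat_nb_sym n m K lit)).
Qed.

End SatNumbering.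

Lemma cmp_pred f : cmp f -> cmp (fun xs env => (f xs env).-1).
Proof. by move=> cf; apply: cmp_ext (cmp_sub cf (cmp_const 1)) => xs env; rewrite subn1. Qed.

Section SatComputable.
Variables (K : nat) (n m : seq (seq bool) -> nat) (lit : seq (seq bool) -> nat -> nat -> nat).
Hypothesis cn : cmp (fun xs _ => n xs).
Hypothesis cm : cmp (fun xs _ => m xs).
Hypothesis clit : forall f g, cmp f -> cmp g ->
  cmp (fun xs env => lit xs (f xs env) (g xs env)).

Ltac sat_step :=
  match goal with
  | |- cmp (fun xs env => lit xs (@?f xs env) (@?g xs env)) => apply (@clit f g)
  | |- cmp (fun xs env => predn (@?f xs env)) => apply (@cmp_pred f)
  end.
Ltac sat_tac := repeat first [sat_step | cmp_leaf | cmp_step | cmpb_step].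

Lemma cmp_nconstraints : cmp (fun xs _ => nconstraints (m xs) K).
Proof. by rewrite /nconstraints; sat_tac. Qed.

Lemma cmp_nsignals : cmp (fun xs _ => nsignals (n xs) (m xs) K).
Proof. by have c := cmp_nconstraints; rewrite /nsignals; sat_tac. Qed.

Lemma cmp_nslots : cmp (fun xs _ => nslots (m xs) K).
Proof. by have c := cmp_nconstraints; rewrite /nslots; sat_tac. Qed.

Lemma cmp_chain f g : cmp f -> cmp g ->
  cmp (fun xs env => chain (n xs) K (f xs env) (g xs env)).
Proof. by move=> cf cg; rewrite /chain; sat_tac. Qed.

Lemma cmp_entry f g h : cmp f -> cmp g -> cmp h ->
  cmp (fun xs env => entry (n xs) K (lit xs) (f xs env) (g xs env) (h xs env)).
Proof.
move=> cf cg ch; rewrite /entry; have cK := cmp_const K.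
have cj := cmp_div cf cK; have ck := cmp_mod cf cK.
have c1 := cmp_chain cj (cmp_succ ck); have c2 := cmp_chain cj ck.
by sat_tac.
Qed.

Lemma cmp_slot f g h : cmp f -> cmp g -> cmp h ->
  cmp (fun xs env => slot (f xs env) (g xs env) (h xs env)).
Proof. by move=> cf cg ch; rewrite /slot; sat_tac. Qed.

Lemma cmp_sat_nbn f g : cmp f -> cmp g ->
  cmp (fun xs env => sat_nbn (n xs) (m xs) K (lit xs) (f xs env) (g xs env)).
Proof.
move=> cf cg; rewrite /sat_nbn.
have cS := cmp_nsignals; have cL := cmp_nslots.
have c2 := cmp_const 2.
have cd := cmp_sub cf (cmp_mul cS cL).
have c3 := cmp_div cd c2; have c4 := cmp_mod cd c2.
have c5 := cmp_sub cg (cmp_const 1).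
have c6 := cmp_entry c3 c4 c5; have c7 := cmp_slot c3 c4 c5.
by sat_tac.
Qed.

Lemma cmp_gadget_adjn f g : cmp f -> cmp g ->
  let nh xs := nsignals (n xs) (m xs) K * nslots (m xs) K in
  let ng xs := nh xs + nconstraints (m xs) K * 2 in
  cmpb (fun xs env => gadget_adjn (nh xs) (ng xs)
    (sat_nbn (n xs) (m xs) K (lit xs)) (f xs env) (g xs env)).
Proof.
move=> cf cg nh ng; rewrite /gadget_adjn.
have cnh : cmp (fun xs _ => nh xs) := cmp_mul cmp_nsignals cmp_nslots.
have cng : cmp (fun xs _ => ng xs).
  exact: cmp_add cnh (cmp_mul cmp_nconstraints (cmp_const 2)).
have c1 := cmp_wk (cmp_sub cf (cmp_add (cmp_const 4) cnh)).
have c2 := cmp_sat_nbn c1 cmp_var.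
have cF : cmpb (fun _ _ => false) := cmp_const false.
by sat_tac.
Qed.

Lemma cmp_sat_size : cmp (fun xs _ => sat_size (n xs) (m xs) K).
Proof.
have cS := cmp_nsignals; have cL := cmp_nslots; have cE := cmp_nconstraints.
by rewrite /sat_size; sat_tac.
Qed.

Lemma cmp_sat_adjn f g : cmp f -> cmp g ->
  cmpb (fun xs env => sat_adjn (n xs) (m xs) K (lit xs) (f xs env) (g xs env)).
Proof.
move=> cf cg; rewrite /sat_adjn.
exact: cmpb_or (cmp_gadget_adjn cf cg) (cmp_gadget_adjn cg cf).
Qed.

(** A single formula for the bit at each position, the form required by [out_fun]. *)
Lemma encode_matrix N (A : nat -> bool) :
  nseq N true ++ false :: mkseq A (N * N) =
  mkseq (fun i => if i < N then true else (N < i) && A (i - N.+1)) (N + (N * N).+1).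
Proof.
apply: (@eq_from_nth _ false).
  by rewrite size_cat /= size_nseq !size_mkseq.
move=> i; rewrite size_cat /= size_nseq size_mkseq => iN.
rewrite nth_mkseq // nth_cat size_nseq.
case: ltnP => iN'; first by rewrite nth_nseq iN'.
case: ltngtP iN' => // [Ni|->] _; last by rewrite subnn.
rewrite (_ : i - N = (i - N.+1).+1) /=; last by lia.
by rewrite nth_mkseq //; lia.
Qed.

Theorem sat_graph_computable : exists eb el, forall x, let xs := [:: x; [::]] in
  out_fun eb el x =
  let N := sat_size (n xs) (m xs) K in
  nseq N true ++ false ::
    mkseq (fun k => sat_adjn (n xs) (m xs) K (lit xs) (k %/ N) (k %% N)) (N * N).
Proof.
have cN := cmp_sat_size.
have [el elE] : cmp (fun xs _ => let N := sat_size (n xs) (m xs) K in N + (N * N).+1).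
  exact: cmp_add cN (cmp_succ (cmp_mul cN cN)).
have ck := cmp_sub cmp_var (cmp_succ cN).
have [eb ebE] : cmpb (fun xs env => let N := sat_size (n xs) (m xs) K in
    let i := head 0 env in
    if i < N then true else (N < i) && sat_adjn (n xs) (m xs) K (lit xs)
      ((i - N.+1) %/ N) ((i - N.+1) %% N)).
  apply: cmpb_if.
  - exact: cmpb_leq (cmp_succ cmp_var) cN.
  - exact: (cmp_const true).
  - apply: cmpb_and; first exact: cmpb_leq (cmp_succ cN) cmp_var.
    exact: cmp_sat_adjn (cmp_div ck cN) (cmp_mod ck cN).
exists eb, el => x xs; cbv zeta; rewrite encode_matrix /out_fun /out_len elE.
apply: eq_mkseq => i; rewrite /out_bit ebE [head 0 _]/=.
by case: (if _ then _ else _).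
Qed.

End SatComputable.

(** * Hardness *)

(** With one color, proper paths are single edges, so one color suffices exactly for complete
    graphs. *)
Lemma pc_eq2P (G : cgraph) : pc G = 2 <->
  has_proper_path_coloring G 2 /\ exists u v : G, u != v /\ ~~ adj u v.
Proof.
rewrite /pc; case: ex_minnP => k /asboolP kG kmin; split=> [k2|[G2 [u [v [uv nadj]]]]].
  rewrite k2 in kG kmin; split=> //; apply: contrapT => complete.
  suff /asboolP/kmin : has_proper_path_coloring G 1 by [].
  exists [ffun=> ord0] => u v uv; exists [:: v]; split=> //.
  rewrite /proper_path /= inE uv !andbT; apply/negPn/negP => nadj.
  by apply: complete; exists u, v.
have k2 := kmin 2 (asboolT G2).
case: kG kmin => c cP; case: k k2 c cP => [|[|[|k]]] // _ c cP.
  (* With no color at all, the value at [set0] would inhabit ['I_0]. *)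
  by case: (c set0).
have [p [/and3P[pP _ pS] pv]] := cP u v uv.
case: p pP pS pv => [_ _ E|x [|y p]] /=.
- by move: uv; rewrite -E eqxx.
- by rewrite andbT => ux _ E; rewrite -E ux in nadj.
- by move=> _ /andP[]; rewrite !ord1.
Qed.

Section GadgetConnected.
Variables (G H : finType) (nb : G -> 'I_3 -> G + H).
Hypothesis nb_irr : forall g i, nb g i != inl g.
Hypothesis nb_host : forall g, exists i h, nb g i = inr h.
Notation V := (gadget_graph nb_irr).
Let hub : V := inl (inl ord0).

Lemma gadget_nontrivial : 1 < #|V|.
Proof.
by apply/card_gt1P; exists hub, (inl (inl ord_max)).
Qed.

Lemma connect_gadget_hub (u : V) : connect (@adj V) u hub.
Proof.
have host h : connect (@adj V) (inl (inr h)) hub by apply: connect1; rewrite /= /gadget_adj orbT.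
have guest g : connect (@adj V) (inr (inl g)) hub.
  have [i [h E]] := nb_host g; apply: connect_trans (connect1 _) (host h).
  by have := adj_nbv nb g i; rewrite /nbv E.
case: u => [[c|h]|[g|[g b]]] //.
  have [->|c0] := eqVneq c ord0; first exact: connect0.
  by apply: connect1; rewrite /= /gadget_adj /= c0.
apply: connect_trans (connect1 _) (guest g).
by rewrite /= adj_leaf.
Qed.

Lemma gadget_connected (u v : V) : connect (@adj V) u v.
Proof.
apply: connect_trans (connect_gadget_hub u) _.
by rewrite (sym_connect_sym (@adj_sym V)) connect_gadget_hub.
Qed.

Definition gadget_cgraph : cgraph := CGraph gadget_nontrivial gadget_connected.

End GadgetConnected.

Section Hardness.
Variables (n m K : nat) (lit : nat -> nat -> nat).

Lemma sat_nb_host (g : sat_guest n m K) : exists i h, sat_nb lit g i = inr h.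
Proof.
exists (Ordinal (isT : 2 < 3)); case: g => [[s t]|[e b]].
  by exists (signal_host s t).
by exists (inord (entry n K lit e b 1), inord (slot e b 1)).
Qed.

Hypothesis K_gt0 : 0 < K.
Hypothesis lit_lt : forall j k, j < m -> k < K -> lit j k < n.*2.+2.

Definition sat_cgraph : cgraph :=
  @gadget_cgraph _ _ _ (@sat_nb_irr n m K lit K_gt0) sat_nb_host.

Lemma pc_sat_cgraph : pc sat_cgraph = 2 <-> satisfiable m K lit.
Proof.
rewrite pc_eq2P; apply: iff_trans (sat_graph_two_coloring K_gt0 lit_lt).
split=> [[]//|G2]; split=> //.
pose g : sat_guest n m K := inl (ord0, ord0).
by exists (inr (inr (g, ord0))), (inr (inr (g, ord_max))).
Qed.

Lemma encode_sat_cgraph : let N := sat_size n m K in encode sat_cgraph =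
  nseq N true ++ false ::
    mkseq (fun k => sat_adjn n m K lit (k %/ N) (k %% N)) (N * N).
Proof. exact: (encode_sat_graph K_gt0 lit_lt). Qed.

End Hardness.

Theorem NP_reduction L : inNP L -> exists eb el, forall x,
  exists G : cgraph, out_fun eb el x = encode G /\ (L x <-> pc G = 2).
Proof.
case=> V [q [[M [p MV]] LE]].
pose Qn (xs : seq (seq bool)) := q.[size (nth [::] xs 0)]%R.
pose Tn (xs : seq (seq bool)) := p.[(size (nth [::] xs 0) + Qn xs)%N]%R.
have cQ : cmp (fun xs _ => Qn xs) by apply: cmp_poly (cmp_len false).
have cT : cmp (fun xs _ => Tn xs) by apply: cmp_poly (cmp_add (cmp_len false) cQ).
have [eb [el elE]] := @sat_graph_computable (clause_width M)
  (fun xs => nvars M (Tn xs) (Qn xs)) (fun xs => nclauses M (Tn xs) (Qn xs))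
  (fun xs => clause_lit M (nth [::] xs 0) (Tn xs) (Qn xs))
  (cmp_nvars M cT cQ) (cmp_nclauses M cT cQ)
  (fun f g => @cmp_clause_lit M _ _ cT cQ f g).
exists eb, el => x; rewrite elE {elE cQ cT}; set xs := [:: x; [::]].
exists (@sat_cgraph (nvars M (Tn xs) (Qn xs)) (nclauses M (Tn xs) (Qn xs))
  (clause_width M) (clause_lit M x (Tn xs) (Qn xs)) isT).
have ll : forall j k, j < nclauses M (Tn xs) (Qn xs) -> k < clause_width M ->
    clause_lit M x (Tn xs) (Qn xs) j k < (nvars M (Tn xs) (Qn xs)).*2.+2.
  by move=> j k; apply: clause_lit_lt.
split; first by rewrite (encode_sat_cgraph _ ll).
apply: iff_trans (iff_sym (pc_sat_cgraph _ ll)).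
apply: iff_trans (iff_sym (tableau_satisfiable M x (Tn xs) (Qn xs))).
(* Polynomials over [nat] are monotone, so by time [Tn] the verifier has halted on every certificate
   of length at most [Qn]. *)
have acc w : size w <= Qn xs -> V x w <-> accepted (run M [:: x; w] (Tn xs)).
  move=> wQ; have [hlt <-] := MV x w; rewrite /run.
  rewrite (@iter_fixed _ (@step M) _ p.[(size x + size w)%N]%R (Tn xs)) //.
    by apply: poly_mono; rewrite leq_add2l.
  by rewrite {1}/step [halting _]hlt.
rewrite LE; split=> [[w [wQ Vw]]|[w wQ aw]]; exists w => //.
  exact/acc.
by split=> //; apply/acc.
Qed.

Theorem pc_fun_NPhard : NPhard_fun pc_fun.
Proof.
move=> L /NP_reduction[eb [el elE]].
have [M [p MP]] := oracle_out_fun eb el; exists M, p => O OP x.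
have [hlt acc] := MP O x; split=> //; apply: iff_trans acc _.
have [G [-> LG]] := elE x; rewrite LG (OP (encode G) (nseq (pc G) true)); last by exists G.
by split=> [/(congr1 size)|->] //; rewrite size_nseq.
Qed.

(** * The verifier *)

Definition path_check (n : nat) (A C : nat -> nat -> bool) (P : nat -> nat) (u v l : nat) : bool :=
  [&& P 0 == u, P l == v,
      all (fun k => P k < n) (iota 0 l.+1),
      all (fun k => A (P k) (P k.+1)) (iota 0 l),
      all (fun k => (l <= k.+1) || (C (P k) (P k.+1) != C (P k.+1) (P k.+2))) (iota 0 l)
    & all (fun i => all (fun j => (j <= i) || (P i != P j)) (iota 0 l.+1)) (iota 0 l.+1)].

Definition paths_check n (A C : nat -> nat -> bool) (P : nat -> nat -> nat -> nat) : bool :=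
  all (fun u => all (fun v => (u == v) || has (path_check n A C (P u v) u v) (iota 0 n))
    (iota 0 n)) (iota 0 n).

Lemma all_iotaP n (a : pred nat) : reflect (forall i, i < n -> a i) (all a (iota 0 n)).
Proof.
apply: (iffP allP) => H i; first by move=> iN; apply: H; rewrite mem_iota.
by rewrite mem_iota => iN; apply: H.
Qed.

Lemma has_iotaP n (a : pred nat) : reflect (exists2 i, i < n & a i) (has a (iota 0 n)).
Proof.
apply: (iffP hasP) => [[i]|[i iN ai]]; last by exists i; rewrite ?mem_iota.
by rewrite mem_iota => iN ai; exists i.
Qed.

Section Check.
Variables (G : sgraph) (c : G -> nat) (d : nat -> G) (A C : nat -> nat -> bool).
Hypothesis cK : cancel c d.
Hypothesis dK : forall a, a < #|G| -> c (d a) = a.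
Hypothesis c_lt : forall u, c u < #|G|.
Hypothesis AE : forall u v, A (c u) (c v) = adj u v.
Variable P : nat -> nat -> nat -> nat.

Lemma paths_check_connected :
  paths_check #|G| A C P -> alt_connected (fun x y => C (c x) (c y)).
Proof.
move=> /all_iotaP chk u v uv.
have /all_iotaP/(_ (c v) (c_lt v))/orP[/eqP/(can_inj cK) E|] := chk _ (c_lt u).
  by rewrite E eqxx in uv.
case/has_iotaP=> l lG /and5P[/eqP P0 /eqP Pl /all_iotaP PG /all_iotaP PA
  /andP[/all_iotaP PC /all_iotaP PI]].
have cd k : k <= l -> c (d (P (c u) (c v) k)) = P (c u) (c v) k by move=> kl; rewrite dK ?PG.
apply/alt_pathP; exists l, (fun k => d (P (c u) (c v) k)); split.
- by rewrite P0 cK.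
- by rewrite Pl cK.
- by move=> i il; rewrite -AE !cd ?PA // ltnW.
- move=> i il; have := PC i (ltnW il); rewrite leqNgt il /=.
  by rewrite !cd // ?(ltnW il) // ltnW // ltnW.
- move=> i j /andP[ij jl]; have /all_iotaP/(_ j jl) := PI i (leqW (leq_trans ij jl)).
  rewrite leqNgt ij /=; apply: contraNneq => /(congr1 c).
  by rewrite !cd ?(leq_trans (ltnW ij)) // => ->.
Qed.

Lemma paths_check_complete (f : G -> G -> bool) (s : G -> G -> nat -> G) :
  (forall u v, u != v -> exists n, [/\ s u v 0 = u, s u v n = v,
    forall i, i < n -> adj (s u v i) (s u v i.+1),
    forall i, i.+1 < n -> f (s u v i) (s u v i.+1) != f (s u v i.+1) (s u v i.+2)
    & forall i j, i < j <= n -> s u v i != s u v j]) ->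
  (forall u v k, k < #|G| -> P (c u) (c v) k = c (s u v k)) ->
  (forall u v, C (c u) (c v) = f u v) ->
  paths_check #|G| A C P.
Proof.
move=> sP PE CE; apply/all_iotaP => u' /dK <-; move: (d u') => {u'} u.
apply/all_iotaP => v' /dK <-; move: (d v') => {v'} v.
case: (eqVneq u v) => [->|uv]; first by rewrite eqxx.
apply/orP; right; apply/has_iotaP; have [n [s0 sn sA sC sI]] := sP u v uv.
(* The vertices of a path are distinct, so [#|G|] certificate entries per path suffice. *)
have nG : n < #|G|.
  have inj : injective (fun i : 'I_n.+1 => s u v i).
    move=> i j E; apply/val_inj; case: (ltngtP i j) => // ij.
      by have := sI i j; rewrite E eqxx ij -ltnS ltn_ord => /(_ isT).
    by have := sI j i; rewrite E eqxx ij -ltnS ltn_ord => /(_ isT).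
  by have := leq_card _ inj; rewrite card_ord.
have PE' k : k <= n -> P (c u) (c v) k = c (s u v k).
  by move=> kn; apply: PE; apply: leq_ltn_trans nG.
exists n => //; apply/and5P; split.
- by rewrite PE' // s0.
- by rewrite PE' // sn.
- by apply/all_iotaP => k kn; rewrite PE'.
- by apply/all_iotaP => k kn; rewrite !PE' ?AE ?sA // ltnW.
apply/andP; split; apply/all_iotaP => i iN.
  case: leqP => // iN'; rewrite !PE' ?CE ?sC //; lia.
apply/all_iotaP => j jn; case: leqP => //= ij.
by rewrite !PE' // (inj_eq (can_inj cK)) sI ?ij.
Qed.

End Check.

Definition matrix_bit (x : seq bool) (n a b : nat) : bool :=
  nth false x (n.+1 + (a * n + b)).

(* A certificate consists of an n x n matrix of colors followed by the
   vertices of the paths, each written in unary on n bits. *)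
Definition cert_color (w : seq bool) (n a b : nat) : bool :=
  nth false w (if a < b then a * n + b else b * n + a).

Definition cert_vertex (w : seq bool) (n u v k : nat) : nat :=
  \sum_(a < n) nth false w (n * n + (((u * n + v) * n + k) * n + a)).

(** Connectedness comes with the paths, and the nonadjacent pair rules out a single color. *)
Definition verify_at (x w : seq bool) (n : nat) : bool :=
  [&& (1 < n) && (size x == n.+1 + n * n),
      all (fun i => nth false x i) (iota 0 n) && ~~ nth false x n,
      all (fun a => ~~ matrix_bit x n a a &&
        all (fun b => matrix_bit x n a b == matrix_bit x n b a) (iota 0 n)) (iota 0 n),
      has (fun a => has (fun b => (a != b) && ~~ matrix_bit x n a b) (iota 0 n)) (iota 0 n)
    & paths_check n (matrix_bit x n) (cert_color w n) (cert_vertex w n)].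

(** Searching for the number of vertices below the length of the input turns decoding into a bounded
    quantifier. *)
Definition verify (x w : seq bool) : bool := has (verify_at x w) (iota 0 (size x)).

Lemma cert_color_sym w n a b : cert_color w n a b = cert_color w n b a.
Proof. by rewrite /cert_color; case: ltngtP => // ->. Qed.

Lemma numbering_rank (T : finType) : numbering (fun x : T => enum_rank x : nat).
Proof.
apply: (@eq_from_nth _ 0) => [|i]; rewrite size_map; first by rewrite size_iota cardE.
move=> iT.
have iT' := iT; rewrite -cardE in iT'.
have x0 := enum_val (Ordinal iT').
rewrite (nth_map x0) // nth_iota // add0n.
by rewrite -(enum_val_nth x0 (Ordinal iT')) enum_valK.
Qed.

Lemma numbering_inverse (T : finType) (c : T -> nat) (x0 : T) : numbering c ->
  exists d, cancel c d /\ forall a, a < #|T| -> c (d a) = a.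
Proof.
move=> cN; have dK a : a < #|T| -> c (nth x0 (enum T) a) = a.
  move=> aT; rewrite -(nth_map x0 0) -?cardE // [map _ _]cN nth_iota //.
exists (nth x0 (enum T)); split=> // x.
by apply: (numbering_inj cN); rewrite dK ?numbering_lt.
Qed.

Lemma encode_matrix_bit (G : sgraph) (c : G -> nat) u v : numbering c ->
  matrix_bit (encode G) #|G| (c u) (c v) = adj u v.
Proof.
move=> cN; have [d [cK dK]] := numbering_inverse u cN.
rewrite (@encode_numbering G c (fun a b => adj (d a) (d b)) cN); last by move=> x y; rewrite !cK.
rewrite /matrix_bit nth_cat size_nseq ifF; last by lia.
rewrite (_ : _ - #|G| = (c u * #|G| + c v).+1) /=; last by lia.
rewrite nth_mkseq; last by apply: radix_lt; apply: numbering_lt.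
by rewrite radix_div ?radix_mod ?numbering_lt // !cK.
Qed.

Lemma size_encode (G : sgraph) : size (encode G) = #|G|.+1 + #|G| * #|G|.
Proof. by rewrite size_cat /= size_nseq size_allpairs -cardE addnS. Qed.

Lemma nth_encode_prefix (G : sgraph) i : i <= #|G| -> nth false (encode G) i = (i < #|G|).
Proof.
move=> iG; rewrite nth_cat size_nseq nth_nseq; case: ltngtP iG => // -> _.
by rewrite subnn.
Qed.

Lemma alt_connected_connect (G : sgraph) (f : G -> G -> bool) :
  alt_connected f -> forall u v : G, connect (@adj G) u v.
Proof.
move=> fP u v; have [->|/fP[p [/and3P[pP _ _] <-]]] := eqVneq u v; first exact: connect0.
by apply/connectP; exists p.
Qed.

Lemma verify_encode x w : verify x w -> exists G : cgraph, x = encode G.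
Proof.
case/has_iotaP=> n _ /and5P[/andP[n1 /eqP sx] /andP[/all_iotaP x1 x0] /all_iotaP mP _ pP].
have aS : symmetric (fun a b : 'I_n => matrix_bit x n a b).
  by move=> a b; have /andP[_ /all_iotaP/(_ b (ltn_ord b))/eqP] := mP a (ltn_ord a).
have aI : irreflexive (fun a b : 'I_n => matrix_bit x n a b).
  by move=> a; apply: negbTE; have /andP[] := mP a (ltn_ord a).
pose G := SGraph aS aI.
have GN : #|G| = n by rewrite card_ord.
have [d [cK dK]] := @numbering_inverse G _ (Ordinal n1) (numbering_ord n).
have con : forall u v : G, connect (@adj G) u v.
  apply: alt_connected_connect.
  apply: (@paths_check_connected G (@nat_of_ord n) d (matrix_bit x n) (cert_color w n)
    cK dK _ _ (cert_vertex w n)) => [u|//|]; last by rewrite GN.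
  by rewrite GN ltn_ord.
have nt : 1 < #|G| by rewrite GN.
exists (CGraph nt con) => /=.
rewrite (encode_numbering (G := G) (A := matrix_bit x n) (numbering_ord n)) // GN.
apply: (@eq_from_nth _ false).
  by rewrite sx size_cat /= size_nseq size_mkseq addnS.
move=> i iN; rewrite nth_cat size_nseq; case: ltngtP => [lt|gt|->].
- by rewrite x1 // nth_nseq lt.
- rewrite (_ : i - n = (i - n.+1).+1) /=; last by lia.
  rewrite nth_mkseq /matrix_bit; last by lia.
  by rewrite -divn_eq subnKC.
- by rewrite subnn /= (negbTE x0).
Qed.

Lemma verify_pc2 (G : cgraph) w : verify (encode G) w -> pc G = 2.
Proof.
case/has_iotaP=> n _ /and5P[_ /andP[/all_iotaP x1 x0] _ nadj pP].
(* In an encoding the first [false] stands at the number of vertices. *)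
have nG : n = #|G|.
  case: (ltngtP n #|G|) => // lt.
    by rewrite nth_encode_prefix ?lt // ltnW in x0.
  by have := x1 _ lt; rewrite nth_encode_prefix // ltnn.
rewrite {}nG in nadj pP.
case: (pickP G) => [u0 _|G0]; last by have := cgraph_nontrivial G; rewrite eq_card0.
have cN := numbering_rank G; have [d [cK dK]] := numbering_inverse u0 cN.
have bitE (u v : G) := encode_matrix_bit u v cN.
apply/pc_eq2P; split.
  apply/two_coloringP; exists (fun u v : G => cert_color w #|G| (enum_rank u) (enum_rank v)).
  split; first by move=> u v; apply: cert_color_sym.
  by apply: (paths_check_connected cK dK _ _ pP).
case/has_iotaP: nadj => a aG /has_iotaP[b bG /andP[ab nab]].
exists (d a), (d b); rewrite -bitE /= !dK // nab.
by split=> //; apply: contraNneq ab => /(congr1 (fun u : G => enum_rank u : nat));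
   rewrite !dK // => ->.
Qed.

Definition certificate (n : nat) (C : nat -> nat -> bool)
    (P : nat -> nat -> nat -> nat) : seq bool :=
  mkseq (fun i => if i < n * n then C (i %/ n) (i %% n)
    else let j := i - n * n in let k := j %/ n in let v := k %/ n in
      j %% n < P (v %/ n) (v %% n) (k %% n)) (n * n + n * n * n * n).

Section Certificate.
Variables (n : nat) (C : nat -> nat -> bool) (P : nat -> nat -> nat -> nat).

Lemma cert_colorE a b : (forall a b, C a b = C b a) -> a < n -> b < n ->
  cert_color (certificate n C P) n a b = C a b.
Proof.
move=> CC an bn; rewrite /cert_color.
have E a' b' : a' < n -> b' < n -> nth false (certificate n C P) (a' * n + b') = C a' b'.
  move=> an' bn'; have lt := radix_lt an' bn'.
  by rewrite nth_mkseq ?ltn_addr // lt radix_div ?radix_mod.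
by case: ifP => _; rewrite E // CC.
Qed.

Lemma cert_vertexE u v k : u < n -> v < n -> k < n -> P u v k <= n ->
  cert_vertex (certificate n C P) n u v k = P u v k.
Proof.
move=> un vn kn PN; rewrite /cert_vertex.
rewrite (eq_bigr (fun a : 'I_n => (a < P u v k) : nat)) => [|a _].
  exact: sum_ltn.
have an := ltn_ord a.
have l1 := radix_lt un vn; have l2 := radix_lt l1 kn; have l3 := radix_lt l2 an.
rewrite nth_mkseq ?ltn_add2l // ifF; last by lia.
by rewrite /= addKn !radix_mod ?(radix_div _ an, radix_div _ kn, radix_div _ vn,
  radix_mod _ kn, radix_mod _ vn).
Qed.

End Certificate.

Lemma verify_complete (G : cgraph) : pc G = 2 -> exists2 w,
  size w = #|G| * #|G| + #|G| * #|G| * #|G| * #|G| & verify (encode G) w.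
Proof.
case/pc_eq2P => /two_coloringP[f [fC fP]] [u0 [v0 [uv0 nadj]]].
have cN := numbering_rank G; have [d [cK dK]] := numbering_inverse u0 cN.
have bitE (u v : G) := encode_matrix_bit u v cN.
pose c (u : G) : nat := enum_rank u.
have c_lt u : c u < #|G| by apply: ltn_ord.
(* Paths are chosen for all pairs at once; equal vertices get a dummy one. *)
have /choice[s sP] (p : G * G) : exists s : nat -> G, p.1 != p.2 -> exists n,
    [/\ s 0 = p.1, s n = p.2,
    forall i, i < n -> adj (s i) (s i.+1),
    forall i, i.+1 < n -> f (s i) (s i.+1) != f (s i.+1) (s i.+2)
    & forall i j, i < j <= n -> s i != s j].
  have [E|/fP/alt_pathP[n [s sP]]] := eqVneq p.1 p.2; first by exists (fun=> u0).
  by exists s => _; exists n.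
pose C a b := f (d a) (d b); pose P u v k := c (s (d u, d v) k).
exists (certificate #|G| C P); first by rewrite size_mkseq.
apply/has_iotaP; exists #|G|; first by rewrite size_encode; lia.
apply/and5P; split.
- by rewrite cgraph_nontrivial size_encode eqxx.
- rewrite nth_encode_prefix // ltnn andbT; apply/all_iotaP => i iG.
  by rewrite nth_encode_prefix // ltnW.
- apply/all_iotaP => a /dK <-; rewrite bitE adj_irr /=.
  by apply/all_iotaP => b /dK <-; rewrite !bitE adj_sym.
- apply/has_iotaP; exists (c u0) => //; apply/has_iotaP; exists (c v0) => //.
  by rewrite bitE nadj andbT (inj_eq (can_inj cK)).
- apply: (paths_check_complete (c := c) cK dK _ _
    (f := f) (s := fun u v => s (u, v))) => //.
  + by move=> u v uv; apply: (sP (u, v)).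
  + by move=> u v k kG; rewrite cert_vertexE // /P ?cK // ltnW.
  + by move=> u v; rewrite cert_colorE // /C ?cK // => a b; rewrite fC.
Qed.


Lemma cmp_matrix_bit f g h : cmp f -> cmp g -> cmp h ->
  cmpb (fun xs env => matrix_bit (nth [::] xs 0) (f xs env) (g xs env) (h xs env)).
Proof. by move=> cf cg ch; rewrite /matrix_bit; cmp_tac. Qed.

Lemma cmp_cert_color f g h : cmp f -> cmp g -> cmp h ->
  cmpb (fun xs env => cert_color (nth [::] xs 1) (f xs env) (g xs env) (h xs env)).
Proof. by move=> cf cg ch; rewrite /cert_color; cmp_tac. Qed.

Lemma cmp_cert_vertex n u v k : cmp n -> cmp u -> cmp v -> cmp k ->
  cmp (fun xs env => cert_vertex (nth [::] xs 1) (n xs env) (u xs env) (v xs env) (k xs env)).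
Proof.
move=> cn cu cv ck; rewrite /cert_vertex.
apply: (@cmp_sum n (fun a xs env => nth false (nth [::] xs 1) (n xs env * n xs env +
  (((u xs env * n xs env + v xs env) * n xs env + k xs env) * n xs env + a)))) => //=.
have cn' := cmp_wk cn; have cu' := cmp_wk cu; have cv' := cmp_wk cv; have ck' := cmp_wk ck.
by apply: (@cmp_bit true); cmp_tac.
Qed.

Lemma cmp_path_check n u v l : cmp n -> cmp u -> cmp v -> cmp l ->
  cmpb (fun xs env => path_check (n xs env) (matrix_bit (nth [::] xs 0) (n xs env))
    (cert_color (nth [::] xs 1) (n xs env))
    (cert_vertex (nth [::] xs 1) (n xs env) (u xs env) (v xs env))
    (u xs env) (v xs env) (l xs env)).
Proof.
move=> cn cu cv cl; rewrite /path_check.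
have cP := cmp_cert_vertex cn cu cv.
have cn1 := cmp_wk cn; have cu1 := cmp_wk cu; have cv1 := cmp_wk cv; have cl1 := cmp_wk cl.
have cP1 := cmp_cert_vertex cn1 cu1 cv1.
pose P xs env := cert_vertex (nth [::] xs 1) (n xs env) (u xs env) (v xs env).
have k0 := cmp_var; have k1 := cmp_succ k0; have k2 := cmp_succ k1.
do 2 (apply: cmpb_and; first by apply: cmpb_eq => //; apply: cP => //; exact: cmp_const).
apply: cmpb_and.
  apply: (@cmpb_all (fun xs env => (l xs env).+1)
    (fun k xs env => P xs env k < n xs env)).
    exact: cmp_succ.
  by apply: cmpb_leq cn1; apply/cmp_succ/cP1.
apply: cmpb_and.
  apply: (@cmpb_all l (fun k xs env => matrix_bit (nth [::] xs 0) (n xs env)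
    (P xs env k) (P xs env k.+1))) => //.
  by apply: cmp_matrix_bit => //; apply: cP1.
apply: cmpb_and.
  apply: (@cmpb_all l (fun k xs env => (l xs env <= k.+1) ||
    (cert_color (nth [::] xs 1) (n xs env) (P xs env k) (P xs env k.+1) !=
     cert_color (nth [::] xs 1) (n xs env) (P xs env k.+1) (P xs env k.+2)))) => //.
  apply: cmpb_or; first exact: cmpb_leq cl1 k1.
  by apply/cmpb_neg/cmpb_eqb; apply: cmp_cert_color => //; apply: cP1.
apply: (@cmpb_all (fun xs env => (l xs env).+1) (fun i xs env =>
  all (fun j => (j <= i) || (P xs env i != P xs env j)) (iota 0 (l xs env).+1))); first exact: cmp_succ.
apply: (@cmpb_all (fun xs env => (l xs (behead env)).+1) (fun j xs env =>
  (j <= head 0 env) || (P xs (behead env) (head 0 env) != P xs (behead env) j))); first exact: cmp_succ.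
apply: cmpb_or; first exact: cmpb_leq k0 (cmp_wk k0).
have cP2 := cmp_cert_vertex (cmp_wk cn1) (cmp_wk cu1) (cmp_wk cv1).
by apply/cmpb_neg/cmpb_eq; [exact: cP2 (cmp_wk k0)|exact: cP2 k0].
Qed.

Lemma cmp_paths_check n : cmp n ->
  cmpb (fun xs env => paths_check (n xs env) (matrix_bit (nth [::] xs 0) (n xs env))
    (cert_color (nth [::] xs 1) (n xs env)) (cert_vertex (nth [::] xs 1) (n xs env))).
Proof.
move=> cn; rewrite /paths_check.
have cn1 := cmp_wk cn; have cn2 := cmp_wk cn1; have cn3 := cmp_wk cn2.
have c := cmp_path_check cn3 (cmp_wk (cmp_wk cmp_var)) (cmp_wk cmp_var) cmp_var.
by cmp_tac.
Qed.

Lemma cmp_verify : cmpb (fun xs _ => verify (nth [::] xs 0) (nth [::] xs 1)).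
Proof.
rewrite /verify /verify_at.
have k0 := cmp_var; have k1 := cmp_wk k0; have k2 := cmp_wk k1.
have c1 := cmp_paths_check k0.
have c2 := cmp_matrix_bit k1 k0 k0.
have c3 := cmp_matrix_bit k2 k1 k0.
have c4 := cmp_matrix_bit k2 k0 k1.
by cmp_tac.
Qed.

Theorem pc_eq2_inNP : inNP pc_eq2_yes.
Proof.
have [e eE] := cmp_verify.
have [|q qP] := @poly_boundedP (fun n => n * n + n * n * n * n).
  by do ?[apply: poly_bounded_add | apply: poly_bounded_mul | exact: poly_bounded_id].
exists (fun x w => 0 < eval [:: x; w] [::] e), q; split; first exact: polytime_rel_expr.
move=> x; split=> [[G [-> G2]]|[w [_]]]; last first.
  rewrite eE /= lt0b => vw; have [G E] := verify_encode vw.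
  by exists G; split=> //; move: vw; rewrite E => /verify_pc2.
have [w wE vw] := verify_complete G2; exists w; rewrite eE /= vw; split=> //.
have nG : #|G| <= size (encode G) by rewrite size_encode; lia.
by rewrite wE; apply: leq_trans (qP _); rewrite leq_add ?leq_mul.
Qed.

Theorem pc_eq2_NPhard : NPhard pc_eq2.
Proof.
move=> L /NP_reduction[eb [el elE]]; exists (out_fun eb el).
split=> [|x]; first exact: polytime_out_fun.
have [G [-> LG]] := elE x; split; first by exists G.
(* A yes-instance only provides some [H] with the same encoding. The verifier sees nothing but the
   encoding, so a certificate for [H] shows [pc G = 2]. *)
rewrite LG; split=> [G2|[H [E /verify_complete[w _]]]]; first by exists G.
by rewrite -E => /verify_pc2.
Qed.

Theorem theorem2p1 : NPcomplete pc_eq2 /\ NPhard_fun pc_fun.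
Proof. by split; [split; [exact: pc_eq2_inNP|exact: pc_eq2_NPhard]|exact: pc_fun_NPhard]. Qed.
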